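(* Let $(C;p_1,\dots,p_n)$, $n=g+3$, be a smooth MHV M-curve of genus $g$ of type $?\in\{A,B\}$, and let $\Lambda:\mathrm{Pic}^{g+1}C\dashrightarrow M_{0,n}$ be its scattering amplitude map. Then $$\Lambda^{-1}\big(M^{?}_{0,n}(\mathbb R)\big)\subset\mathrm{Pic}^{g+1}(\mathbb R).$$ Moreover, the restriction of $\Lambda$ to any of the $2^g$ connected components $\mathrm{Pic}^{g+1}_I(\mathbb R)$ of $\mathrm{Pic}^{g+1}(\mathbb R)$ is injective (where $\Lambda$ is defined).
   Context: An M-curve is a smooth projective complex curve $C$ of genus $g$ with a real structure (anti-holomorphic involution $p\mapsto\bar p$) such that $C(\mathbb R)$ has $g+1$ connected components $C_1,\dots,C_{g+1}$ (ovals). A smooth MHV M-curve is an M-curve with $n=g+3$ distinct marked points such that the divisor $p_1+\dots+p_n$ is preserved by complex conjugation and one of the following holds: (type A) all marked points are real, and every component of $C(\mathbb R)$ contains one marked point except for one component, which contains three; (type B) all but two marked points are real, one on each component of $C(\mathbb R)$, and the remaining two are complex conjugate. $M^A_{0,n}(\mathbb R)=M_{0,n}(\mathbb R)$ is the moduli space of $n$ distinct real points of $\mathbb P^1(\mathbb C)$; $M^B_{0,n}(\mathbb R)$ is the moduli space of $n$ distinct points of $\mathbb P^1(\mathbb C)$, $n-2$ of them real and two complex conjugate (the conjugate pair carrying the labels of the conjugate pair of marked points). Both are viewed in $M_{0,n}(\mathbb C)$. $\mathrm{Pic}^{g+1}(\mathbb R)$ is the real locus of $\mathrm{Pic}^{g+1}C$;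 it has $2^g$ connected components $\mathrm{Pic}^{g+1}_I(\mathbb R)$ indexed by $I\subset\{1,\dots,g+1\}$ with $|I|\equiv g+1\bmod2$: for a conjugation-invariant divisor $D$, $\mathcal O(D)\in\mathrm{Pic}_I$ iff ($\deg(D\cap C_i)$ is odd $\Leftrightarrow i\in I$). The scattering amplitude map is $\Lambda(L)=(\phi_L(p_1),\dots,\phi_L(p_n))$, where $\phi_L:C\to\mathbb P^1$ is the degree $g+1$ morphism given by $|L|$; it is defined on line bundles $L$ of degree $g+1$ which are globally generated with $h^0(L)=2$ and for which the points $\phi_L(p_i)$ are distinct (the complement of the divisors $E$ and $E_{ij}$, where $E=\{\omega_C(p-x_1-\dots-x_{g-2})\}$ and $E_{ij}=\{\omega_C(-x_1-\dots-x_{g-1}+p_i+p_j)\}$, $p,x_k\in C$). *)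

(* Defs.v *)
From HB Require Import structures.
From mathcomp Require Import all_boot all_order all_algebra.
From mathcomp Require Import complex.
From mathcomp Require Import all_classical all_reals all_analysis.

Set Implicit Arguments.
Unset Strict Implicit.
Unset Printing Implicit Defensive.

Import Order.TTheory GRing.Theory Num.Theory.
Import numFieldNormedType.Exports.

Local Open Scope classical_set_scope.
Local Open Scope ring_scope.
Local Open Scope complex_scope.

(* Smooth projective complex curves are taken in their analytic incarnation, as
   compact connected Riemann surfaces. The complex numbers are [R[i]], and
   [R[i]^o] is [R[i]] seen as a normed space over itself, so that
   [derivable f z 1] is complex differentiability of [f] at [z].

   A chart [c] is a homeomorphism [rs_coord c] from the open set [rs_dom c]
   onto the open set [rs_cod c], with inverse [rs_param c]; the values of
   [rs_coord c] and [rs_param c] elsewhere are irrelevant. *)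
Record curve (R : realType) := Curve {
  rs_pt :> topologicalType;
  rs_chart : Type;
  rs_dom : rs_chart -> set rs_pt;
  rs_cod : rs_chart -> set R[i]^o;
  rs_coord : rs_chart -> rs_pt -> R[i]^o;
  rs_param : rs_chart -> R[i]^o -> rs_pt;
  rs_dom_open : forall c, open (rs_dom c);
  rs_cod_open : forall c, open (rs_cod c);
  rs_coord_cod : forall c x, rs_dom c x -> rs_cod c (rs_coord c x);
  rs_param_dom : forall c z, rs_cod c z -> rs_dom c (rs_param c z);
  rs_coordK : forall c x, rs_dom c x -> rs_param c (rs_coord c x) = x;
  rs_paramK : forall c z, rs_cod c z -> rs_coord c (rs_param c z) = z;
  rs_coord_continuous :
    forall c x, rs_dom c x -> {for x, continuous (rs_coord c)};
  rs_param_continuous :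
    forall c z, rs_cod c z -> {for z, continuous (rs_param c)};
  rs_cover : forall x, exists c, rs_dom c x;
  rs_transition : forall c d z, rs_cod c z -> rs_dom d (rs_param c z) ->
    derivable (rs_coord d \o rs_param c) z 1;
  rs_hausdorff : hausdorff_space rs_pt;
  rs_nonempty : [set: rs_pt] !=set0;
  rs_compact : compact [set: rs_pt];
  rs_connected : connected [set: rs_pt]
}.

Section Curve.
Context (R : realType) (X : curve R).
Implicit Types (x : X) (c d : rs_chart X) (f h : X -> R[i]) (D : X -> int).

(* A holomorphic differential is given by its coefficient [w c], [w c z dz],
   in each chart [c]. *)
Definition holo_form (w : rs_chart X -> R[i]^o -> R[i]^o) :=
  (forall c z, rs_cod c z -> derivable (w c) z 1) /\
  (forall c d z, rs_cod c z -> rs_dom d (rs_param c z) ->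
     w c z = w d (rs_coord d (rs_param c z)) *
             derive1 (rs_coord d \o rs_param c) z).

(* The genus is the dimension of the space of holomorphic differentials. *)
Definition has_genus (g : nat) :=
  exists s : 'I_g -> rs_chart X -> R[i]^o -> R[i]^o,
    (forall k, holo_form (s k)) /\
    (forall w, holo_form w -> exists! a : 'rV[R[i]]_g,
       forall c z, rs_cod c z -> w c z = \sum_k a 0 k * s k c z).

Definition holo_near h x :=
  exists2 c, rs_dom c x &
    \forall z \near rs_coord c x, derivable (h \o rs_param c : R[i]^o -> R[i]^o) z 1.

(* In a punctured neighbourhood of [x], [f = t ^ k * h], where
   [t := rs_coord c - rs_coord c x] is a local coordinate at [x] and [h] is
   holomorphic at [x]. Meromorphic functions are represented by functions
   [X -> R[i]] whose values are irrelevant on a finite set, whence the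
   punctured neighbourhood here and in [mero_eq]. *)
Definition local_form f x (k : int) c h :=
  [/\ rs_dom c x, holo_near h x &
      \forall y \near x^', f y = (rs_coord c y - rs_coord c x : R[i]) ^ k * h y].

Definition mero_eq f1 f2 := forall x, \forall y \near x^', f1 y = f2 y.

Definition is_divisor D := finite_set [set x | D x != 0].

Definition degree D : int := \sum_(x \in [set: X]) D x.

(* Line bundles are represented by divisors, [D] standing for O(D), up to linear
   equivalence: [D1 - D2 = div f] for some meromorphic [f]. *)
Definition lin_equiv D1 D2 :=
  exists f, forall x, exists c h,
    local_form f x (D1 x - D2 x) c h /\ h x != 0.

(* Global sections of O(D), i.e. meromorphic [f] with [div f + D >= 0]. In the
   trivialization of O(D) near [x] by [t ^ (- D x)], [f] becomes the holomorphic
   function [h] of its local form. *)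
Definition is_section D f :=
  forall x, exists c h, local_form f x (- D x) c h.

Definition section_basis D m (s : 'I_m -> X -> R[i]) :=
  (forall k, is_section D (s k)) /\
  (forall f, is_section D f -> exists! a : 'rV[R[i]]_m,
     mero_eq f (fun y => \sum_k a 0 k * s k y)).

Definition has_h0 D m := exists s : 'I_m -> X -> R[i], section_basis D s.

Definition globally_generated D :=
  forall x, exists f c h,
    [/\ is_section D f, local_form f x (- D x) c h & h x != 0].

(* Points of P^1 are given by homogeneous coordinates, nonzero vectors in
   ['rV[R[i]]_2] up to equality of the spanned lines, [(v == w)%MS].
   [morphism_at D s x v] : [v] is a vector of homogeneous coordinates of the
   image of [x] under the map [s 0 : s 1] to P^1 given by a basis [s] of
   H^0(O(D)). *)
Definition morphism_at D (s : 'I_2 -> X -> R[i]) x (v : 'rV[R[i]]_2) :=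
  exists c (h : 'I_2 -> X -> R[i]),
    forall k, local_form (s k) x (- D x) c (h k) /\ v 0 k = h k x.

End Curve.

(* Points of M_{0,n}(C): configurations of distinct points of P^1 modulo
   PGL_2(C). *)
Definition distinct_config (R : realType) n (v : 'I_n -> 'rV[R[i]]_2) :=
  (forall i, v i != 0) /\ (forall i j, i != j -> ~~ (v i == v j)%MS).

Definition config_equiv (R : realType) n (v w : 'I_n -> 'rV[R[i]]_2) :=
  exists2 M : 'M[R[i]]_2, M \in unitmx & forall i, (v i *m M == w i)%MS.

(* [Lambda] maps the class of [D] to the class of [v]. *)
Definition amplitude (R : realType) (X : curve R) g (p : 'I_g.+3 -> X)
    (D : X -> int) (v : 'I_g.+3 -> 'rV[R[i]]_2) :=
  [/\ is_divisor D, degree D = g.+1%:Z, has_h0 D 2 & globally_generated D] /\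
  (distinct_config v /\
   exists s, section_basis D s /\ forall i, morphism_at D s (p i) (v i)).

Section RealStructure.
Context (R : realType) (X : curve R) (sigma : X -> X).

Definition antiholomorphic :=
  forall (c d : rs_chart X) z, rs_cod c z -> rs_dom d (sigma (rs_param c z)) ->
    derivable ((fun w => conjc (rs_coord d (sigma (rs_param c w))))
                 : R[i]^o -> R[i]^o) z 1.

Definition real_structure :=
  [/\ involutive sigma, continuous sigma & antiholomorphic].

Definition real_points : set X := [set x | sigma x = x].

Definition m_curve g (oval : 'I_g.+1 -> set X) :=
  [/\ has_genus X g, real_structure, injective oval &
      [set connected_component real_points x | x in real_points] = range oval].

(* The real locus of Pic, sigma acting on O(D) by conjugation of [D]. *)
Definition pic_real (D : X -> int) := lin_equiv (D \o sigma) D.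

Definition pic_component g (oval : 'I_g.+1 -> set X) (I : {set 'I_g.+1})
    (D : X -> int) :=
  exists D' : X -> int,
    [/\ is_divisor D', lin_equiv D D', forall x, D' (sigma x) = D' x &
        forall j, odd `|(\sum_(x \in oval j) D' x)%R|%N = (j \in I)].

End RealStructure.

(* In type B, the labels of the pair of conjugate marked points are recorded. *)
Inductive mhv_type (n : nat) := TypeA | TypeB of 'I_n & 'I_n.
Arguments TypeA {n}.

Definition marked_on (R : realType) (X : curve R) n (p : 'I_n -> X)
    (S : set X) : {set 'I_n} :=
  [set i | `[< S (p i) >]]%SET.

Definition smooth_mhv (R : realType) (X : curve R) (sigma : X -> X) g
    (oval : 'I_g.+1 -> set X) (p : 'I_g.+3 -> X) (ty : mhv_type g.+3) :=
  [/\ m_curve sigma oval, injective p,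
      forall i, exists j, sigma (p i) = p j &
      match ty with
      | TypeA =>
          (forall i, real_points sigma (p i)) /\
          exists j0, #|marked_on p (oval j0)| = 3%N /\
            forall j, j != j0 -> #|marked_on p (oval j)| = 1%N
      | TypeB a b =>
          [/\ a != b, sigma (p a) = p b,
              forall i, i != a -> i != b -> real_points sigma (p i) &
              forall j, #|marked_on p (oval j)| = 1%N]
      end].

Definition p1_conj (R : realType) (v : 'rV[R[i]]_2) : 'rV[R[i]]_2 :=
  map_mx (@conjc R) v.

(* The class of [v] lies in M^A_{0,n}(R), resp. M^B_{0,n}(R). *)
Definition real_moduli (R : realType) n (ty : mhv_type n)
    (v : 'I_n -> 'rV[R[i]]_2) :=
  exists w, [/\ distinct_config w, config_equiv v w &
    match ty with
    | TypeA => forall i, (p1_conj (w i) == w i)%MS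
    | TypeB a b => (p1_conj (w a) == w b)%MS /\
        forall i, i != a -> i != b -> (p1_conj (w i) == w i)%MS
    end].

(* Main.v *)
(** Let s be a basis of H^0(O(D)). For the first part compare it with t = conj(s o sigma),
    a basis of H^0(O(sigma D)); for the second, with a basis t of H^0(O(D')), both bases being
    normalized so that their values at the marked points agree as points of P^1. The
    determinant s_0 t_1 - s_1 t_0 is then a section, vanishing at the g + 3 marked points, of a
    line bundle of degree 2g + 2 isomorphic to O(E), with E conjugation-invariant and of even
    degree on every oval. If such a section were nonzero, its real or imaginary part would give
    a nonzero real one, with an even number of zeros on each oval; as each oval carries an odd
    number of marked points, there would be a further zero on each of the g + 1 ovals, hence
    at least 2g + 4 zeros. So the determinant vanishes, and t_0 / s_0 is a meromorphic function
    whose divisor is the difference of the two line bundles.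

    That a meromorphic function f has degree 0, and even degree on every oval when it is real,
    follows from the pencil (1 - t) + t f, t real: by Hurwitz' theorem, the degree and the parity
    do not depend on t (nonreal zeros of real functions being paired by conjugation), and t = 0
    gives a constant. *)

Require Import Defs.
From HB Require Import structures.
From mathcomp Require Import all_boot all_order all_algebra.
From mathcomp Require Import complex.
From mathcomp Require Import all_classical all_reals all_analysis.
From mathcomp Require Import ring lra zify.

Set Implicit Arguments.
Unset Strict Implicit.
Unset Printing Implicit Defensive.

Import Order.TTheory GRing.Theory Num.Theory.
Import numFieldNormedType.Exports.
Import ComplexField.

Local Open Scope classical_set_scope.
Local Open Scope ring_scope.
Local Open Scope complex_scope.

(** The analysis starts from complex differentiability at points alone. A single integral is needed:
    in logarithmic polar coordinates, the vanishing of the circulation of a closed form around a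
    rectangle says that the mean of Re f over a circle does not depend on the radius, even if f is
    merely continuous at the centre. Hence the maximum principle, with isolated exceptional points,
    and from it the holomorphy of divided differences. Dividing out zeros one at a time replaces
    Taylor expansions and winding numbers.

    Zeros on ovals are counted without parametrizing the ovals. An oval is closed and so is the rest
    of the real locus, so that a small conjugation-invariant neighbourhood of one of its points
    meets the real locus in the oval only; zeros can leave the oval only in conjugate pairs.

    A change of chart multiplies the leading coefficients of all functions at a given exponent by a
    common factor; thus a pair of sections defines a point of P^1, and proportional pairs at a
    marked point give the determinant one more order. *)

Notation modc := Normc.normc.

(** * The modulus as a real number *)

Section Modulus.
Variable R : realType.
Implicit Types z w : R[i].

Lemma normcE z : `|z| = (modc z)%:C.
Proof. by []. Qed.

Lemma modc_ge0 z : 0 <= modc z.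
Proof. by case: z => a b; rewrite /= sqrtr_ge0. Qed.

Lemma ler_modcD z w : modc (z + w) <= modc z + modc w.
Proof. by have := ler_normD z w; rewrite !normcE -rmorphD /= lecR. Qed.

Lemma modcN z : modc (- z) = modc z.
Proof. by case: z => a b /=; rewrite !sqrrN. Qed.

Lemma modcB z w : modc (z - w) = modc (w - z).
Proof. by rewrite -modcN opprB. Qed.

Lemma modc_eq0 z : (modc z == 0) = (z == 0).
Proof. by apply/eqP/eqP => [/Normc.eq0_normc//|->]; exact: Normc.normc0. Qed.

Lemma modc_gt0 z : (0 < modc z) = (z != 0).
Proof. by rewrite lt_def modc_ge0 andbT modc_eq0. Qed.

Lemma modcX z n : modc (z ^+ n) = modc z ^+ n.
Proof.
by elim: n => [|n IHn]; rewrite ?expr0 ?Normc.normc1// !exprS Normc.normcM IHn.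
Qed.

Lemma modc_real (x : R) : modc x%:C = `|x|.
Proof. by rewrite /= expr0n /= addr0 sqrtr_sqr. Qed.

Lemma Re_le_modc z : `|complex.Re z| <= modc z.
Proof.
by case: z => a b /=; rewrite -sqrtr_sqr ler_sqrt ?addr_ge0 ?sqr_ge0// lerDl sqr_ge0.
Qed.

Lemma Im_le_modc z : `|complex.Im z| <= modc z.
Proof.
by case: z => a b /=; rewrite -sqrtr_sqr ler_sqrt ?addr_ge0 ?sqr_ge0// lerDr sqr_ge0.
Qed.

(** Balls of [R[i]^o] have complex radii, but a positive complex number is real, which turns them
    into discs of real radius. *)
Lemma nearcP z0 (P : set R[i]^o) :
  (\forall z \near z0 : R[i]^o, P z) <->
  exists2 d : R, 0 < d & forall z, modc (z - z0) < d -> P z.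
Proof.
split=> [/nbhs_ballP[e /= e0 eP]|[d d0 dP]].
  case: e e0 eP => e e' /andP[/eqP /= -> e0] eP; exists e => // z zd.
  by apply: eP; rewrite /ball /= normcE modcB ltcR.
apply/nbhs_ballP; exists d%:C; rewrite /= ?ltcR// => z.
by rewrite /ball /= normcE modcB ltcR => /dP.
Qed.

End Modulus.

(** * Goursat's argument for closed forms on rectangles *)

Section Green.
Variable R : realType.

Lemma divr_expr2_lt (x d : R) : 0 < d -> exists n, x / 2 ^+ n < d.
Proof.
move=> d0; exists (Num.trunc (x / d)).+1.
rewrite ltr_pdivrMr ?exprn_gt0// mulrC -ltr_pdivrMr//.
apply: lt_trans (truncnS_gt _) _.
by rewrite -natrX ltr_nat ltn_expl.
Qed.

Lemma continuous_primitive (f : R -> R) (A B : R) : continuous f -> A < B ->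
  exists F : R -> R, forall x, A < x < B -> is_derive x 1 F (f x).
Proof.
move=> cf AB; exists (fun x => \int[lebesgue_measure]_(t in `[A, x]) f t) => x /andP[Ax xB].
have fi : lebesgue_measure.-integrable `[A, B] (EFin \o f).
  apply: continuous_compact_integrable; first exact: segment_compact.
  exact: continuous_subspaceT.
have Ax1 : (BLeft A < BRight x)%E by rewrite /= lte_fin.
have [d1 <-] := continuous_FTC1 xB fi Ax1 (cf x).
by rewrite derive1E; exact/derivableP.
Qed.

(** Integrals appear as differences of values of a primitive; the derivative is two-sided even at
    the endpoints. *)
Definition primitive_on (G g : R -> R) (a b : R) :=
  forall x, a <= x <= b -> is_derive x 1 G (g x).

Lemma primitive_mean (G g : R -> R) (s t c : R) :
  s <= t -> primitive_on G g s t -> (forall x, s <= x <= t -> g x <= c) ->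
  G t - G s <= c * (t - s).
Proof.
move=> st Gg gc.
have [||x] := @MVT_segment R G g s t st.
- by move=> x /andP[]; rewrite !bnd_simp => sx xt; apply: Gg; rewrite !ltW.
- apply: derivable_within_continuous => x /andP[]; rewrite !bnd_simp => sx xt.
  by have /Gg : s <= x <= t by rewrite sx.
- rewrite in_itv /= => xst ->.
  by rewrite ler_wpM2r ?subr_ge0// gc.
Qed.

Lemma primitive_affine_dist (G g : R -> R) (s t p q e : R) :
  s <= t -> primitive_on G g s t ->
  (forall x, s <= x <= t -> `|g x - (p + q * x)| <= e) ->
  `|G t - G s - (p * (t - s) + q * (t ^+ 2 - s ^+ 2) / 2)| <= e * (t - s).
Proof.
move=> st Gg ge.
pose L := fun x : R => p * x + q * x ^+ 2 / 2.
have LE u v : L u - L v = p * (u - v) + q * (u ^+ 2 - v ^+ 2) / 2 by rewrite /L; field.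
have dL (x : R) : is_derive x 1 L (p + q * x).
  rewrite /L; apply: is_derive_eq.
  by rewrite /= !scaler1 !scaler0 /GRing.scale /=; field.
rewrite -LE ler_norml; apply/andP; split.
  have := @primitive_mean (L \- G) (fun x => p + q * x - g x) s t e st.
  rewrite /= => H; suff: L t - G t - (L s - G s) <= e * (t - s) by lra.
  apply: H => [x xst|x xst].
    by have := Gg _ xst => ?; apply: is_deriveB.
  by have := ge _ xst; rewrite ler_norml => /andP[]; lra.
have := @primitive_mean (G \- L) (fun x => g x - (p + q * x)) s t e st.
rewrite /= => H; suff: G t - L t - (G s - L s) <= e * (t - s) by lra.
apply: H => [x xst|x xst].
  by have := Gg _ xst => ?; apply: is_deriveB.
by have := ge _ xst; rewrite ler_norml => /andP[]; lra.
Qed.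

Section Rectangles.
Variables (P Q GP GQ : R -> R -> R) (a b c d : R).
Hypothesis ab : a < b.
Hypothesis cd : c < d.
Hypothesis GPP : forall y, c <= y <= d -> primitive_on (GP y) (P^~ y) a b.
Hypothesis GQQ : forall x, a <= x <= b -> primitive_on (GQ x) (Q x) c d.

(** The numbers [p], [q], [r] are P_x, P_y = Q_x and Q_y: the form P dx + Q dy is differentiable at
    this point and closed there. No uniformity in the point is assumed, whence the subdivision
    argument below. *)
Definition closed_at (P Q : R -> R -> R) (x0 y0 : R) :=
  exists p q r : R, forall e, 0 < e -> exists2 dl, 0 < dl &
    forall x y, `|x - x0| < dl -> `|y - y0| < dl ->
    `|P x y - P x0 y0 - p * (x - x0) - q * (y - y0)| <= e * (`|x - x0| + `|y - y0|) /\
    `|Q x y - Q x0 y0 - q * (x - x0) - r * (y - y0)| <= e * (`|x - x0| + `|y - y0|).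

Hypothesis PQ : forall x y, a <= x <= b -> c <= y <= d -> closed_at P Q x y.

(** The counterclockwise circulation of P dx + Q dy around the rectangle [s, t] x [u, v]. *)
Let J s t u v := (GQ t v - GQ t u) - (GQ s v - GQ s u)
  - (GP v t - GP v s) + (GP u t - GP u s).

(** The affine parts of [P] and [Q] have no circulation, because they share the coefficient [q].
    Each side contributes an error of at most its length times e / 2 times the half-perimeter. *)
Lemma closed_rectangle_small x0 y0 (e : R) : a <= x0 <= b -> c <= y0 <= d -> 0 < e ->
  exists2 dl, 0 < dl & forall s t u v, a <= s -> s <= x0 <= t -> t <= b ->
    c <= u -> u <= y0 <= v -> v <= d -> t - s < dl -> v - u < dl ->
    `|J s t u v| <= e * (t - s + (v - u)) ^+ 2.
Proof.
move=> x0ab y0cd e0.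
have [p [q [r /(_ (e / 2))]]] := PQ x0ab y0cd.
case=> [|dl dl0 H]; first by rewrite divr_gt0.
exists dl => // s t u v as_ /andP[sx xt] tb cu /andP[uy yv] vd std uvd.
have H1 y : u <= y <= v ->
    `|GP y t - GP y s - ((P x0 y0 - p * x0 + q * (y - y0)) * (t - s) + p * (t ^+ 2 - s ^+ 2) / 2)|
    <= (e / 2 * (t - s + (v - u))) * (t - s).
  move=> /andP[uy' yv']; apply: (@primitive_affine_dist _ (P^~ y)).
  - lra.
  - by move=> x xst; apply: GPP; lra.
  - move=> x xst; have [||h _] := H x y; try by rewrite ltr_norml; lra.
    apply: le_trans (_ : e / 2 * (`|x - x0| + `|y - y0|) <= _).
      by rewrite (_ : _ - _ = P x y - P x0 y0 - p * (x - x0) - q * (y - y0)) //; ring.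
    by rewrite ler_pM2l ?divr_gt0// lerD// ler_norml; lra.
have H2 x : s <= x <= t ->
    `|GQ x v - GQ x u - ((Q x0 y0 - r * y0 + q * (x - x0)) * (v - u) + r * (v ^+ 2 - u ^+ 2) / 2)|
    <= (e / 2 * (t - s + (v - u))) * (v - u).
  move=> /andP[sx' xt']; apply: (@primitive_affine_dist _ (Q x)).
  - lra.
  - by move=> y yst; apply: GQQ; lra.
  - move=> y yst; have [||_ h] := H x y; try by rewrite ltr_norml; lra.
    apply: le_trans (_ : e / 2 * (`|x - x0| + `|y - y0|) <= _).
      by rewrite (_ : _ - _ = Q x y - Q x0 y0 - q * (x - x0) - r * (y - y0)) //; ring.
    by rewrite ler_pM2l ?divr_gt0// lerD// ler_norml; lra.
have Hu : u <= u <= v by lra.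
have Hv : u <= v <= v by lra.
have Hs : s <= s <= t by lra.
have Ht : s <= t <= t by lra.
have := H1 _ Hu; have := H1 _ Hv; have := H2 _ Hs; have := H2 _ Ht.
rewrite /J !ler_norml.
set E1 := e / 2 * _.
have -> : e * (t - s + (v - u)) ^+ 2 = 2 * (E1 * (t - s)) + 2 * (E1 * (v - u)) by rewrite /E1; field.
lra.
Qed.

(** Selects a quarter carrying at least its share of the circulation. The last one is taken by
    default; [corner_big] shows that it qualifies when the other three do not. *)
Let quarter (e W H : R) (n : nat) (su : R * R) : R * R :=
  let w := W / 2 ^+ n.+1 in let h := H / 2 ^+ n.+1 in
  let big s u := e / 4 ^+ n.+1 < `|J s (s + w) u (u + h)| in
  if big su.1 su.2 then su
  else if big (su.1 + w) su.2 then (su.1 + w, su.2)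
  else if big su.1 (su.2 + h) then (su.1, su.2 + h)
  else (su.1 + w, su.2 + h).

Fixpoint corner (e : R) (n : nat) : R * R :=
  if n is m.+1 then quarter e (b - a) (d - c) m (corner e m) else (a, c).

Let wd n := (b - a) / 2 ^+ n.
Let ht n := (d - c) / 2 ^+ n.

Let wdS n : wd n = wd n.+1 + wd n.+1.
Proof. by rewrite /wd exprS; field. Qed.

Let htS n : ht n = ht n.+1 + ht n.+1.
Proof. by rewrite /ht exprS; field. Qed.

Let wd_gt0 n : 0 < wd n.
Proof. by rewrite divr_gt0 ?subr_gt0// exprn_gt0. Qed.

Let ht_gt0 n : 0 < ht n.
Proof. by rewrite divr_gt0 ?subr_gt0// exprn_gt0. Qed.

Lemma corner_step e n : let q := corner e n in let q' := corner e n.+1 in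
  (q.1 <= q'.1 /\ q'.1 + wd n.+1 <= q.1 + wd n) /\
  (q.2 <= q'.2 /\ q'.2 + ht n.+1 <= q.2 + ht n).
Proof.
rewrite /= /quarter -/(wd n.+1) -/(ht n.+1) (wdS n) (htS n).
have := wd_gt0 n.+1; have := ht_gt0 n.+1.
by case: ifP => _ /=; [|case: ifP => _ /=; [|case: ifP => _ /=]] => h0 w0;
  split; split; lra.
Qed.

Lemma corner_big e : 0 <= e -> e < `|J a b c d| -> forall n,
  let q := corner e n in e / 4 ^+ n < `|J q.1 (q.1 + wd n) q.2 (q.2 + ht n)|.
Proof.
move=> e0 eJ; elim=> [|n IHn] /=.
  by rewrite /wd /ht !expr0 !divr1 !addrA ![_ + _ - _]addrAC !subrr !add0r.
move: IHn; rewrite /= /quarter -/(wd n.+1) -/(ht n.+1) wdS htS.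
set q := corner e n; set w := wd n.+1; set h := ht n.+1; set E := e / 4 ^+ n.+1.
have -> : e / 4 ^+ n = 4 * E by rewrite /E exprS; field.
case: ifP => // /negbT; rewrite -leNgt => l1; case: ifP => // /negbT; rewrite -leNgt => l2.
case: ifP => // /negbT; rewrite -leNgt => l3 /=; rewrite !ltNge => l4; apply/negP => l5.
move/negP: l4; apply.
(* The contributions of the inner sides cancel. *)
have -> : J q.1 (q.1 + (w + w)) q.2 (q.2 + (h + h)) =
    J q.1 (q.1 + w) q.2 (q.2 + h) + J (q.1 + w) (q.1 + w + w) q.2 (q.2 + h) +
    J q.1 (q.1 + w) (q.2 + h) (q.2 + h + h) +
    J (q.1 + w) (q.1 + w + w) (q.2 + h) (q.2 + h + h).
  by rewrite /J !addrA; ring.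
rewrite (_ : 4 * E = E + E + E + E); last by ring.
by do 3 apply: le_trans (ler_normD _ _) (lerD _ _) => //.
Qed.

Lemma corner_limit (e : R) : exists x y, forall n, let q := corner e n in
  [/\ a <= q.1, q.1 <= x <= q.1 + wd n & q.1 + wd n <= b] /\
  [/\ c <= q.2, q.2 <= y <= q.2 + ht n & q.2 + ht n <= d].
Proof.
have nest (u l : nat -> R) : (forall n, u n <= u n.+1 /\ u n.+1 + l n.+1 <= u n + l n) ->
    (forall n, 0 < l n) ->
    exists x, forall n, [/\ u 0%N <= u n, u n <= x <= u n + l n & u n + l n <= u 0%N + l 0%N].
  move=> H l0.
  have ule n m : u n <= u (n + m)%N.
    by elim: m => [|m IHm]; rewrite ?addn0// addnS (le_trans IHm)//; case: (H (n + m)%N).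
  have lle n m : u (n + m)%N + l (n + m)%N <= u n + l n.
    by elim: m => [|m IHm]; rewrite ?addn0// addnS (le_trans _ IHm)//; case: (H (n + m)%N).
  have ul n m : u n <= u m + l m.
    apply: (le_trans (ule n m)); rewrite addnC; apply: le_trans (lle m n).
    by rewrite lerDl ltW.
  exists (sup (range u)) => n; split; first by have := ule 0%N n.
    apply/andP; split.
      apply: ub_le_sup; last by exists n.
      by exists (u n + l n) => _ [m _ <-].
    by apply: ge_sup; [exists (u 0%N), 0%N|move=> _ [m _ <-]].
  by have := lle 0%N n.
have [x xP] := nest (fun n => (corner e n).1) wd (fun n => (corner_step e n).1) wd_gt0.
have [y yP] := nest (fun n => (corner e n).2) ht (fun n => (corner_step e n).2) ht_gt0.
have w0 : a + wd 0 = b by rewrite /wd expr0; field.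
have h0 : c + ht 0 = d by rewrite /ht expr0; field.
by exists x, y => n; have := xP n; have := yP n; rewrite w0 h0.
Qed.

(** At the common point of the nested rectangles, the circulation is eventually at most [e / S]
    times the square of the half-perimeter, which is e / 4 ^ n by the choice of [S]; yet every
    selected rectangle has more. *)
Lemma closed_rectangle_integral : J a b c d = 0.
Proof.
apply/eqP/negP => /negP J0.
pose e := `|J a b c d| / 2.
have e0 : 0 < e by rewrite divr_gt0// normr_gt0.
have eJ : e < `|J a b c d| by rewrite /e gtr_pMr ?normr_gt0//; lra.
have [x [y xy]] := corner_limit e.
have [[ax /andP[x1 x2] xb] [cy /andP[y1 y2] yd]] := xy 0%N.
pose S := (b - a + (d - c)) ^+ 2.
have S0 : 0 < S by rewrite exprn_gt0// addr_gt0 ?subr_gt0.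
have [|||dl dl0 H] := @closed_rectangle_small x y (e / S); [lra|lra|by rewrite divr_gt0|].
have [n [nw nh]] : exists n, wd n < dl /\ ht n < dl.
  have [n1 h1] := divr_expr2_lt (b - a) dl0; have [n2 h2] := divr_expr2_lt (d - c) dl0.
  exists (maxn n1 n2); split; [apply: le_lt_trans h1|apply: le_lt_trans h2];
    by rewrite ler_pM2l ?subr_gt0// lef_pV2 ?posrE ?exprn_gt0// ler_eXn2l ?ltr1n// ?leq_maxl ?leq_maxr.
have [[ax' x' xb'] [cy' y' yd']] := xy n.
have := corner_big (ltW e0) eJ n; have := H _ _ _ _ ax' x' xb' cy' y' yd'.
rewrite ![_ + _ - _]addrAC !subrr !add0r => /(_ nw nh) h1 h2.
have := lt_le_trans h2 h1.
rewrite /wd /ht -mulrDl expr_div_n -/S -exprM mulnC exprM (_ : 2 ^+ 2 = 4)//; last by rewrite expr2; ring.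
by rewrite mulrA divfK ?gt_eqF// ltxx.
Qed.

End Rectangles.
End Green.

(** * Complex differentiability in terms of moduli; the exponential *)

Section Differentiability.

Lemma is_derive_near (K : numFieldType) (f : K^o -> K^o) (x d : K^o) :
  is_derive x 1 f d -> forall e : K, 0 < e -> exists2 dl : K, 0 < dl &
  forall y : K, `|y - x| < dl -> `|f y - f x - d * (y - x)| <= e * `|y - x|.
Proof.
case=> df <- e e0; rewrite /derive.
have /cvgrPdist_le /(_ e e0) /nbhs_ballP[dl /= dl0 H] := df.
exists dl => // y yx; have [->|yNx] := eqVneq y x; first by rewrite !subrr mulr0 subr0 normr0 mulr0.
have yx0 : y - x != 0 by rewrite subr_eq0.
have := H (y - x); rewrite /ball /= sub0r normrN => /(_ yx yx0).
rewrite /GRing.scale /= mulr1 subrK => h.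
rewrite -(ler_pdivrMr _ _ (_ : 0 < `|y - x|)) ?normr_gt0// -normfV -normrM.
by rewrite mulrBl mulfK// [_ / _]mulrC -normrN opprB.
Qed.

Variable R : realType.
Notation C := R[i]^o.

Lemma is_derive_modc (f : C -> C) (z d : C) : is_derive z 1 f d ->
  forall e : R, 0 < e -> exists2 dl : R, 0 < dl & forall w, modc (w - z) < dl ->
    modc (f w - f z - d * (w - z)) <= e * modc (w - z).
Proof.
move=> fd e e0; have [|dl dl0 H] := is_derive_near fd (_ : 0 < e%:C); first by rewrite ltcR.
case: dl dl0 H => dl dl' /andP[/eqP /= -> dl0] H; exists dl => // w wdl.
by have := H w; rewrite !normcE ltcR -rmorphM lecR => /(_ wdl).
Qed.

Lemma derivable_modcP (f : C -> C) (z : C) : derivable f z 1 <->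
  exists d : C, forall e : R, 0 < e -> exists2 dl : R, 0 < dl & forall w, modc (w - z) < dl ->
    modc (f w - f z - d * (w - z)) <= e * modc (w - z).
Proof.
split=> [/derivableP fd|[d H]]; first by exists ('D_1 f z); exact: is_derive_modc.
apply/cvg_ex; exists d; apply/cvgrPdist_le => -[e e'] /andP[/eqP /= -> e0].
have [dl dl0 {}H] := H e e0; apply/nbhs_ballP; exists dl%:C; rewrite /= ?ltcR// => h.
rewrite /ball /= sub0r normrN normcE ltcR => hdl h0.
have := H (z + h); rewrite addrC addKr => /(_ hdl).
rewrite normcE lecR /GRing.scale /= mulr1 addrC => le.
rewrite -(ler_pM2r (_ : 0 < modc h)) ?modc_gt0// -Normc.normcM mulrBl mulrAC mulVf// mul1r.
by rewrite -modcN opprB addrC [h + z]addrC.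
Qed.

Lemma continuous_modcP (f : C -> C) (z : C) : {for z, continuous f} <->
  forall e : R, 0 < e -> exists2 dl : R, 0 < dl & forall w, modc (w - z) < dl ->
    modc (f w - f z) < e.
Proof.
split=> [fz e e0|H].
  have /nearcP[dl dl0 H] : \forall w \near z, modc (f w - f z) < e.
    have := fz; move/cvgrPdist_lt => /(_ e%:C); rewrite ltcR => /(_ e0).
    by apply: filterS => w; rewrite normcE ltcR modcB.
  by exists dl.
rewrite /prop_for /continuous_at; apply/(@cvgrPdist_lt _ C _ (nbhs z)) => -[e e'] /andP[/eqP /= -> e0]; apply/nearcP.
have [dl dl0 {}H] := H e e0; exists dl => // w /H.
by rewrite normcE ltcR modcB.
Qed.

Definition cis (t : R) : C := cos t +i* sin t.

Lemma cisD s t : cis (s + t) = cis s * cis t.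
Proof. by rewrite /cis cosD sinD; congr (_ +i* _); rewrite addrC. Qed.

Lemma modc_cis t : modc (cis t) = 1.
Proof. by rewrite /= cos2Dsin2 sqrtr1. Qed.

Lemma cis0 : cis 0 = 1.
Proof. by rewrite /cis cos0 sin0. Qed.

Lemma cis_2pi : cis (2 * pi) = 1.
Proof. by rewrite /cis mulr_natl cos2pi sin2pi. Qed.

Lemma modc_le_ReIm (z : R[i]) : modc z <= `|complex.Re z| + `|complex.Im z|.
Proof.
case: z => x y /=.
rewrite -[leRHS]ger0_norm ?addr_ge0// -sqrtr_sqr ler_wsqrtr//.
by rewrite sqrrD !real_normK ?num_real// lerD2r lerDl mulrn_wge0// mulr_ge0.
Qed.

(** The derivative of e^(s + i t) at 0 is 1. The remainder is split into those of [expR], [cos] and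
    [sin] at 0 and the mixed term [s * t]. *)
Lemma cexp_near0 (e : R) : 0 < e -> exists2 dl : R, 0 < dl & forall s t,
  `|s| < dl -> `|t| < dl ->
  modc ((expR s)%:C * cis t - 1 - (s +i* t)) <= e * (`|s| + `|t|).
Proof.
move=> e0.
have e40 : 0 < Num.min (e / 8) 1 by rewrite lt_min ltr01 divr_gt0.
have [d1 d10 H1] := is_derive_near (is_derive_expR (0 : R)) e40.
have [d2 d20 H2] := is_derive_near (is_derive_cos (0 : R)) e40.
have [d3 d30 H3] := is_derive_near (is_derive_sin (0 : R)) e40.
exists (Num.min (Num.min d1 d2) (Num.min d3 (Num.min (e / 8) 1))).
  by rewrite !lt_min d10 d20 d30 ltr01 divr_gt0.
move=> s t; rewrite !lt_min => /andP[/andP[s1 _] /andP[_ /andP[s4 s5]]].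
move=> /andP[/andP[_ t2] /andP[t3 /andP[t4 t5]]].
have := H1 s; rewrite expR0 subr0 mul1r => /(_ s1) h1.
have := H2 t; rewrite subr0 cos0 sin0 oppr0 mul0r subr0 => /(_ t2) h2.
have := H3 t; rewrite sin0 cos0 !subr0 mul1r => /(_ t3) h3.
have -> : (expR s)%:C * cis t - 1 - (s +i* t) = (expR s - 1 - s)%:C * cis t +
    ((1 + s)%:C * ((cos t - 1) +i* (sin t - t)) + 0 +i* (s * t)).
  by apply/eqP; rewrite eq_complex /=; apply/andP; split; apply/eqP; ring.
have m1 : Num.min (e / 8) 1 <= e / 8 by rewrite ge_min lexx.
have hs : `|expR s - 1 - s| <= e / 8 * `|s| by rewrite (le_trans h1)// ler_wpM2r.
have hc : `|cos t - 1| <= e / 8 * `|t| by rewrite (le_trans h2)// ler_wpM2r.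
have hn : `|sin t - t| <= e / 8 * `|t| by rewrite (le_trans h3)// ler_wpM2r.
apply: le_trans (ler_modcD _ _) _; rewrite Normc.normcM modc_cis mulr1 modc_real.
apply: le_trans (lerD hs (ler_modcD _ _)) _; rewrite Normc.normcM modc_real.
have h5 : `|1 + s| <= 2 by rewrite (le_trans (ler_normD _ _))// normr1; lra.
have h6 : modc ((cos t - 1) +i* (sin t - t)) <= e / 4 * `|t|.
  apply: le_trans (modc_le_ReIm _) _ => /=; lra.
have h7 : modc (0 +i* (s * t)) <= e / 8 * `|t|.
  rewrite /= expr0n /= add0r sqrtr_sqr normrM ler_wpM2r// ltW//.
have h8 : `|1 + s| * modc ((cos t - 1) +i* (sin t - t)) <= 2 * (e / 4 * `|t|).
  by apply: ler_pM => //; exact: modc_ge0.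
have := normr_ge0 s; have := normr_ge0 t; nra.
Qed.

End Differentiability.

(** * Means over circles in logarithmic polar coordinates *)

Section MaximumModulus.
Variable R : realType.
Notation C := R[i]^o.

Lemma continuous_Re : continuous (@complex.Re R : C -> R).
Proof.
move=> z; apply/(@cvgrPdist_lt _ R _ (nbhs z)) => e e0; apply/nearcP; exists e => // w.
by rewrite modcB; apply: le_lt_trans; case: z w => [x y] [u v]; exact: (Re_le_modc ((x - u) +i* (y - v))).
Qed.

Lemma continuous_Im : continuous (@complex.Im R : C -> R).
Proof.
move=> z; apply/(@cvgrPdist_lt _ R _ (nbhs z)) => e e0; apply/nearcP; exists e => // w.
by rewrite modcB; apply: le_lt_trans; case: z w => [x y] [u v]; exact: (Im_le_modc ((x - u) +i* (y - v))).
Qed.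

Lemma continuous_complex (T : topologicalType) (u v : T -> R) (t : T) :
  {for t, continuous u} -> {for t, continuous v} ->
  {for t, continuous (fun t => u t +i* v t : C)}.
Proof.
move=> cu cv; apply/(@cvgrPdist_lt _ C _ (nbhs t)) => -[e e'] /andP[/eqP /= -> e0].
have e20 : 0 < e / 2 by rewrite divr_gt0.
move/(@cvgrPdist_lt _ R _ (nbhs t))/(_ _ e20) in cu.
move/(@cvgrPdist_lt _ R _ (nbhs t))/(_ _ e20) in cv.
apply: filterS2 cu cv => s su sv; rewrite normcE ltcR.
by apply: le_lt_trans (modc_le_ReIm _) _ => /=; lra.
Qed.

Lemma derivable_continuous (f : C -> C) (z : C) : derivable f z 1 -> {for z, continuous f}.
Proof. by move=> /derivable1_diffP /differentiable_continuous. Qed.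

Section Circles.
Variables (f : C -> C) (a : C) (r e : R).
Hypotheses (r0 : 0 < r) (e0 : 0 < e) (fa : {for a, continuous f}).
Hypothesis fd : forall z, 0 < modc (z - a) < r -> derivable f z 1.

(** The coordinates are z = a + e^(x + i y). Truncating [x] at [X] keeps [polar] inside the disc for
    every [x], so that [P] and [Q] are continuous on whole lines, as the construction of primitives
    requires. The rectangle used below stays left of [X], at radii up to r / 2. *)
Let X := ln (r * 2 / 3).
Let polar (x y : R) : C := a + (expR (Num.min x X))%:C * cis y.

Let expX : expR X = r * 2 / 3.
Proof. by rewrite lnK ?posrE ?divr_gt0 ?mulr_gt0. Qed.

Let polarB x y : polar x y - a = (expR (Num.min x X))%:C * cis y.
Proof. by rewrite /polar addrC addKr. Qed.

Let modc_polar x y : modc (polar x y - a) = expR (Num.min x X).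
Proof. by rewrite polarB Normc.normcM modc_cis mulr1 modc_real gtr0_norm ?expR_gt0. Qed.

Let polar_derivable x y : derivable f (polar x y) 1.
Proof.
apply: fd; rewrite modc_polar expR_gt0 /=.
apply: le_lt_trans (_ : expR X < _); first by rewrite ler_expR ge_min lexx orbT.
by rewrite expX; have := r0; lra.
Qed.

Let polar_continuousx y : continuous (polar^~ y).
Proof.
move=> x; have -> : polar^~ y = fun x => (complex.Re a + expR (Num.min x X) * cos y)
    +i* (complex.Im a + expR (Num.min x X) * sin y).
  apply/funext => t; rewrite /polar /cis; apply/eqP; rewrite eq_complex.
  by case: a => a1 a2 /=; apply/andP; split; apply/eqP; ring.
have ce : {for x, continuous (fun x => expR (Num.min x X))}.
  apply: continuous_comp; last exact: continuous_expR.
  by apply: continuous_min; [exact: cvg_id|exact: cvg_cst].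
have cf (b c : R) : {for x, continuous (fun x => b + expR (Num.min x X) * c)}.
  by apply: cvgD; [exact: cvg_cst|apply: cvgM; [exact: ce|exact: cvg_cst]].
exact: continuous_complex (cf _ _) (cf _ _).
Qed.

Let polar_continuousy x : continuous (polar x).
Proof.
move=> y; have -> : polar x = fun y => (complex.Re a + expR (Num.min x X) * cos y)
    +i* (complex.Im a + expR (Num.min x X) * sin y).
  apply/funext => t; rewrite /polar /cis; apply/eqP; rewrite eq_complex.
  by case: a => a1 a2 /=; apply/andP; split; apply/eqP; ring.
have cf (b c : R) (h : R -> R) : continuous h -> {for y, continuous (fun y => b + c * h y)}.
  by move=> ch; apply: cvgD; [exact: cvg_cst|apply: cvgM; [exact: cvg_cst|exact: ch]].
exact: continuous_complex (cf _ _ _ (@continuous_cos R)) (cf _ _ _ (@continuous_sin R)).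
Qed.

Let P x y := complex.Im (f (polar x y)).
Let Q x y := complex.Re (f (polar x y)).

(** The Cauchy-Riemann equations for f(a + e^(x + i y)), whose derivative is l = f'(z) (z - a): the
    partial derivatives of the imaginary part [P] are Im l and Re l, those of the real part [Q] are
    Re l and - Im l. *)
Lemma polar_closed_at x0 y0 : x0 < X -> closed_at P Q x0 y0.
Proof.
move=> x0X; pose z0 := polar x0 y0.
have [D HD] := (derivable_modcP f z0).1 (@polar_derivable x0 y0).
pose m := expR x0; have m0 : 0 < m := expR_gt0 _.
have mE : modc (z0 - a) = m by rewrite modc_polar min_l// ltW.
pose l := D * (z0 - a).
exists (complex.Im l), (complex.Re l), (- complex.Im l) => e1 e10.
pose k := Num.min 1 (e1 / (2 * (modc D * m + 1))).
have Dm : 0 < modc D * m + 1 by rewrite ltr_wpDl// mulr_ge0// ?modc_ge0 ?ltW.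
have k0 : 0 < k by rewrite lt_min ltr01 divr_gt0// mulr_gt0.
have [d1 d10 H1] := cexp_near0 k0.
have [|d2 d20 H2] := HD (e1 / (4 * m)); first by rewrite divr_gt0// mulr_gt0.
exists (Num.min d1 (Num.min (X - x0) (d2 / (4 * m)))).
  by rewrite !lt_min d10 subr_gt0 x0X divr_gt0// mulr_gt0.
move=> x y; rewrite !lt_min => /andP[xd1 /andP[xX xd2]] /andP[yd1 /andP[_ yd2]].
have {}xX : x < X by move: xX; rewrite ltr_norml => /andP[_]; lra.
set s := x - x0 in xd1 xd2 *; set t := y - y0 in yd1 yd2 *.
set N : R := `|s| + `|t|.
have N0 : 0 <= N by rewrite addr_ge0.
pose E := (expR s)%:C * cis t - 1 - (s +i* t).
have hE : modc E <= k * N := H1 _ _ xd1 yd1.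
have wz : polar x y - z0 = (z0 - a) * (E + (s +i* t)).
  rewrite /E subrK mulrBr mulr1.
  have -> : (z0 - a) * ((expR s)%:C * cis t) = polar x y - a.
    rewrite !polarB !min_l ?(ltW x0X) ?(ltW xX)// mulrACA -cisD -rmorphM -expRD.
    by rewrite /s /t !(addrC x0, addrC y0) !subrK.
  by rewrite opprB addrA subrK.
have st : modc (s +i* t) <= N by exact: modc_le_ReIm.
have k1 : k <= 1 by rewrite ge_min lexx.
have hw : modc (polar x y - z0) <= m * (2 * N).
  rewrite wz Normc.normcM mE ler_pM2l//; apply: le_trans (ler_modcD _ _) _; nra.
have wd : modc (polar x y - z0) < d2.
  apply: le_lt_trans hw _; rewrite -(ltr_pdivlMl _ _ m0) -(ltr_pdivlMl _ _ (_ : 0 < 2))//.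
  move: xd2 yd2; set q := d2 / (4 * m) => *.
  have -> : 2^-1 * (m^-1 * d2) = q + q by rewrite /q; field; rewrite gt_eqF.
  by rewrite ltrD.
have hF : modc (f (polar x y) - f z0 - l * (s +i* t)) <= e1 * N.
  have -> : f (polar x y) - f z0 - l * (s +i* t) =
      (f (polar x y) - f z0 - D * (polar x y - z0)) + l * E by rewrite wz /l; ring.
  apply: le_trans (ler_modcD _ _) _; apply: le_trans (lerD (H2 _ wd) (lexx _)) _.
  rewrite Normc.normcM /l Normc.normcM mE.
  have h1 : e1 / (4 * m) * modc (polar x y - z0) <= e1 / 2 * N.
    have -> : e1 / 2 * N = e1 / (4 * m) * (m * (2 * N)) by field; rewrite gt_eqF.
    by rewrite ler_pM2l// divr_gt0// mulr_gt0.
  have h2 : modc D * m * modc E <= e1 / 2 * N.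
    apply: le_trans (_ : (modc D * m + 1) * (k * N) <= _).
      by apply: ler_pM => //; [rewrite mulr_ge0 ?modc_ge0// ltW|exact: modc_ge0|rewrite lerDl].
    rewrite mulrA ler_wpM2r//.
    apply: le_trans (_ : (modc D * m + 1) * (e1 / (2 * (modc D * m + 1))) <= _).
      by rewrite ler_pM2l// ge_min lexx orbT.
    by rewrite le_eqVlt; apply/orP; left; apply/eqP; field; rewrite gt_eqF.
  by lra.
split; [apply: le_trans hF; apply: le_trans (Im_le_modc _)|apply: le_trans hF; apply: le_trans (Re_le_modc _)];
  rewrite le_eqVlt; apply/orP; left; apply/eqP; congr (`|_|); rewrite /P /Q -/z0;
  case: (f (polar x y)) => ? ?; case: (f z0) => ? ?; case: l => ? ? /=; ring.
Qed.

(** The mean of Re f over circles around [a] does not depend on the radius. Under the assumption it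
    is at most Re f(a) - e r^2 / 4 at radius r / 2, whereas by continuity it is at least Re f(a) - e
    r^2 / 8 on a small circle. *)
Lemma no_strict_maximum :
  ~ (forall z, modc (z - a) < r -> complex.Re (f z) <= complex.Re (f a) - e * modc (z - a) ^+ 2).
Proof.
move=> H; pose x1 := ln (r / 2).
have expx1 : expR x1 = r / 2 by rewrite lnK// posrE divr_gt0.
have x1X : x1 < X by rewrite -ltr_expR expx1 expX; have := r0; lra.
have e80 : 0 < e * r ^+ 2 / 8 by rewrite divr_gt0// mulr_gt0// exprn_gt0.
have [dl dl0 Hd] := (continuous_modcP f a).1 fa _ e80.
have mn0 : 0 < Num.min (dl / 2) (r / 4) by rewrite lt_min !divr_gt0.
pose x0 := ln (Num.min (dl / 2) (r / 4)).
have expx0 : expR x0 = Num.min (dl / 2) (r / 4) by rewrite lnK.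
have x01 : x0 < x1.
  by rewrite -ltr_expR expx0 expx1 gt_min; apply/orP; right; have := r0; lra.
have pi2 : 0 < 2 * pi :> R by rewrite mulr_gt0// pi_gt0.
(* The interval from [A] to [B] contains the ranges of both coordinates, so that one choice of
   primitives serves for both. *)
pose B : R := `|x0| + `|x1| + 2 * pi + 1; pose A : R := - B.
have AB : A < B by have := normr_ge0 x0; have := normr_ge0 x1; rewrite /A /B; lra.
have [prim primP] : exists prim : (R -> R) -> R -> R, forall g, continuous g ->
    forall x, A < x < B -> is_derive x 1 (prim g) (g x).
  suff: forall g : R -> R, exists G : R -> R, continuous g ->
    forall x, A < x < B -> is_derive x 1 G (g x) by move=> /choice[pr prP]; exists pr => g; exact: prP.
  move=> g; have [cg|ncg] := pselect (continuous g); last by exists g.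
  by have [G GP] := continuous_primitive cg AB; exists G.
have cQ x : continuous (Q x).
  move=> y; apply: (@continuous_comp _ _ _ (f \o polar x) (@complex.Re R : C -> R)); last exact: continuous_Re.
  apply: continuous_comp; first exact: polar_continuousy.
  exact: (derivable_continuous (@polar_derivable x y)).
have cP y : continuous (P^~ y).
  move=> x; apply: (@continuous_comp _ _ _ (f \o polar^~ y) (@complex.Im R : C -> R)); last exact: continuous_Im.
  apply: continuous_comp; first exact: polar_continuousx.
  exact: (derivable_continuous (@polar_derivable x y)).
have xAB x : x0 <= x <= x1 -> A < x < B.
  have := ler_norm x0; have := ler_norm (- x0); have := ler_norm x1; have := ler_norm (- x1).
  by rewrite !normrN /A /B; lra.
have yAB y : 0 <= y <= 2 * pi -> A < y < B.
  by have := normr_ge0 x0; have := normr_ge0 x1; rewrite /A /B; lra.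
have J0 := @closed_rectangle_integral R P Q (fun y => prim (P^~ y)) (fun x => prim (Q x))
  x0 x1 0 (2 * pi) x01 pi2
  (fun y _ x xx => primP _ (cP y) x (xAB x xx))
  (fun x _ y yy => primP _ (cQ x) y (yAB y yy))
  (fun x y xx _ => @polar_closed_at x y (le_lt_trans (proj2 (andP xx)) x1X)).
(* By periodicity the sides at angles 0 and 2 pi cancel; the two circles remain. *)
have PE : P^~ (2 * pi) = P^~ 0.
  by apply/funext => x; rewrite /P /polar cis_2pi cis0.
move: J0; rewrite PE /=.
have up : prim (Q x1) (2 * pi) - prim (Q x1) 0 <= (complex.Re (f a) - e * r ^+ 2 / 4) * (2 * pi - 0).
  apply: (@primitive_mean _ _ (Q x1)); first exact: ltW.
    by move=> y yy; apply: primP => //; exact: yAB.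
  move=> y _; apply: le_trans (H (polar x1 y) _) _.
    by rewrite modc_polar min_l ?(ltW x1X)// expx1; have := r0; lra.
  rewrite modc_polar min_l ?(ltW x1X)// expx1 lerD2l lerN2.
  by rewrite le_eqVlt; apply/orP; left; apply/eqP; field.
have lo : (fun y => - prim (Q x0) y) (2 * pi) - (fun y => - prim (Q x0) y) 0 <=
    - (complex.Re (f a) - e * r ^+ 2 / 8) * (2 * pi - 0).
  apply: (@primitive_mean _ (fun y => - prim (Q x0) y) (fun y => - Q x0 y)); first exact: ltW.
    by move=> y yy; apply: is_deriveN; apply: primP => //; exact: yAB.
  move=> y _; have x0X : x0 <= X by rewrite ltW// (lt_trans x01).
  have := Hd (polar x0 y); rewrite modc_polar min_l// expx0.
  have : Num.min (dl / 2) (r / 4) < dl by rewrite gt_min; apply/orP; left; lra.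
  move=> /[swap] /[apply] /(le_lt_trans (Re_le_modc _)); rewrite -/(Q x0 y).
  rewrite /Q; case: (f (polar x0 y)) => ? ?; case: (f a) => ? ? /=.
  by rewrite ltr_norml => /andP[+ _]; lra.
move: up lo => /= up lo; have : 0 < e * r ^+ 2 * pi by rewrite !mulr_gt0 ?exprn_gt0 ?pi_gt0.
by move=> ? ?; nra.
Qed.

End Circles.
End MaximumModulus.

(** * The maximum principle on discs *)

Section DiscMaximum.
Variable R : realType.
Notation C := R[i]^o.

Lemma modc_sqr (z : R[i]) : modc z ^+ 2 = complex.Re z ^+ 2 + complex.Im z ^+ 2.
Proof. by case: z => x y /=; rewrite sqr_sqrtr// addr_ge0 ?sqr_ge0. Qed.

(* Inductive wrappers: unification must never unfold [derivable] or [continuous]. *)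
Variant cdiff (f : C -> C) (z : C) : Prop := CDiff of derivable f z 1.
Variant ccont (f : C -> C) (z : C) : Prop := CCont of {for z, continuous f}.

Implicit Types (f g : C -> C) (a b c z w : C).

Lemma cdiffP f z : derivable f z 1 <-> cdiff f z.
Proof. by split=> [|[]]. Qed.

Lemma ccontP f z : {for z, continuous f} <-> ccont f z.
Proof. by split=> [|[]]. Qed.

Lemma cdiffD f g z : cdiff f z -> cdiff g z -> cdiff (fun w => f w + g w) z.
Proof. by case=> fz [gz]; split; exact: (derivableD fz gz). Qed.

Lemma cdiffB f g z : cdiff f z -> cdiff g z -> cdiff (fun w => f w - g w) z.
Proof. by case=> fz [gz]; split; exact: (derivableB fz gz). Qed.

Lemma cdiffM f g z : cdiff f z -> cdiff g z -> cdiff (fun w => f w * g w) z.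
Proof. by case=> fz [gz]; split; exact: (derivableM fz gz). Qed.

Lemma cdiffV f z : f z != 0 -> cdiff f z -> cdiff (fun w => (f w)^-1) z.
Proof. by move=> fz0 [fz]; split; exact: (derivableV fz0 fz). Qed.

Lemma cdiff_cst c z : cdiff (fun=> c) z.
Proof. by split; exact: derivable_cst. Qed.

Lemma cdiff_id z : cdiff (fun w => w) z.
Proof. by split; exact: derivable_id. Qed.

Lemma cdiff_subr c z : cdiff (fun w => w - c) z.
Proof. by apply: cdiffB; [exact: cdiff_id|exact: cdiff_cst]. Qed.

Lemma cdiffX f n z : cdiff f z -> cdiff (fun w => f w ^+ n) z.
Proof.
move=> fz; elim: n => [|n IHn]; first exact: cdiff_cst.
by under eq_fun do rewrite exprS; exact: cdiffM.
Qed.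

Lemma cdiff_comp f g z : cdiff f z -> cdiff g (f z) -> cdiff (g \o f) z.
Proof.
case=> fz [gz]; have df := (derivable1_diffP f z).1 fz.
have dg := (derivable1_diffP g (f z)).1 gz.
by split; exact: ((derivable1_diffP (g \o f) z).2 (differentiable_comp df dg)).
Qed.

Lemma cdiff_near_eq f g z : (\forall w \near z, f w = g w) -> cdiff f z -> cdiff g z.
Proof. by move=> fg [fz]; split; apply: near_eq_derivable fz => //; rewrite oner_neq0. Qed.

Lemma cdiff_modcP f z : cdiff f z <->
  exists d : C, forall e : R, 0 < e -> exists2 dl : R, 0 < dl &
  forall w, modc (w - z) < dl -> modc (f w - f z - d * (w - z)) <= e * modc (w - z).
Proof. by rewrite -(propext (cdiffP f z)); exact: derivable_modcP. Qed.

Lemma ccont_modcP f z : ccont f z <-> forall e : R, 0 < e -> exists2 dl : R, 0 < dl &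
  forall w, modc (w - z) < dl -> modc (f w - f z) < e.
Proof. by rewrite -(propext (ccontP f z)); exact: continuous_modcP. Qed.

Lemma cdiff_cont f z : cdiff f z -> ccont f z.
Proof. by case=> fz; split; exact: derivable_continuous. Qed.

Lemma ccontB f g z : ccont f z -> ccont g z -> ccont (fun w => f w - g w) z.
Proof. by case=> fz [gz]; split; exact: (continuousB fz gz). Qed.

Lemma ccontD f g z : ccont f z -> ccont g z -> ccont (fun w => f w + g w) z.
Proof. by case=> fz [gz]; split; exact: (continuousD fz gz). Qed.

Lemma ccontM f g z : ccont f z -> ccont g z -> ccont (fun w => f w * g w) z.
Proof. by case=> fz [gz]; split; exact: (continuousM fz gz). Qed.

Lemma ccont_cst c z : ccont (fun=> c) z.
Proof. by split; exact: cst_continuous. Qed.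

Lemma ccont_near_eq f g z : (\forall w \near z, f w = g w) -> ccont f z -> ccont g z.
Proof.
move=> /nearcP[d d0 H] /ccont_modcP fz; apply/ccont_modcP => e /fz[dl dl0 H'].
exists (Num.min d dl) => [|w]; rewrite lt_min ?d0// => /andP[wd /H'].
by rewrite !H// subrr Normc.normc0.
Qed.

Lemma ler_dist_modc (z w : R[i]) : `|modc z - modc w| <= modc (z - w).
Proof.
rewrite ler_norml; have := ler_modcD (z - w) w; have := ler_modcD (w - z) z.
by rewrite !subrK [modc (w - z)]modcB => *; apply/andP; split; lra.
Qed.

Lemma continuous_modc : continuous (@Normc.normc R : C -> R).
Proof.
move=> z; apply/(@cvgrPdist_lt _ R _ (nbhs z)) => e e0; apply/nearcP; exists e => // w.
by rewrite modcB; apply: le_lt_trans; exact: ler_dist_modc.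
Qed.

Lemma compact_disc (a : C) (r : R) : compact [set z : C | modc (z - a) <= r].
Proof.
pose Sx := `[complex.Re a - r, complex.Re a + r]; pose Sy := `[complex.Im a - r, complex.Im a + r].
have cK : compact ((fun p : R * R => p.1 +i* p.2 : C) @` ([set` Sx] `*` [set` Sy])).
  apply: continuous_compact; last by apply: compact_setX; exact: segment_compact.
  apply: continuous_subspaceT => p.
  by apply: continuous_complex; [exact: cvg_fst|exact: cvg_snd].
apply: subclosed_compact cK _.
  have -> : [set z : C | modc (z - a) <= r] = (fun z : C => modc (z - a)) @^-1` [set x : R | x <= r].
    by [].
  apply: closed_comp; last exact: closed_le.
  move=> z _; apply: (@continuous_comp _ _ _ (fun z : C => z - a : C) (@Normc.normc R : C -> R)).
    by case: (cdiff_cont (cdiff_subr a z)).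
  exact: continuous_modc.
move=> z /= zr; exists (complex.Re z, complex.Im z); last by case: z {zr}.
have := le_trans (Re_le_modc _) zr; have := le_trans (Im_le_modc _) zr.
rewrite /Sx /Sy /= !in_itv /= !ler_norml; case: z {zr} => x y; case: (a) => a1 a2 /=.
by move=> h1 h2; split; lra.
Qed.

Lemma disc_max (u : C -> R) (a : C) (r : R) : 0 <= r ->
  (forall z, modc (z - a) <= r -> {for z, continuous u}) ->
  exists2 z0, modc (z0 - a) <= r & forall z, modc (z - a) <= r -> u z <= u z0.
Proof.
move=> r0 cu; have [||c + H] := compact_EVT_max _ (@compact_disc a r) (_ : {within _, continuous u}).
  by exists a; rewrite /= subrr Normc.normc0.
  by apply: continuous_in_subspaceT => z; rewrite inE => /cu.
by rewrite inE => cr; exists c => // z zr; apply: H; rewrite inE.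
Qed.

(** Isolated exceptional points have to be allowed: the principle is applied to functions known only
    to be continuous there, in order to remove these singularities. *)
Definition punctured_cdiff (f : C -> C) (z : C) :=
  exists2 d : R, 0 < d & forall w, 0 < modc (w - z) < d -> cdiff f w.

(** Adding e |z - a|^2 with [e] small keeps the maximum [z0] off the boundary. Expanded around [z0],
    this term has as its linear part the real part of the holomorphic function [b * (z - z0)];
    adding that to [f] makes [z0] a strict maximum of the kind excluded above. *)
Lemma maximum_Re (f : C -> C) (a : C) (r M : R) : 0 < r ->
  (forall z, modc (z - a) <= r -> ccont f z) ->
  (forall z, modc (z - a) < r -> punctured_cdiff f z) ->
  (forall z, modc (z - a) = r -> complex.Re (f z) <= M) ->
  forall z, modc (z - a) <= r -> complex.Re (f z) <= M.
Proof.
move=> r0 fc fd fM z1 z1r; rewrite leNgt; apply/negP => Mz1.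
(* The added term is, on the boundary, half of the supposed excess at [z1]. *)
pose e : R := (complex.Re (f z1) - M) / (2 * r ^+ 2).
have e0 : 0 < e by rewrite divr_gt0 ?subr_gt0// mulr_gt0// exprn_gt0.
have er : e * r ^+ 2 = (complex.Re (f z1) - M) / 2 by rewrite /e; field; rewrite gt_eqF.
pose u (z : C) : R := complex.Re (f z) + e * modc (z - a) ^+ 2.
have [|z0 z0r H] := @disc_max u a r (ltW r0).
  move=> z zr; have c1 : {for z, continuous (fun z => complex.Re (f z))}.
    exact: (@continuous_comp _ _ _ f (@complex.Re R : C -> R) z ((ccontP f z).2 (fc z zr)) (@continuous_Re R (f z))).
  have cm : {for z, continuous (fun z : C => modc (z - a))}.
    apply: (@continuous_comp _ _ _ (fun z : C => z - a : C) (@Normc.normc R : C -> R)).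
      by case: (cdiff_cont (cdiff_subr a z)).
    exact: continuous_modc.
  have c2 := @cst_continuous C R e z.
  exact: (continuousD c1 (continuousM c2 (continuousM cm cm))).
have [z0E|z0N] := eqVneq (modc (z0 - a)) r.
  have := H z1 z1r; have := fM z0 z0E; rewrite /u z0E er.
  have : 0 <= e * modc (z1 - a) ^+ 2 by rewrite mulr_ge0// ?(ltW e0)// exprn_ge0// modc_ge0.
  by move: Mz1; lra.
have {}z0r : modc (z0 - a) < r by rewrite lt_neqAle z0N.
have [d d0 fd0] := fd _ z0r.
pose r2 : R := Num.min d (r - modc (z0 - a)).
have r20 : 0 < r2 by rewrite lt_min d0 subr_gt0.
pose b : C := 2 * e%:C * conjc (z0 - a).
pose g (z : C) : C := f z + b * (z - z0).
have dg z : cdiff (fun z => b * (z - z0)) z.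
  by apply: cdiffM; [exact: cdiff_cst|exact: cdiff_subr].
apply: (@no_strict_maximum R g z0 r2 e r20 e0).
- exact/ccontP/(ccontD (fc z0 (ltW z0r)))/cdiff_cont.
- move=> z; rewrite lt_min => /andP[zz0 /andP[zd _]].
  by apply/cdiffP/cdiffD => //; apply: fd0; rewrite zz0.
move=> z; rewrite lt_min => /andP[_ zr2].
have zr : modc (z - a) <= r.
  rewrite (_ : z - a = (z - z0) + (z0 - a)); last by rewrite addrA subrK.
  by apply: le_trans (ler_modcD _ _) _; lra.
have := H z zr; rewrite /u /g /b !modc_sqr.
case: (f z) => f1 f2; case: (f z0) => f3 f4; case: (z) => x y; case: (z0) => x0 y0; case: (a) => a1 a2 /=.
by move=> h; nra.
Qed.

(** Multiplication by the unit [b] turns the value at [z1] into its modulus, so that the bound for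
    real parts applies. *)
Lemma maximum_modulus (f : C -> C) (a : C) (r M : R) : 0 < r ->
  (forall z, modc (z - a) <= r -> ccont f z) ->
  (forall z, modc (z - a) < r -> punctured_cdiff f z) ->
  (forall z, modc (z - a) = r -> modc (f z) <= M) ->
  forall z, modc (z - a) <= r -> modc (f z) <= M.
Proof.
move=> r0 fc fd fM z1 z1r.
have [fz1|fz1] := eqVneq (f z1) 0.
  rewrite fz1 Normc.normc0; apply: le_trans (fM (a + r%:C) _); first exact: modc_ge0.
  by rewrite addrC addKr modc_real gtr0_norm.
have m0 : modc (f z1) != 0 by rewrite modc_eq0.
pose b : C := conjc (f z1) / (modc (f z1))%:C.
have mb : modc b = 1.
  rewrite /b Normc.normcM Normc.normcV modc_real ger0_norm ?modc_ge0//.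
  by rewrite (_ : modc (conjc _) = modc (f z1)) ?divff//; case: (f z1) => x y /=; rewrite sqrrN.
have bf : complex.Re (b * f z1) = modc (f z1).
  have -> : b * f z1 = (modc (f z1))%:C.
    rewrite /b mulrAC; apply: (mulIf (_ : (modc (f z1))%:C != 0)).
      by rewrite -(rmorph0 (real_complex R)) (inj_eq (@complexI R)).
    rewrite divfK; last by rewrite -(rmorph0 (real_complex R)) (inj_eq (@complexI R)).
    rewrite -rmorphM -expr2 modc_sqr; case: (f z1) => x y; apply/eqP; rewrite eq_complex /=.
    by apply/andP; split; apply/eqP; ring.
  by [].
have h1 z : modc (z - a) <= r -> ccont (fun z => b * f z) z.
  by move=> /fc; apply: ccontM; exact: ccont_cst.
have h2 z : modc (z - a) < r -> punctured_cdiff (fun z => b * f z) z.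
  by case/fd => d d0 H; exists d => // w /H; apply: cdiffM; exact: cdiff_cst.
have h3 z : modc (z - a) = r -> complex.Re (b * f z) <= M.
  move=> /fM; apply: le_trans; apply: le_trans (ler_norm _) _; apply: le_trans (Re_le_modc _) _.
  by rewrite Normc.normcM mb mul1r.
by rewrite -bf; exact: (maximum_Re r0 h1 h2 h3 z1r).
Qed.

End DiscMaximum.

(** * Divided differences and removable singularities *)

Section Removable.
Variable R : realType.
Notation C := R[i]^o.

Definition diff_quotient (g : C -> C) (b d : C) : C -> C :=
  fun z => if z == b then d else (g z - g b) / (z - b).

Implicit Types (g : C -> C) (a b d z : C).

Lemma diff_quotientK g b d z : g z = g b + (z - b) * diff_quotient g b d z.
Proof.
rewrite /diff_quotient; case: eqVneq => [->|zb]; first by rewrite subrr mul0r addr0.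
by rewrite mulrC divfK ?subr_eq0// addrC subrK.
Qed.

Lemma near_neq (z b : C) : z != b -> \forall w \near z, w != b.
Proof.
move=> zb; apply/nearcP; exists (modc (b - z)) => [|w]; first by rewrite modc_gt0 subr_eq0 eq_sym.
by apply: contraTneq => ->; rewrite ltxx.
Qed.

Lemma diff_quotient_near g b d z : z != b ->
  \forall w \near z, (g w - g b) / (w - b) = diff_quotient g b d w.
Proof. by move=> /near_neq; apply: filterS => w /negbTE; rewrite /diff_quotient => ->. Qed.

Lemma cdiff_diff_quotient g b d z : z != b -> cdiff g z ->
  cdiff (diff_quotient g b d) z.
Proof.
move=> zb gz; apply: cdiff_near_eq (diff_quotient_near g d zb) _.
have zb0 : z - b != 0 by rewrite subr_eq0.
by apply: cdiffM; [apply: cdiffB gz _; exact: cdiff_cst|apply: (@cdiffV R (fun w => w - b)) => //; exact: cdiff_subr].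
Qed.

Lemma ccont_diff_quotient g b : cdiff g b ->
  ccont (diff_quotient g b ('D_1 g b)) b.
Proof.
move=> gb; apply/ccont_modcP => e e0.
have e20 : 0 < e / 2 by rewrite divr_gt0.
have [dl dl0 H] := is_derive_modc (derivableP (iffRL (cdiffP g b) gb)) e20.
exists dl => // w wb; rewrite /diff_quotient eqxx; case: eqVneq => [_|wNb].
  by rewrite subrr Normc.normc0.
have wb0 : 0 < modc (w - b) by rewrite modc_gt0 subr_eq0.
rewrite -(ltr_pM2r wb0) -Normc.normcM mulrBl divfK ?subr_eq0//.
by apply: le_lt_trans (H w wb) _; rewrite ltr_pM2r//; lra.
Qed.

Lemma ccont_diff_quotient_neq g b d z : z != b -> ccont g z ->
  ccont (diff_quotient g b d) z.
Proof.
move=> zb gz; have zb0 : z - b != 0 by rewrite subr_eq0.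
apply: ccont_near_eq (diff_quotient_near g d zb) _.
apply: ccontM; first by apply: ccontB gz _; exact: ccont_cst.
by apply/cdiff_cont/cdiffV => //; exact: cdiff_subr.
Qed.

Lemma neq_avoid (s : seq C) (z : C) : exists2 d : R, 0 < d &
  forall w, 0 < modc (w - z) < d -> w \notin s.
Proof.
elim: s => [|b s [d d0 H]]; first by exists 1.
have [zb|zb] := eqVneq z b; first rewrite zb.
  rewrite zb in H; exists d => // w wd; rewrite inE negb_or (H _ wd) andbT.
  by case/andP: wd; rewrite modc_gt0 subr_eq0.
exists (Num.min d (modc (b - z))); first by rewrite lt_min d0 modc_gt0 subr_eq0 eq_sym.
move=> w /andP[w0]; rewrite lt_min => /andP[wd wb]; rewrite inE negb_or (H w) ?w0 ?wd// andbT.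
by apply: contraTneq wb => ->; rewrite ltxx.
Qed.

(* Difference quotients g[b, .] and g[b', .] are close on a circle around a when b and b'
   are close to a, hence by the maximum principle also at a, so that the difference
   quotient of g at a satisfies the Cauchy criterion. *)
Lemma removable_cauchy (g : C -> C) (a : C) (r : R) : 0 < r ->
  ccont g a -> (forall z, 0 < modc (z - a) < r -> cdiff g z) ->
  forall e : R, 0 < e -> exists2 dl : R, 0 < dl &
  forall b b', 0 < modc (b - a) < dl -> 0 < modc (b' - a) < dl ->
    modc ((g b - g a) / (b - a) - (g b' - g a) / (b' - a)) <= e.
Proof.
move=> r0 ga gd e e0.
have [d1 d10 H1] := (ccont_modcP g a).1 ga 1 ltr01.
pose s : R := Num.min (r / 2) (d1 / 2).
have s0 : 0 < s by rewrite lt_min !divr_gt0.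
have sr : s < r by rewrite gt_min; apply/orP; left; lra.
have sd1 : s < d1 by rewrite gt_min; apply/orP; right; lra.
(* On the circle of radius [s] one has |z - b| >= s / 2. The choice of [k] bounds each of the two
   terms of the numerator there by e s^2 / 16, well within the required e / 2 times s^2 / 2. *)
pose k : R := e * s / 16 * Num.min 1 s.
have k0 : 0 < k by rewrite !mulr_gt0// lt_min ltr01.
have [d2 d20 H2] := (ccont_modcP g a).1 ga k k0.
pose dl : R := Num.min (s / 2) (Num.min d2 k).
exists dl; first by rewrite !lt_min divr_gt0// d20.
have gc z : modc (z - a) <= s -> ccont g z.
  move=> zs; have [->//|za] := eqVneq z a; apply: cdiff_cont; apply: gd.
  by rewrite modc_gt0 subr_eq0 za (le_lt_trans zs).
pose Q b := diff_quotient g b ('D_1 g b).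
have bd b : 0 < modc (b - a) < dl -> cdiff g b.
  case/andP=> b0; rewrite !lt_min => /andP[bs _]; apply: gd; rewrite b0 /=; lra.
have Qc b z : 0 < modc (b - a) < dl -> modc (z - a) <= s -> ccont (Q b) z.
  move=> hb zs; have [->|zb] := eqVneq z b.
    by apply: ccont_diff_quotient; exact: bd.
  by apply: ccont_diff_quotient_neq => //; exact: gc.
have Qcirc b z : 0 < modc (b - a) < dl -> modc (z - a) = s ->
    modc (Q b z - (g z - g a) / (z - a)) <= e / 2.
  case/andP => b0; rewrite !lt_min => /and3P[bs bd2 bk] zs.
  have zb : s / 2 <= modc (z - b).
    have := ler_modcD (z - b) (b - a); rewrite addrA subrK zs; lra.
  have zNb : z != b by apply: contraTneq zb => ->; rewrite subrr Normc.normc0 -ltNge divr_gt0.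
  have za0 : z - a != 0 by rewrite -modc_gt0 zs.
  have zb0 : z - b != 0 by rewrite subr_eq0.
  rewrite /Q /diff_quotient (negbTE zNb).
  have -> : (g z - g b) / (z - b) - (g z - g a) / (z - a) =
      ((g a - g b) * (z - a) + (g z - g a) * (b - a)) / ((z - b) * (z - a)).
    by field; rewrite za0 zb0.
  rewrite Normc.normcM Normc.normcV Normc.normcM zs.
  rewrite ler_pdivrMr; last by rewrite mulr_gt0// (lt_le_trans _ zb)// divr_gt0.
  apply: le_trans (ler_modcD _ _) _; rewrite !Normc.normcM zs.
  have h1 := ltW (H2 b bd2); rewrite modcB in h1.
  have h2 : modc (g z - g a) <= 1 by apply/ltW/H1; rewrite zs.
  have k1 : k <= e * s / 16 by rewrite ger_pMr ?ge_min ?lexx// !mulr_gt0.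
  have es0 : 0 < e * s / 16 by rewrite !mulr_gt0.
  have k2 : k <= e * s / 16 * s by rewrite ler_pM2l// ge_min lexx orbT.
  have h3 : modc (g a - g b) * s <= e * s / 16 * s.
    by rewrite ler_pM2r//; apply: le_trans h1 k1.
  have h4 : modc (g z - g a) * modc (b - a) <= e * s / 16 * s.
    apply: le_trans (_ : 1 * k <= _); last by rewrite mul1r.
    by apply: ler_pM; rewrite ?modc_ge0// ltW.
  apply: le_trans (lerD h3 h4) _; apply: le_trans (_ : e / 2 * (s / 2 * s) <= _).
    rewrite (_ : e / 2 * (s / 2 * s) = e * s / 16 * s + e * s / 16 * s + e * s / 8 * s); last by field.
    by rewrite lerDl !mulr_ge0// ltW.
  by rewrite ler_pM2l ?divr_gt0// ler_pM2r.
move=> b b' hb hb'.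
have QQ z : modc (z - a) <= s -> modc (Q b z - Q b' z) <= e.
  apply: (@maximum_modulus R (fun z => Q b z - Q b' z : C) a s e s0).
  - by move=> w ws; apply: ccontB; exact: Qc.
  - move=> w ws; have [d d0 H] := neq_avoid [:: a; b; b'] w.
    exists (Num.min d (s - modc (w - a))); first by rewrite lt_min d0 subr_gt0.
    move=> u /andP[u0]; rewrite lt_min => /andP[ud us].
    have := H u (introT andP (conj u0 ud)); rewrite !inE !negb_or => /and3P[ua ub ub'].
    have gu : cdiff g u.
      apply: gd; rewrite modc_gt0 subr_eq0 ua /=.
      have := ler_modcD (u - w) (w - a); rewrite addrA subrK; lra.
    by apply: cdiffB; apply: cdiff_diff_quotient.
  - move=> w ws; have := Qcirc b w hb ws; have := Qcirc b' w hb' ws.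
    set q : C := (g w - g a) / (w - a) => h1 h2.
    have -> : Q b w - Q b' w = (Q b w - q) - (Q b' w - q) by rewrite opprB addrA subrK.
    apply: le_trans (ler_modcD _ _) _; rewrite (modcN (Q b' w - q)) [e]splitr.
    exact: lerD h2 h1.
have := QQ a; rewrite subrr Normc.normc0 (ltW s0) => /(_ isT).
(* Divided differences are symmetric: g[c, a] = g[a, c]. *)
have nb c : 0 < modc (c - a) < dl -> Q c a = (g c - g a) / (c - a).
  case/andP; rewrite modc_gt0 subr_eq0 => ca _.
  by rewrite /Q /diff_quotient eq_sym (negbTE ca) -opprB -[a - c]opprB invrN mulrNN.
by rewrite !nb.
Qed.

(** The limit is taken along the sequence a + 1 / (n + 1), separately in real and imaginary
    parts. *)
Lemma cauchy_complex (Q : C -> C) (a : C) :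
  (forall e : R, 0 < e -> exists2 dl : R, 0 < dl & forall b b',
    0 < modc (b - a) < dl -> 0 < modc (b' - a) < dl -> modc (Q b - Q b') <= e) ->
  exists l : C, forall e : R, 0 < e -> exists2 dl : R, 0 < dl & forall b,
    0 < modc (b - a) < dl -> modc (Q b - l) <= e.
Proof.
move=> H.
pose c (n : nat) : C := a + (n.+1%:R^-1 : R)%:C.
have cE n : modc (c n - a) = n.+1%:R^-1 by rewrite addrC addKr modc_real ger0_norm ?invr_ge0.
have cdl (dl : R) : 0 < dl -> exists N, forall n, (N <= n)%N -> 0 < modc (c n - a) < dl.
  move=> dl0; exists (Num.trunc dl^-1) => n Nn; rewrite cE invr_gt0 ltr0n /=.
  rewrite invf_plt ?posrE ?ltr0n//; apply: lt_le_trans (truncnS_gt _) _.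
  by rewrite ler_nat ltnS.
have red (z w : C) : `|complex.Re z - complex.Re w| <= modc (z - w).
  by case: z w => [x y] [u v]; exact: (Re_le_modc ((x - u) +i* (y - v))).
have imd (z w : C) : `|complex.Im z - complex.Im w| <= modc (z - w).
  by case: z w => [x y] [u v]; exact: (Im_le_modc ((x - u) +i* (y - v))).
have limc (p : C -> R) : (forall z w, `|p z - p w| <= modc (z - w)) ->
    exists l, forall e : R, 0 < e -> exists N, forall n, (N <= n)%N -> `|p (Q (c n)) - l| <= e.
  move=> pl; have cp : cvg ((fun n => p (Q (c n))) @ \oo).
    apply/cauchy_cvgP/cauchy_exP => e e0.
    have [|dl dl0 H'] := H (e / 2); first by rewrite divr_gt0.
    have [N HN] := cdl dl dl0.
    exists (p (Q (c N))); exists N => // n /= Nn; rewrite /ball /=.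
    apply: le_lt_trans (pl _ _) _; apply: le_lt_trans (H' _ _ (HN _ (leqnn N)) (HN _ Nn)) _; lra.
  exists (lim ((fun n => p (Q (c n))) @ \oo)) => e e0.
  have /cvgrPdist_le /(_ e e0) [N _ HN] := cp.
  by exists N => n /HN; rewrite distrC.
have [l1 H1] := limc (@complex.Re R) red.
have [l2 H2]   := limc (@complex.Im R) imd.
exists (l1 +i* l2) => e e0; have e30 : 0 < e / 3 by rewrite divr_gt0.
have [dl dl0 H'] := H _ e30; exists dl => // b hb.
have [N HN] := cdl dl dl0; have [N1 HN1] := H1 _ e30; have [N2 HN2] := H2 _ e30.
pose n := maxn N (maxn N1 N2).
have Nn : (N <= n)%N by rewrite leq_maxl.
have N1n : (N1 <= n)%N by rewrite leq_max leq_maxl orbT.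
have N2n : (N2 <= n)%N by rewrite leq_max leq_maxr orbT.
rewrite (_ : Q b - _ = (Q b - Q (c n)) + (Q (c n) - (l1 +i* l2))); last by rewrite addrA subrK.
apply: le_trans (ler_modcD _ _) _; have h1 := H' _ _ hb (HN _ Nn).
have h2 : modc (Q (c n) - (l1 +i* l2)) <= e / 3 + e / 3.
  apply: le_trans (modc_le_ReIm _) _; have := HN1 _ N1n; have := HN2 _ N2n.
  by case: (Q (c n)) => x y /= *; lra.
lra.
Qed.

Theorem removable_singularity (g : C -> C) (a : C) (r : R) : 0 < r ->
  ccont g a -> (forall z, 0 < modc (z - a) < r -> cdiff g z) ->
  cdiff g a.
Proof.
move=> r0 ga gd; have [l Hl] := cauchy_complex (removable_cauchy r0 ga gd).
apply/cdiff_modcP; exists l => e e0; have [dl dl0 H] := Hl e e0.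
exists dl => // w wdl; have [->|wa] := eqVneq w a; first by rewrite !subrr mulr0 subr0 Normc.normc0 mulr0.
have wa0 : 0 < modc (w - a) by rewrite modc_gt0 subr_eq0.
have := H w; rewrite wa0 wdl => /(_ isT); rewrite -(ler_pM2r wa0) -Normc.normcM.
by rewrite mulrBl divfK// subr_eq0.
Qed.

(** This takes the place of infinite differentiability: a zero at [b] can be divided out without
    leaving the functions holomorphic on the disc. *)
Lemma cdiff_divided_difference (f : C -> C) (a b : C) (r : R) :
  (forall z, modc (z - a) < r -> cdiff f z) -> modc (b - a) < r ->
  forall z, modc (z - a) < r -> cdiff (diff_quotient f b ('D_1 f b)) z.
Proof.
move=> fd br z zr; have [->|zb] := eqVneq z b; last by apply: cdiff_diff_quotient => //; exact: fd.
have s0 : 0 < r - modc (b - a) by rewrite subr_gt0.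
apply: removable_singularity s0 _ _; first by apply: ccont_diff_quotient; exact: fd.
move=> w /andP[]; rewrite modc_gt0 subr_eq0 => wb ws.
apply: cdiff_diff_quotient => //; apply: fd.
have := ler_modcD (w - b) (b - a); rewrite addrA subrK; lra.
Qed.

End Removable.

(** * Orders of zeros and Hurwitz' theorem *)

Section Zeros.
Variable R : realType.
Notation C := R[i]^o.
Implicit Types (f g u : C -> C) (a b z : C).

(** If z - a can be divided out [n] times, the maximum principle bounds the quotient by max |f| / (r
    / 2) ^ n on the disc of radius r / 2, hence |f| by max |f| / 2 ^ n on the disc of radius r / 4.
    If this never stops, [f] vanishes there. *)
Lemma zero_order f a (r : R) : 0 < r -> (forall z, modc (z - a) < r -> cdiff f z) ->
  (forall z, modc (z - a) < r / 4 -> f z = 0) \/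
  exists k u, [/\ forall z, modc (z - a) < r -> cdiff u z, u a != 0 &
                  forall z, f z = (z - a) ^+ k * u z].
Proof.
move=> r0 fd; have [|NH] := pselect (exists k u, [/\ forall z, modc (z - a) < r -> cdiff u z,
  u a != 0 & forall z, f z = (z - a) ^+ k * u z]); [by right|left].
have H k : exists2 u, forall z, modc (z - a) < r -> cdiff u z & forall z, f z = (z - a) ^+ k * u z.
  elim: k => [|k [u ud fu]]; first by exists f => // z; rewrite expr0 mul1r.
  have ua : u a = 0 by apply/eqP/negP => /negP ua; apply: NH; exists k, u; split.
  exists (diff_quotient u a ('D_1 u a)).
    by apply: cdiff_divided_difference ud _; rewrite subrr Normc.normc0.
  by move=> z; rewrite fu {1}(diff_quotientK u a ('D_1 u a) z) ua add0r exprSr mulrA.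
have r20 : 0 < r / 2 by rewrite divr_gt0.
have lt_r z : modc (z - a) <= r / 2 -> modc (z - a) < r by move=> h; apply: le_lt_trans h _; lra.
have [|z0 _ Mf] := @disc_max R (fun z => modc (f z)) a _ (ltW r20).
  move=> z /lt_r /fd /cdiff_cont /ccontP fz.
  exact: (@continuous_comp _ _ _ f (@Normc.normc R : C -> R) z fz (@continuous_modc R (f z))).
move=> z zr; apply/eqP/negP => /negP fz0.
have fz : 0 < modc (f z) by rewrite modc_gt0.
have [n] := divr_expr2_lt (modc (f z0)) fz; apply/negP; rewrite -leNgt.
have [u ud fu] := H n.
have um w : modc (w - a) <= r / 2 -> modc (u w) <= modc (f z0) / (r / 2) ^+ n.
  apply: maximum_modulus => //.
  - by move=> v /lt_r /ud /cdiff_cont.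
  - move=> v vr; exists (r / 2 - modc (v - a)) => [|y /andP[_ yv]]; first by rewrite subr_gt0.
    apply: ud; apply: lt_r; have := ler_modcD (y - v) (v - a); rewrite addrA subrK; lra.
  - move=> v vr; rewrite ler_pdivlMr ?exprn_gt0// mulrC -vr -modcX -Normc.normcM -fu.
    by apply: Mf; rewrite vr.
have zr2 : modc (z - a) <= r / 2 by apply: ltW; apply: lt_le_trans zr _; lra.
rewrite fu Normc.normcM modcX; apply: le_trans (_ : (r / 4) ^+ n * (modc (f z0) / (r / 2) ^+ n) <= _).
  apply: ler_pM; rewrite ?exprn_ge0 ?modc_ge0//; last exact: um.
  by apply: lerXn2r; rewrite ?nnegrE ?modc_ge0 ?divr_ge0 ?ltW.
rewrite mulrCA ler_wpM2l ?modc_ge0//.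
rewrite (_ : r / 4 = r / 2 * 2^-1); last by field.
by rewrite exprMn mulrAC divff ?expf_neq0 ?gt_eqF// mul1r exprVn.
Qed.

(** By induction on the exponent. If [g] had no zero in the disc, the maximum principle for 1 / g
    would bound |g| at [a] from below by its minimum on the circle, although it is small at [a]. A
    zero must be close to [a], as the model function is small there; after dividing it out, the
    quotient is close to the model of lower exponent. The explicit list of zeros, with a cofactor
    [v] that does not vanish, replaces a count by winding numbers. *)
Lemma hurwitz (a : C) (r r' m M : R) (u : C -> C) : 0 < r -> r < r' -> 0 < m ->
  (forall z, modc (z - a) < r' -> cdiff u z) ->
  (forall z, modc (z - a) <= r -> m <= modc (u z) <= M) ->
  forall (k : nat) (rho : R), 0 < rho -> exists2 e : R, 0 < e & forall g,
  (forall z, modc (z - a) < r' -> cdiff g z) ->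
  (forall z, modc (z - a) = r -> modc (g z - (z - a) ^+ k * u z) <= e) ->
  exists (l : seq C) v, [/\ size l = k, forall b, b \in l -> modc (b - a) < rho,
    forall z, modc (z - a) < r' -> cdiff v z,
    forall z, modc (z - a) <= r -> v z != 0 &
    forall z, g z = \prod_(b <- l) (z - b) * v z].
Proof.
move=> r0 rr' m0 ud uM; elim=> [|k IHk] rho rho0.
  exists (m / 2) => [|g gd gu]; first by rewrite divr_gt0.
  exists [::], g; split=> // [z zr|z]; last by rewrite big_nil mul1r.
  have : modc (g z - u z) <= m / 2.
    apply: (@maximum_modulus R (fun z => g z - u z) a r _ r0) => //.
    - by move=> w wr; apply/cdiff_cont/cdiffB; [apply: gd|apply: ud]; exact: le_lt_trans rr'.
    - move=> w wr; exists (r - modc (w - a)) => [|y /andP[_ yw]]; first by rewrite subr_gt0.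
      have yr : modc (y - a) < r'.
        have := ler_modcD (y - w) (w - a); rewrite addrA subrK; lra.
      by apply: cdiffB; [exact: gd|exact: ud].
    - by move=> w /gu; rewrite expr0 mul1r.
  have /andP[mu _] := uM z zr; move=> h; apply/eqP => gz0; move: h; rewrite gz0 sub0r modcN.
  by apply/negP; rewrite -ltNge; lra.
have [e1 e10 IH] := IHk rho rho0.
have aar : modc (a - a) <= r by rewrite subrr Normc.normc0 ltW.
have M0 : 0 < M by have /andP[h1 h2] := uM a aar; rewrite (lt_le_trans m0)// (le_trans h1).
have rk0 : 0 < r ^+ k by rewrite exprn_gt0.
(* For |z1 - a| < [rho1], replacing one factor z - a by z - z1 changes the model by at most e1 r / 4
   on the circle; the bound r / 2 keeps |z - z1| >= r / 2 there. *)
pose rho1 : R := Num.min (Num.min rho (r / 2)) (e1 * r / (4 * (r ^+ k * M))).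
have rho10 : 0 < rho1 by rewrite !lt_min rho0 !divr_gt0// !mulr_gt0.
have rho1M : rho1 * (r ^+ k * M) <= e1 * r / 4.
  apply: le_trans (_ : e1 * r / (4 * (r ^+ k * M)) * (r ^+ k * M) <= _).
    by rewrite ler_pM2r ?mulr_gt0// ge_min lexx orbT.
  by rewrite le_eqVlt; apply/orP; left; apply/eqP; field; rewrite !gt_eqF.
pose A : R := r ^+ k.+1.
have A0 : 0 < A by rewrite exprn_gt0.
(* The three bounds respectively produce a zero [z1], bring it within [rho1] of [a], and leave the
   quotient within [e1] of the model. *)
pose e : R := Num.min (m * A / 4) (Num.min (m * rho1 ^+ k.+1 / 2) (e1 * r / 4)).
have e0 : 0 < e by rewrite !lt_min !divr_gt0// mulr_gt0// exprn_gt0.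
exists e => // g gd gu.
have disc z : modc (z - a) <= r -> modc (z - a) < r' by move/le_lt_trans; apply.
have powd z : modc (z - a) < r' -> cdiff (fun z => (z - a) ^+ k.+1 * u z) z.
  by move=> zr; apply: cdiffM; [apply: cdiffX; exact: cdiff_subr|exact: ud].
have h z : modc (z - a) <= r -> modc (g z - (z - a) ^+ k.+1 * u z) <= e.
  apply: (@maximum_modulus R (fun z => g z - (z - a) ^+ k.+1 * u z) a r _ r0) => //.
  - by move=> w /disc wr; apply/cdiff_cont/cdiffB; [exact: gd|exact: powd].
  - move=> w wr; exists (r - modc (w - a)) => [|y /andP[_ yw]]; first by rewrite subr_gt0.
    have yr : modc (y - a) < r'.
      have := ler_modcD (y - w) (w - a); rewrite addrA subrK; lra.
    by apply: cdiffB; [exact: gd|exact: powd].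
have [z1 z1r gz1] : exists2 z1, modc (z1 - a) <= r & g z1 = 0.
  apply: contrapT => /forall2NP NZ.
  have gN0 z : modc (z - a) <= r -> g z != 0 by move=> zr; have [//|/eqP] := NZ z.
  have aa : modc (a - a) <= r by rewrite subrr Normc.normc0 ltW.
  have : modc (g a)^-1 <= (3 * (m * A / 4))^-1.
    apply: (@maximum_modulus R (fun z => (g z)^-1) a r _ r0) => //.
    - by move=> w wr; apply/cdiff_cont/cdiffV; [exact: gN0|exact/gd/disc].
    - move=> w wr; exists (r - modc (w - a)) => [|y /andP[_ yw]]; first by rewrite subr_gt0.
      have yr : modc (y - a) <= r.
        have := ler_modcD (y - w) (w - a); rewrite addrA subrK; lra.
      by apply: cdiffV; [exact: gN0|exact/gd/disc].
    - move=> w wr; rewrite Normc.normcV lef_pV2 ?posrE ?modc_gt0 ?gN0 ?wr//; last first.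
        by rewrite !mulr_gt0.
      have : m * A <= modc ((w - a) ^+ k.+1 * u w).
        rewrite Normc.normcM modcX wr mulrC ler_pM2l//.
        have wr' : modc (w - a) <= r by rewrite wr.
        by have /andP[] := uM w wr'.
      have : modc ((w - a) ^+ k.+1 * u w) <= modc (g w) + modc (g w - (w - a) ^+ k.+1 * u w).
        by have := ler_modcD (g w) (- (g w - (w - a) ^+ k.+1 * u w)); rewrite opprB addrC subrK modcB.
      have : e <= m * A / 4 by rewrite ge_min lexx.
      have := h w; rewrite wr lexx => /(_ isT); lra.
  have ga : modc (g a) <= m * A / 4.
    have := h a aa; rewrite subrr expr0n /= mul0r subr0 => /le_trans; apply.
    by rewrite ge_min lexx.
  have ga0 : 0 < modc (g a) by rewrite modc_gt0 gN0.
  rewrite Normc.normcV lef_pV2 ?posrE ?mulr_gt0//; have : 0 < m * A by rewrite mulr_gt0.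
  lra.
have z1rho : modc (z1 - a) < rho1.
  have := h z1 z1r; rewrite gz1 sub0r modcN Normc.normcM modcX => hz1.
  rewrite -(@ltr_pXn2r _ k.+1)// ?nnegrE ?modc_ge0 ?(ltW rho10)//.
  have /andP[mu _] := uM z1 z1r.
  rewrite -(ltr_pM2l m0); apply: le_lt_trans (_ : m * rho1 ^+ k.+1 / 2 < _); last first.
    have : 0 < m * rho1 ^+ k.+1 by rewrite mulr_gt0// exprn_gt0.
    lra.
  apply: le_trans (_ : e <= _); last by rewrite !ge_min lexx orbT.
  by apply: le_trans hz1; rewrite mulrC ler_wpM2l// exprn_ge0// modc_ge0.
pose g1 := diff_quotient g z1 ('D_1 g z1).
have gE z : g z = (z - z1) * g1 z by rewrite (diff_quotientK g z1 ('D_1 g z1) z) gz1 add0r.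
have g1d z : modc (z - a) < r' -> cdiff g1 z.
  by move=> zr; apply: (cdiff_divided_difference gd) => //; exact: disc.
have [|l [v [sl lrho vd v0 g1E]]] := IH g1 g1d.
  move=> z zr; have z1r2 : modc (z1 - a) < r / 2.
    by apply: lt_le_trans z1rho _; rewrite !ge_min lexx orbT.
  have zz1 : r / 2 <= modc (z - z1).
    have := ler_modcD (z - z1) (z1 - a); rewrite addrA subrK zr; lra.
  rewrite -(@ler_pM2l _ (r / 2)) ?divr_gt0//.
  apply: le_trans (_ : modc (z - z1) * modc (g1 z - (z - a) ^+ k * u z) <= _).
    by rewrite ler_wpM2r ?modc_ge0.
  rewrite -Normc.normcM.
  have -> : (z - z1) * (g1 z - (z - a) ^+ k * u z) =
      (g z - (z - a) ^+ k.+1 * u z) + (z1 - a) * ((z - a) ^+ k * u z).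
    by rewrite gE exprS; ring.
  apply: le_trans (ler_modcD _ _) _; rewrite (Normc.normcM (z1 - a)) (Normc.normcM (_ ^+ _)) modcX zr.
  have h1 : modc (g z - (z - a) ^+ k.+1 * u z) <= e1 * r / 4.
    by apply: le_trans (h z _) _; [rewrite zr|rewrite !ge_min lexx !orbT].
  have h2 : modc (z1 - a) * (r ^+ k * modc (u z)) <= e1 * r / 4.
    apply: le_trans rho1M; apply: ler_pM; rewrite ?modc_ge0 ?(ltW z1rho)//.
      by rewrite mulr_ge0 ?modc_ge0// ltW.
    have zr' : modc (z - a) <= r by rewrite zr.
    by rewrite ler_pM2l//; have /andP[] := uM z zr'.
  have -> : r / 2 * e1 = e1 * r / 4 + e1 * r / 4 by field.
  exact: lerD h1 h2.
exists (z1 :: l), v; split=> //; first by rewrite /= sl.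
  move=> b; rewrite inE => /predU1P[->|/lrho//].
  by apply: lt_le_trans z1rho _; rewrite !ge_min lexx.
by move=> z; rewrite gE g1E big_cons mulrA.
Qed.

End Zeros.

(** * Leading coefficients at a point *)

Section Leading.
Variable R : realType.
Notation C := R[i]^o.
Implicit Types (f g u q : C -> C) (a b v w z : C) (n m : int).

Definition hol f a := \forall z \near a, cdiff f z.

(** The coefficient [v] may be zero: the order of [f] at [a] is at least [n], and [v] is the
    coefficient of (z - a)^n. Thus functions of different orders can be added, and vectors of
    coefficients formed, at a common exponent. *)
Variant lead f a n v : Prop := Lead u of
  [/\ hol u a, u a = v & \forall z \near a^', f z = (z - a : R[i]) ^ n * u z].

Lemma near_punctured (P : C -> Prop) a : (\forall z \near a, P z) -> \forall z \near a^', P z.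
Proof. exact: cvg_within. Qed.

Lemma hol_cdiff f a : hol f a -> cdiff f a.
Proof. exact: nbhs_singleton. Qed.

Lemma hol_near f a : hol f a -> \forall z \near a, hol f z.
Proof. by rewrite /hol => /near_join. Qed.

Lemma cont_near_neq0 f a : ccont f a -> f a != 0 -> \forall z \near a, f z != 0.
Proof.
move=> /ccont_modcP fa fa0; have [|d d0 H] := fa (modc (f a)); first by rewrite modc_gt0.
apply/nearcP; exists d => // z /H; apply: contraTneq => ->.
by rewrite sub0r (modcN (f a)) ltxx.
Qed.

Lemma hol_cst v a : hol (fun=> v) a.
Proof. by near=> z; exact: cdiff_cst. Unshelve. all: by end_near. Qed.

Lemma hol_subr b a : hol (fun z => z - b) a.
Proof. by near=> z; exact: cdiff_subr. Unshelve. all: by end_near. Qed.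

Lemma holD f g a : hol f a -> hol g a -> hol (fun z => f z + g z) a.
Proof. by apply: filterS2 => z; exact: cdiffD. Qed.

Lemma holM f g a : hol f a -> hol g a -> hol (fun z => f z * g z) a.
Proof. by apply: filterS2 => z; exact: cdiffM. Qed.

Lemma holV f a : f a != 0 -> hol f a -> hol (fun z => (f z)^-1) a.
Proof.
move=> fa0 fa; have /cdiff_cont/cont_near_neq0/(_ fa0) := hol_cdiff fa.
by apply: filterS2 fa => z; move=> /[swap]; exact: cdiffV.
Qed.

Lemma holX f (k : nat) a : hol f a -> hol (fun z => f z ^+ k) a.
Proof. by apply: filterS => z; exact: cdiffX. Qed.

Lemma hol_exprz f n a : f a != 0 -> hol f a -> hol (fun z => (f z : R[i]) ^ n) a.
Proof.
case: n => k fa0 fa; first exact: (@holX f k).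
apply: (@holV (fun z => f z ^+ k.+1)); last exact: holX.
by rewrite expf_neq0.
Qed.

Lemma hol_comp f g a : hol f a -> hol g (f a) -> hol (fun z => g (f z)) a.
Proof.
move=> fa ga; have /ccontP fc := cdiff_cont (hol_cdiff fa).
have := fc _ ga; apply: filterS2 fa => z fz gz.
exact: (cdiff_comp fz gz).
Qed.

Lemma lead_near_eq f g a n v : (\forall z \near a^', f z = g z) -> lead f a n v -> lead g a n v.
Proof.
move=> fg [u [uh ua fu]]; exists u; split=> //.
by apply: filterS2 fg fu => z ->.
Qed.

Lemma lead_hol u a : hol u a -> lead u a 0 (u a).
Proof. by move=> uh; exists u; split=> //; near=> z; rewrite expr0z mul1r. Unshelve. all: by end_near. Qed.

Lemma lead_cst v a : lead (fun=> v) a 0 v.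
Proof. exact: (lead_hol (hol_cst v a)). Qed.

Lemma leadD f g a n v w : lead f a n v -> lead g a n w -> lead (fun z => f z + g z) a n (v + w).
Proof.
move=> [u [uh ua fu]] [u' [uh' ua' fu']]; exists (fun z => u z + u' z); split.
- exact: holD.
- by rewrite ua ua'.
- by apply: filterS2 fu fu' => z -> ->; rewrite mulrDr.
Qed.

Lemma neq_punctured a : \forall z \near a^', z - a != 0.
Proof. by near=> z; rewrite subr_eq0; near: z; exact: nbhs_dnbhs_neq. Unshelve. all: by end_near. Qed.

Lemma leadM f g a n m v w : lead f a n v -> lead g a m w ->
  lead (fun z => f z * g z) a (n + m) (v * w).
Proof.
move=> [u [uh ua fu]] [u' [uh' ua' fu']]; exists (fun z => u z * u' z); split.
- exact: holM.
- by rewrite ua ua'.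
- near=> z; have za : z - a != 0 by near: z; exact: neq_punctured.
  rewrite expfzDr// (near fu z)// (near fu' z)//.
  by rewrite mulrACA.
Unshelve. all: by end_near. Qed.

Lemma leadZ c f a n v : lead f a n v -> lead (fun z => c * f z) a n (c * v).
Proof. by move=> /(leadM (lead_cst c a)); rewrite add0r. Qed.

Lemma leadV f a n v : v != 0 -> lead f a n v -> lead (fun z => (f z)^-1) a (- n) v^-1.
Proof.
move=> v0 [u [uh ua fu]]; exists (fun z => (u z)^-1); split.
- by apply: holV => //; rewrite ua.
- by rewrite ua.
- by apply: filterS fu => z ->; rewrite invfM invr_expz.
Qed.

Lemma cont_punctured_eq f a v : ccont f a -> (\forall z \near a^', f z = v) -> f a = v.
Proof.
move=> /ccont_modcP fc; rewrite /dnbhs /within /= => /nearcP[d d0 H].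
apply/eqP; rewrite -subr_eq0 -modc_eq0 -[_ == 0]negbK; apply/negP => m0.
have {}m0 : 0 < modc (f a - v) by rewrite lt_neqAle eq_sym m0 modc_ge0.
have [dl dl0 H'] := fc _ m0.
pose e : R := Num.min (d / 2) (dl / 2).
have e0 : 0 < e by rewrite lt_min !divr_gt0.
have ez : modc (a + e%:C - a) = e by rewrite addrC addKr modc_real gtr0_norm.
have eN : a + e%:C != a.
  by rewrite -subr_eq0 -modc_gt0 ez.
have := H' (a + e%:C); rewrite ez H// ?ez; last by rewrite gt_min; apply/orP; left; lra.
rewrite (modcB v) ltxx; have : e < dl by rewrite gt_min; apply/orP; right; lra.
by move=> /[swap]/[apply].
Qed.

Lemma lead_uniq f a n v w : lead f a n v -> lead f a n w -> v = w.
Proof.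
move=> [u [uh ua fu]] [u' [uh' ua' fu']]; rewrite -ua -ua'; apply/eqP; rewrite -subr_eq0; apply/eqP.
apply: (@cont_punctured_eq (fun z => u z - u' z)).
  by apply: ccontB; apply/cdiff_cont/hol_cdiff.
near=> z; have za : z - a != 0 by near: z; exact: neq_punctured.
have := near fu z; rewrite (near fu' z)// => /(_ _)/(mulfI _) <-; rewrite ?subrr//.
by rewrite expfz_neq0.
Unshelve. all: by end_near. Qed.

Lemma hol_divided f a : hol f a -> exists2 q, hol q a & forall z, f z = f a + (z - a) * q z.
Proof.
move=> /nearcP[r r0 H]; exists (diff_quotient f a ('D_1 f a)); last exact: diff_quotientK.
apply/nearcP; exists r => //; apply: (cdiff_divided_difference H).
by rewrite subrr Normc.normc0.
Qed.

Lemma lead_succ f a n : lead f a n 0 <-> exists w, lead f a (n + 1) w.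
Proof.
split=> [[u [uh ua fu]]|[w [u [uh ua fu]]]].
  have [q qh uq] := hol_divided uh; exists (q a), q; split=> //.
  near=> z; have za : z - a != 0 by near: z; exact: neq_punctured.
  by rewrite (near fu z)// uq ua add0r expfzDr// expr1z mulrA.
exists (fun z => (z - a) * u z); split; first by apply: holM => //; exact: hol_subr.
  by rewrite subrr mul0r.
near=> z; have za : z - a != 0 by near: z; exact: neq_punctured.
by rewrite (near fu z)// expfzDr// expr1z mulrA.
Unshelve. all: by end_near. Qed.

Lemma lead_lt f a n m v : m < n -> lead f a n v -> lead f a m 0.
Proof.
move=> mn [u [uh ua fu]].
have [k nE] : exists k : nat, n = m + 1 + k%:Z.
  by exists (absz (n - (m + 1))%R); rewrite gez0_abs; lia.
apply/lead_succ; exists ((fun z => (z - a) ^+ k * u z) a), (fun z => (z - a) ^+ k * u z); split=> //.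
  by apply: holM => //; apply: holX; exact: hol_subr.
near=> z; have za : z - a != 0 by near: z; exact: neq_punctured.
by rewrite (near fu z)// nE expfzDr// mulrA.
Unshelve. all: by end_near. Qed.

Lemma lead_order_uniq f a n m v w : v != 0 -> w != 0 -> lead f a n v -> lead f a m w -> n = m.
Proof.
move=> v0 w0 fn fm; case: (ltgtP n m) => // h.
  by have := lead_uniq fn (lead_lt h fm) => /eqP; rewrite (negbTE v0).
by have := lead_uniq fm (lead_lt h fn) => /eqP; rewrite (negbTE w0).
Qed.

Lemma lead_dichotomy f a n v : lead f a n v ->
  (\forall z \near a^', f z = 0) \/ exists m w, [/\ n <= m, w != 0 & lead f a m w].
Proof.
move=> [u [/nearcP[r r0 uh] ua fu]]; have [u0|[k [u' [uh' ua' uE]]]] := zero_order r0 uh.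
  left; near=> z; rewrite (near fu z)// u0 ?mulr0//.
  by near: z; apply: near_punctured; apply/nearcP; exists (r / 4) => //; rewrite divr_gt0.
right; exists (n + k%:Z), (u' a); split=> //; first by rewrite lerDl.
exists u'; split=> //; first by apply/nearcP; exists r.
near=> z; have za : z - a != 0 by near: z; exact: neq_punctured.
by rewrite (near fu z)// uE expfzDr// mulrA.
Unshelve. all: by end_near. Qed.

Lemma dnbhs_join (P : C -> Prop) a :
  (\forall z \near a^', P z) -> \forall z \near a^', z != a /\ \forall w \near z, P w.
Proof.
rewrite /dnbhs /within /= => /nearcP[d d0 H].
apply/nearcP; exists d => // z zd za; split=> //; apply/nearcP.
exists (Num.min (d - modc (z - a)) (modc (z - a))).
  by rewrite lt_min subr_gt0 zd modc_gt0 subr_eq0.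
move=> w; rewrite lt_min => /andP[w1 w2]; apply: H.
  have := ler_modcD (w - z) (z - a); rewrite addrA subrK; lra.
by apply: contraTneq w2 => ->; rewrite modcB ltxx.
Qed.

(** Away from [a] the powers of z - a are units, so that zeros and poles are isolated. *)
Lemma lead_near f a n v : lead f a n v ->
  \forall z \near a^', exists2 w, lead f z 0 w & v != 0 -> w != 0.
Proof.
move=> [u [uh ua fu]]; have uc := cdiff_cont (hol_cdiff uh).
have u0 : \forall z \near a, v != 0 -> u z != 0.
  have [v0|v0] := eqVneq v 0; first by near=> z.
  by rewrite -ua in v0; apply: filterS (cont_near_neq0 uc v0) => z ? _.
near=> z; have [za fz] : z != a /\ \forall w \near z, f w = (w - a : R[i]) ^ n * u w.
  by near: z; exact: dnbhs_join.
have za0 : z - a != 0 by rewrite subr_eq0.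
have uz : hol u z by near: z; apply: near_punctured; exact: hol_near.
have vz : v != 0 -> u z != 0 by near: z; exact: near_punctured.
have H : hol (fun w => (w - a : R[i]) ^ n * u w) z.
  apply: holM => //; apply: (@hol_exprz (fun w => w - a)) => //; exact: hol_subr.
exists ((z - a : R[i]) ^ n * u z).
  apply: lead_near_eq (lead_hol H); apply: near_punctured.
  by apply: filterS fz => w ->.
by move=> /vz uz0; rewrite mulf_neq0// expfz_neq0.
Unshelve. all: by end_near. Qed.

(** The divided differences of [theta] and [psi] multiply to 1 off [a], by the chain rule, hence
    also at [a] by continuity; so that of [psi] is not zero at [a]. *)
Lemma local_coordinate (psi theta : C -> C) a : hol psi a -> cdiff theta (psi a) ->
  (\forall z \near a, theta (psi z) = z) ->
  exists q, [/\ hol q a, q a != 0 & forall z, psi z = psi a + (z - a) * q z].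
Proof.
move=> ph td tp; have [q qh pq] := hol_divided ph; exists q; split=> //.
apply/negP => /eqP qa0.
pose d := diff_quotient theta (psi a) ('D_1 theta (psi a)).
have pc := cdiff_cont (hol_cdiff ph).
have Fc : ccont (fun z => d (psi z) * q z) a.
  apply: ccontM; last exact/cdiff_cont/hol_cdiff.
  case: pc => pc; have [dc] := ccont_diff_quotient td; split.
  exact: (@continuous_comp _ _ _ psi d a pc dc).
have : d (psi a) * q a = 1.
  apply: (@cont_punctured_eq (fun z => d (psi z) * q z) a 1 Fc); near=> z.
  have za : z - a != 0 by near: z; exact: neq_punctured.
  apply: (mulfI za); rewrite mulr1 mulrCA.
  have -> : (z - a) * q z = psi z - psi a by rewrite (pq z) [in RHS]addrC addKr.
  have := diff_quotientK theta (psi a) ('D_1 theta (psi a)) (psi z).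
  rewrite (nbhs_singleton tp) (near (near_punctured tp) z)// -/d => E.
  by apply: (addrI a); rewrite mulrC -E addrCA subrr addr0.
by rewrite qa0 mulr0 => /eqP; rewrite eq_sym oner_eq0.
Unshelve. all: by end_near. Qed.

(** The factor [c] is the [n]-th power of the derivative of [psi] at [a]. That it does not depend on
    [f] is essential: the coefficients of several functions are scaled together and keep defining
    the same point of projective space. *)
Lemma lead_comp (psi theta : C -> C) a n : hol psi a -> cdiff theta (psi a) ->
  (\forall z \near a, theta (psi z) = z) ->
  exists2 c, c != 0 & forall f v, lead f (psi a) n v -> lead (fun z => f (psi z)) a n (c * v).
Proof.
move=> ph td tp; have [q [qh qa pq]] := local_coordinate ph td tp.
exists ((q a : R[i]) ^ n); first by rewrite expfz_neq0.
move=> f v [u [uh ua fu]]; exists (fun z => (q z : R[i]) ^ n * u (psi z)); split.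
- by apply: holM; [exact: hol_exprz|exact: hol_comp].
- by rewrite ua.
have pc := cdiff_cont (hol_cdiff ph); case: pc => pc.
have q0 := cont_near_neq0 (cdiff_cont (hol_cdiff qh)) qa.
have /pc fu' := fu; near=> z.
have za : z - a != 0 by near: z; exact: neq_punctured.
have qz : q z != 0 by near: z; exact: near_punctured.
have pz : psi z - psi a = (z - a) * q z by rewrite (pq z) [LHS]addrC addKr.
have pza : psi z != psi a by rewrite -subr_eq0 pz mulf_neq0.
rewrite (_ : f (psi z) = (psi z - psi a : R[i]) ^ n * u (psi z)).
  by rewrite pz expfzMl mulrA.
by move: pza; near: z; apply: near_punctured; exact: fu'.
Unshelve. all: by end_near. Qed.

(** The Schwarz reflection of [f]. *)
Definition conjf f : C -> C := fun z => conjc (f (conjc z)).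

Lemma modc_conj z : modc (conjc z) = modc z.
Proof. by case: z => x y /=; rewrite sqrrN. Qed.

Lemma cdiff_conj f z : cdiff f (conjc z) -> cdiff (conjf f) z.
Proof.
move=> /cdiff_modcP[d H]; apply/cdiff_modcP; exists (conjc d) => e /H[dl dl0 {}H].
exists dl => // w wz; have := H (conjc w).
have cB (x y : C) : conjc x - conjc y = conjc (x - y) by rewrite rmorphB.
have -> : modc (conjc w - conjc z) = modc (w - z) by rewrite cB modc_conj.
move=> /(_ wz); rewrite -(modc_conj (f _ - _ - _)); congr (modc _ <= _).
rewrite /conjf; case: (f (conjc w)) => ? ?; case: (f (conjc z)) => ? ?.
case: (d) => ? ?; case: (w) => ? ?; case: (z) => ? ? /=.
by apply/eqP; rewrite eq_complex /=; apply/andP; split; apply/eqP; ring.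
Qed.

Lemma near_conj (P : C -> Prop) a : (\forall z \near (conjc a : C), P z) -> \forall z \near a, P (conjc z).
Proof.
move=> /nearcP[d d0 H]; apply/nearcP; exists d => // z zd; apply: H.
by rewrite -rmorphB modc_conj.
Qed.

Lemma hol_conj f a : hol f (conjc a) -> hol (conjf f) a.
Proof. by move=> /near_conj; apply: filterS => z; exact: cdiff_conj. Qed.

Lemma lead_conj f a n v : lead f a n v -> lead (conjf f) (conjc a : C) n (conjc v).
Proof.
move=> [u [uh ua fu]]; exists (conjf u); split; first by apply: hol_conj; rewrite conjcK.
  by rewrite /conjf conjcK ua.
move: fu; rewrite /dnbhs /within /= -{1}[a]conjcK => /near_conj; apply: filterS => z H za.
rewrite /conjf H; last by apply: contra_neq za => <-; rewrite conjcK.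
rewrite rmorphM /=; congr (_ * _); rewrite -[in RHS](conjcK z) -rmorphB.
exact: fmorphXz.
Qed.

End Leading.

(** * Meromorphic functions on a compact Riemann surface *)

Section Surface.
Variables (R : realType) (X : curve R).
Notation C := R[i]^o.
Implicit Types (f g : X -> R[i]) (x y : X) (c d : rs_chart X) (n m : int) (v w : C) (z : C).

Lemma dnbhsP (T : topologicalType) (x : T) (P : T -> Prop) :
  (\forall y \near x^', P y) <-> (\forall y \near x, y != x -> P y).
Proof. by []. Qed.

Lemma near_cod c z : rs_cod c z -> \forall w \near z, rs_cod c w.
Proof. by move=> cz; apply: open_nbhs_nbhs; split=> //; exact: rs_cod_open. Qed.

Lemma near_dom c x : rs_dom c x -> \forall y \near x, rs_dom c y.
Proof. by move=> cx; apply: open_nbhs_nbhs; split=> //; exact: rs_dom_open. Qed.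

Lemma near_param c x (P : X -> Prop) : rs_dom c x ->
  (\forall y \near x, P y) -> \forall z \near rs_coord c x, P (rs_param c z).
Proof.
move=> cx xP; apply: (rs_param_continuous (rs_coord_cod cx)).
by rewrite rs_coordK.
Qed.

Lemma near_coord c x (P : X -> Prop) : rs_dom c x ->
  (\forall z \near rs_coord c x, P (rs_param c z)) -> \forall y \near x, P y.
Proof.
move=> cx xP; have H := rs_coord_continuous cx xP.
near=> y; rewrite -(@rs_coordK _ _ c y); last by near: y; exact: near_dom.
by near: y.
Unshelve. all: by end_near. Qed.

Lemma near_param_punctured c x (P : X -> Prop) : rs_dom c x ->
  (\forall y \near x^', P y) -> \forall z \near (rs_coord c x)^', P (rs_param c z).
Proof.
move=> cx /dnbhsP /(near_param cx) H; apply/dnbhsP.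
near=> z => zx; apply: (near H z) => //; apply: contra_neq zx => <-.
by rewrite rs_paramK//; near: z; exact/near_cod/rs_coord_cod.
Unshelve. all: by end_near. Qed.

Lemma near_coord_punctured c x (P : X -> Prop) : rs_dom c x ->
  (\forall z \near (rs_coord c x)^', P (rs_param c z)) -> \forall y \near x^', P y.
Proof.
move=> cx /dnbhsP H; apply/dnbhsP/(near_coord cx).
near=> z => zx; apply: (near H z) => //; apply: contra_neq zx => ->.
exact: rs_coordK.
Unshelve. all: by end_near. Qed.

Definition chart_lead c f x n v := lead (f \o rs_param c : C -> C) (rs_coord c x) n v.

Lemma hol_near_eq (u w : C -> C) (a : C) : (\forall z \near a, u z = w z) -> hol u a -> hol w a.
Proof.
move=> /near_join uw ua; apply: filterS2 uw ua => z; exact: cdiff_near_eq.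
Qed.

Lemma hol_transition c d x : rs_dom c x -> rs_dom d x ->
  hol (rs_coord d \o rs_param c) (rs_coord c x).
Proof.
move=> cx dx; have cz := rs_coord_cod cx.
have := near_param cx (near_dom dx); apply: filterS2 (near_cod cz) => z zc zd.
by split; exact: rs_transition.
Qed.

Lemma holo_nearP f x c : rs_dom c x -> holo_near f x <-> hol (f \o rs_param c) (rs_coord c x).
Proof.
move=> cx; split=> [[d dx fd]|fh]; last first.
  by exists c => //; apply: filterS fh => z [].
have fd' : hol (f \o rs_param d) ((rs_coord d \o rs_param c) (rs_coord c x)).
  rewrite /= rs_coordK//; apply: filterS fd => z; by split.
apply: hol_near_eq (hol_comp (hol_transition cx dx) fd').
near=> z; rewrite /= rs_coordK//; near: z; exact: (near_param cx (near_dom dx)).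
Unshelve. all: by end_near. Qed.

Lemma local_form_lead f x n c h : local_form f x n c h -> chart_lead c f x n (h x).
Proof.
move=> [cx hx fx]; exists (h \o rs_param c); split; first exact/holo_nearP.
  by rewrite /= rs_coordK.
have := near_param_punctured cx fx; apply: filter_app.
have : \forall z \near (rs_coord c x)^', rs_cod c z.
  by apply: near_punctured; exact/near_cod/rs_coord_cod.
by apply: filterS => z zc; rewrite /= rs_paramK.
Qed.

Lemma lead_local_form f x n c v : rs_dom c x -> chart_lead c f x n v ->
  exists2 h, local_form f x n c h & h x = v.
Proof.
move=> cx [u [uh ua fu]]; exists (u \o rs_coord c) => //; split=> //.
  apply/(holo_nearP _ cx); apply: hol_near_eq uh.
  near=> z; rewrite /= rs_paramK//; near: z; exact/near_cod/rs_coord_cod.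
apply: (near_coord_punctured cx); apply: filter_app fu.
have : \forall z \near (rs_coord c x)^', rs_cod c z.
  by apply: near_punctured; exact/near_cod/rs_coord_cod.
by apply: filterS => z zc; rewrite /= rs_paramK.
Unshelve. all: by end_near. Qed.

Lemma chart_change c d x n : rs_dom c x -> rs_dom d x ->
  exists2 k : C, k != 0 & forall f v, chart_lead c f x n v -> chart_lead d f x n (k * v).
Proof.
move=> cx dx; have ch := hol_transition dx cx.
have [||k k0 H] := @lead_comp R _ (rs_coord d \o rs_param c) _ n ch.
- by rewrite /= rs_coordK//; apply/hol_cdiff/hol_transition.
- near=> z; rewrite /= rs_coordK; last by near: z; exact: (near_param dx (near_dom cx)).
  by rewrite rs_paramK//; near: z; exact/near_cod/rs_coord_cod.
exists k => // f v fv; rewrite /= rs_coordK// in H.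
apply: lead_near_eq (H _ _ fv); apply: near_punctured.
near=> z; rewrite /= rs_coordK//; near: z; exact: (near_param dx (near_dom cx)).
Unshelve. all: by end_near. Qed.

Lemma chart_lead_near c f x n v : rs_dom c x -> chart_lead c f x n v ->
  \forall y \near x^', exists2 w : C, chart_lead c f y 0 w & v != 0 -> w != 0.
Proof.
move=> cx /lead_near H; apply: (near_coord_punctured cx).
apply: filter_app H; have : \forall z \near (rs_coord c x)^', rs_cod c z.
  by apply: near_punctured; exact/near_cod/rs_coord_cod.
by apply: filterS => z zc [w fw w0]; exists w => //; rewrite /chart_lead rs_paramK.
Qed.

Section Conjugation.
Variable sigma : X -> X.
Hypothesis real_sigma : real_structure sigma.

Let sigmaK : involutive sigma. Proof. by case: real_sigma. Qed.

Lemma near_sigma x (P : X -> Prop) : (\forall y \near sigma x, P y) -> \forall y \near x, P (sigma y).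
Proof. by case: real_sigma => _ + _; exact. Qed.

Definition conj_fun f : X -> R[i] := fun y => conjc (f (sigma y)).

(** In charts, [sigma] followed by complex conjugation is a holomorphic change of coordinate [psi]
    with inverse [theta], and [conj_fun f] is the Schwarz reflection of [f] composed with [psi]. The
    factor [k] is again common to all [f]. *)
Lemma chart_conj c d x n : rs_dom c (sigma x) -> rs_dom d x ->
  exists2 k : C, k != 0 & forall f v, chart_lead c f (sigma x) n v ->
    chart_lead d (conj_fun f) x n (k * (conjc v : C)).
Proof.
move=> cx dx; have [_ _ anti] := real_sigma.
pose psi := fun w : C => conjc (rs_coord c (sigma (rs_param d w))) : C.
pose theta := conjf (fun w : C => conjc (rs_coord d (sigma (rs_param c w))) : C).
have psix : psi (rs_coord d x) = conjc (rs_coord c (sigma x)) by rewrite /psi rs_coordK.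
have dc : \forall w \near rs_coord d x, rs_dom c (sigma (rs_param d w)).
  exact: (near_param dx (near_sigma (near_dom cx))).
have [|||k k0 H] := @lead_comp R psi theta (rs_coord d x) n.
- have cz := rs_coord_cod dx; apply: filterS2 (near_cod cz) dc => w wd wc.
  by split; exact: anti.
- rewrite psix; apply: cdiff_conj; rewrite conjcK; split; apply: anti; first exact: rs_coord_cod.
  by rewrite rs_coordK// sigmaK.
- near=> w; rewrite /theta /psi /conjf !conjcK rs_coordK; last by near: w.
  by rewrite sigmaK rs_paramK//; near: w; exact/near_cod/rs_coord_cod.
exists k => // f v /lead_conj; rewrite -psix => /H; apply: lead_near_eq.
apply: near_punctured; near=> w; rewrite /conjf /psi /conj_fun /= conjcK rs_coordK//.
by near: w.
Unshelve. all: by end_near. Qed.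

End Conjugation.

Definition chart_at x : rs_chart X := projT1 (cid (rs_cover x)).

Lemma chart_atP x : rs_dom (chart_at x) x.
Proof. by rewrite /chart_at; case: cid. Qed.
Hint Resolve chart_atP : core.

(** Fixing one chart at each point makes leading coefficients unique, and not only up to a
    factor. *)
Definition leads f x n v := chart_lead (chart_at x) f x n v.

Lemma leads_near_eq f g x n v : (\forall y \near x^', f y = g y) -> leads f x n v -> leads g x n v.
Proof. by move=> /(near_param_punctured (chart_atP x)) fg; exact: lead_near_eq. Qed.

Lemma leads_cst v x : leads (fun=> v) x 0 v.
Proof. exact: lead_cst. Qed.

Lemma leadsD f g x n v w : leads f x n v -> leads g x n w -> leads (fun y => f y + g y) x n (v + w).
Proof. exact: leadD. Qed.

Lemma leadsM f g x n m v w : leads f x n v -> leads g x m w ->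
  leads (fun y => f y * g y) x (n + m) (v * w).
Proof. exact: leadM. Qed.

Lemma leadsZ (a : C) f x n v : leads f x n v -> leads (fun y => a * f y) x n (a * v).
Proof. exact: leadZ. Qed.

Lemma leadsV f x n v : v != 0 -> leads f x n v -> leads (fun y => (f y)^-1) x (- n) v^-1.
Proof. exact: leadV. Qed.

Lemma leads_uniq f x n v w : leads f x n v -> leads f x n w -> v = w.
Proof. exact: lead_uniq. Qed.

Lemma leads_succ f x n : leads f x n 0 <-> exists w, leads f x (n + 1) w.
Proof. exact: lead_succ. Qed.

Lemma leads_lt f x n m v : m < n -> leads f x n v -> leads f x m 0.
Proof. exact: lead_lt. Qed.

Lemma leads_le f x n m v : m <= n -> leads f x n v -> exists w, leads f x m w.
Proof.
rewrite le_eqVlt => /predU1P[->|mn fv]; first by exists v.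
by exists 0; exact: leads_lt fv.
Qed.

Lemma leads_order_uniq f x n m v w : v != 0 -> w != 0 -> leads f x n v -> leads f x m w -> n = m.
Proof. exact: lead_order_uniq. Qed.

Lemma leads_order_le f x n m v w : v != 0 -> leads f x n v -> leads f x m w -> m <= n.
Proof.
move=> v0 fv fw; rewrite leNgt; apply/negP => nm.
by move: v0; rewrite (leads_uniq fv (leads_lt nm fw)) eqxx.
Qed.

Lemma chart_leads c f x n v : rs_dom c x -> chart_lead c f x n v ->
  exists2 w, leads f x n w & v != 0 -> w != 0.
Proof.
move=> cx fv; have [k k0 H] := chart_change n cx (chart_atP x).
by exists (k * v); [exact: H|exact: mulf_neq0].
Qed.

Lemma leads_near f x n v : leads f x n v ->
  \forall y \near x^', exists2 w, leads f y 0 w & v != 0 -> w != 0.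
Proof.
move=> /(chart_lead_near (chart_atP x)); have := near_dom (chart_atP x).
move=> dx /dnbhsP H; apply/dnbhsP; apply: filterS2 dx H => y yc /[apply] -[w fw w0].
have [w' fw' w0'] := chart_leads yc fw; exists w' => // v0; exact/w0'/w0.
Qed.

Definition is_zero f := mero_eq f (fun=> 0).

Lemma leads_zero f x n v : (\forall y \near x^', f y = 0) -> leads f x n v -> v = 0.
Proof.
move=> f0 fv; have fv' := leads_near_eq f0 fv; apply: leads_uniq fv' _.
by exists (fun=> 0); split=> //; [exact: hol_cst|near=> z; rewrite mulr0].
Unshelve. all: by end_near. Qed.

Lemma leads_dichotomy f x n v : leads f x n v ->
  (\forall y \near x^', f y = 0) \/ exists m w, [/\ n <= m, w != 0 & leads f x m w].
Proof.
case/lead_dichotomy => [H|]; last by right.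
by left; exact: (near_coord_punctured (chart_atP x) H).
Qed.

Definition meromorphic f := forall x, exists n v, leads f x n v.
(** Finite order at every point. For meromorphic functions this is the alternative to vanishing
    identically, by the identity theorem. *)
Definition nonzero f := forall x, exists n v, v != 0 /\ leads f x n v.

Lemma near_neq_surface x y : x != y -> \forall w \near x, w != y.
Proof.
move=> xy; have := hausdorff_accessible (@rs_hausdorff _ X) xy.
case=> A [oA xA yA]; apply: filterS (open_nbhs_nbhs (conj oA (set_mem xA))) => w Aw.
by apply/negP => /eqP wy; move: yA; rewrite inE -wy; exact.
Qed.

(** The set [A] of points around which [f] vanishes is open. So is its complement: a nonzero leading
    coefficient at a point forces nonzero ones at all points nearby. Connectedness leaves two
    cases. *)
Lemma identity_theorem f : meromorphic f -> is_zero f \/ nonzero f.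
Proof.
move=> fm; pose A := [set x : X | \forall y \near x^', f y = 0].
have [[x0 Ax0]|A0] := pselect (A !=set0); last first.
  right => x; have [n [v fv]] := fm x.
  have [fx|[m [w [_ w0 fw]]]] := leads_dichotomy fv; last by exists m, w.
  by exfalso; apply: A0; exists x.
left => x; suff AT : A = [set: X] by have : [set: X] x by []; rewrite -AT.
have openA : open A.
  rewrite openE => x1 /dnbhsP fx.
  apply: filterS (near_join fx) => y fy; apply/dnbhsP.
  have [yE|yx1] := eqVneq y x1; first by rewrite yE.
  by apply: filterS2 (near_neq_surface yx1) fy => w wx1 /(_ wx1).
have openCA : open (~` A).
  rewrite openE => x1 Ax1; have [n [v fv]] := fm x1.
  have [//|[m [w [_ w0 fw]]]] := leads_dichotomy fv.
  have /dnbhsP fw' := leads_near fw; apply: filterS fw' => y H.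
  have [->//|/H[w' fwy /(_ w0) w'0]] := eqVneq y x1.
  by move=> Ay; move: w'0; rewrite (leads_zero Ay fwy) eqxx.
apply: (@rs_connected _ X A); first by exists x0.
  by exists A => //; rewrite setTI.
by exists A; [rewrite -openC|rewrite setTI].
Qed.

(** The default value 0 stands for the case where [f] has no finite order at [x]. *)
Definition ordx f x : int := xget 0 [set n | exists2 v, v != 0 & leads f x n v].

Lemma ordx_eq f x n v : v != 0 -> leads f x n v -> ordx f x = n.
Proof.
move=> v0 fv; rewrite /ordx; case: xgetP => [m -> [w w0 fw]|/(_ n)[]]; last by exists v.
exact: leads_order_uniq fw fv.
Qed.

Lemma ordxP f x : nonzero f -> exists2 v, v != 0 & leads f x (ordx f x) v.
Proof. by move=> /(_ x)[n [v [v0 fv]]]; rewrite (ordx_eq v0 fv); exists v. Qed.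

(** Compactness in its filter form, for the filter on finite sequences generated by inclusion. *)
Lemma finite_cover (U : X -> set X) : (forall x, nbhs x (U x)) ->
  exists s : seq X, uniq s /\ forall y, exists2 x, x \in s & U x y.
Proof.
move=> nU; have /compact_near_coveringP H := @rs_compact _ X.
pose F : set_system (seq X) := [set A : set (seq X) | exists s : seq X, forall t : seq X, {subset s <= t} -> A t].
have FF : Filter F.
  split; first by exists [::].
  - move=> A B [s As] [t Bt]; exists (s ++ t) => u su; split.
      by apply: As => x xs; apply: su; rewrite mem_cat xs.
    by apply: Bt => x xt; apply: su; rewrite mem_cat xt orbT.
  - by move=> A B AB [s As]; exists s => t /As/AB.
have [|s sP] := H _ F (fun t y => exists2 x, x \in t & U x y) FF.
  move=> x _; exists (U x, [set t : seq X | x \in t]); last by move=> [y t] /= [Uy xt]; exists x.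
  by split; [exact: nU|exists [:: x] => t; apply; rewrite inE].
exists (undup s); split; first exact: undup_uniq.
by move=> y; have [x xs Uy] := sP s (fun _ => id) y I; exists x; rewrite ?mem_undup.
Qed.

(** Zeros and poles are isolated, hence finite in number by compactness. *)
Lemma ordx_support f : nonzero f -> exists s : seq X, forall x, ordx f x != 0 -> x \in s.
Proof.
move=> fnz; have [x|s [_ sP]] := @finite_cover (fun x => [set y | y != x -> ordx f y = 0]).
  have [v v0 fv] := ordxP x fnz; have /dnbhsP := leads_near fv.
  apply: filterS => y H /H[w fw /(_ v0) w0].
  exact: ordx_eq fw.
exists s => y; have [x xs H] := sP y.
by have [->//|/H->] := eqVneq y x; rewrite eqxx.
Qed.

End Surface.

(** * The real pencil joining 1 to a meromorphic function, locally *)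

Section Pencil.
Variables (R : realType) (X : curve R).
Notation C := R[i]^o.

Lemma lead_linear (b z : C) : exists2 v, v != 0 & lead (fun w => w - b : C) z (z == b)%:Z v.
Proof.
have [->|zb] := eqVneq z b.
  exists 1; rewrite ?oner_neq0//; exists (fun=> 1); split=> //; first exact: hol_cst.
  by near=> w; rewrite expr1z mulr1.
by exists (z - b); [rewrite subr_eq0|exact: (lead_hol (hol_subr b z))].
Unshelve. all: by end_near. Qed.

Lemma lead_prod (l : seq C) (z : C) :
  exists2 v, v != 0 & lead (fun w => \prod_(b <- l) (w - b) : C) z (count_mem z l)%:Z v.
Proof.
elim: l => [|b l [v v0 IHl]].
  exists 1; rewrite ?oner_neq0//; under eq_fun do rewrite big_nil; exact: lead_cst.
have [w w0 lw] := lead_linear b z.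
exists (w * v); first exact: mulf_neq0.
under eq_fun do rewrite big_cons.
by rewrite /= PoszD eq_sym; exact: leadM.
Qed.

Lemma lead_exp (a z : C) (m : nat) :
  exists2 v, v != 0 & lead (fun w => (w - a : R[i]) ^ (- m%:Z) : C) z (- (m * (z == a))%:Z) v.
Proof.
have [v v0 lv] := lead_prod (nseq m a) z; exists v^-1; first by rewrite invr_eq0.
have := leadV v0 lv; rewrite count_nseq /= mulnC eq_sym.
apply: lead_near_eq; near=> w; rewrite big_nseq -exprnN.
by congr (_^-1); elim: (m) => //= k ->; rewrite exprS.
Unshelve. all: by end_near. Qed.

Variable f : X -> R[i].

Definition pencil (t : R) : X -> R[i] := fun y => (1 - t)%:C + t%:C * f y.

Hypothesis fm : meromorphic f.
Hypothesis Fnz : forall t, nonzero (pencil t).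

(** Multiplying by the [m]-th power of the coordinate, where [m] bounds the pole of [f] at [x0],
    turns the pencil into a holomorphic family [H], affine in [t], to which Hurwitz' theorem
    applies; [l] lists the zeros of [H t] in [U]. The order of quantifiers matters: [U] and [m] are
    fixed before [V], into which the zeros can be forced by shrinking [dl]. *)
Lemma pencil_local (x0 : X) (t0 : R) : exists U : set X, nbhs x0 U /\ exists m : nat,
  forall V, nbhs x0 V -> exists2 dl : R, 0 < dl & forall t, `|t - t0| < dl ->
  exists l : seq X, [/\ forall b, b \in l -> U b /\ V b,
    (size l)%:Z - m%:Z = ordx (pencil t0) x0 &
    forall y, U y -> ordx (pencil t) y = (count_mem y l)%:Z - (m * (y == x0))%:Z].
Proof.
pose c := chart_at x0; have cx : rs_dom c x0 := chart_atP x0; pose z0 : C := rs_coord c x0.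
have cz0 : rs_cod c z0 := rs_coord_cod cx.
have [m [w [u [uh ua fu]]]] : exists m : nat, exists w, leads f x0 (- m%:Z) w.
  have [n [v fv]] := fm x0; exists `|n|%N; apply: leads_le fv; lia.
pose H (t : R) (z : C) : C := (1 - t)%:C * (z - z0) ^+ m + t%:C * u z.
have [r1 r10 P1] : exists2 r1 : R, 0 < r1 & forall z, modc (z - z0) < r1 ->
    [/\ rs_cod c z, cdiff u z, modc (u z) <= modc (u z0) + 1 &
    z != z0 -> forall t, pencil t (rs_param c z) = (z - z0 : R[i]) ^ (- m%:Z) * H t z].
  have [d d0 Hd] := (ccont_modcP u z0).1 (cdiff_cont (hol_cdiff uh)) 1 ltr01.
  apply/nearcP; near=> z; split; [by near: z; exact: near_cod|by near: z| |].
    have : modc (z - z0) < d by near: z; apply/nearcP; exists d.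
    move=> /Hd; have := ler_modcD (u z - u z0) (u z0); rewrite subrK; lra.
  move=> zz0 t; have zz00 : z - z0 != 0 by rewrite subr_eq0.
  have fz : z != z0 -> f (rs_param c z) = (z - z0 : R[i]) ^ (- m%:Z) * u z by near: z; exact: fu.
  have pw : (z - z0 : R[i]) ^ (- m%:Z) * (z - z0) ^+ m = 1.
    by rewrite -exprnN mulVf// expf_neq0.
  by rewrite /pencil fz// /H mulrDr (mulrCA _ (1 - t)%:C) pw mulr1 (mulrCA _ t%:C).
have Hd t z : modc (z - z0) < r1 -> cdiff (H t) z.
  move=> /P1[_ uz _ _]; apply: cdiffD; last by apply: cdiffM uz; exact: cdiff_cst.
  by apply: cdiffM; [exact: cdiff_cst|apply: cdiffX; exact: cdiff_subr].
(* If [H t0] vanished near [z0], so would [pencil t0] near [x0]. *)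
have [Hz|[k [u0 [u0d u00 HE]]]] := zero_order r10 (Hd t0).
  exfalso; have [n [v [v0 Fv]]] := Fnz t0 x0.
  suff F0 : \forall y \near x0^', pencil t0 y = 0.
    by move: v0; rewrite (leads_zero F0 Fv) eqxx.
  apply: (near_coord_punctured cx); apply/dnbhsP/nearcP; exists (r1 / 4); first by rewrite divr_gt0.
  move=> z zr zz0; have [|_ _ _ ->//] := P1 z; first by lra.
  by rewrite Hz// mulr0.
have ordE : ordx (pencil t0) x0 = k%:Z - m%:Z.
  apply: (ordx_eq u00); exists u0; split=> //; first by apply/nearcP; exists r1.
  apply/dnbhsP/nearcP; exists r1 => // z zr zz0; have [_ _ _ H1] := P1 z zr.
  have zz00 : z - z0 != 0 by rewrite subr_eq0.
  rewrite /= H1// HE mulrA (exprnP _ k) -expfzDr//.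
  by rewrite [- _ + _]addrC.
pose a := modc (u0 z0); have a0 : 0 < a by rewrite modc_gt0.
have a20 : 0 < a / 2 by rewrite divr_gt0.
have u0c : ccont u0 z0 by apply/cdiff_cont/u0d; rewrite subrr Normc.normc0.
have [r2 r20 Hr2] := (ccont_modcP u0 z0).1 u0c _ a20.
pose r' : R := Num.min r1 r2; have r'0 : 0 < r' by rewrite lt_min r10.
pose r : R := r' / 2; have r0 : 0 < r by rewrite divr_gt0.
have rr' : r < r' by rewrite /r; lra.
have r'r1 z : modc (z - z0) < r' -> modc (z - z0) < r1 by rewrite lt_min => /andP[].
have rr1 z : modc (z - z0) <= r -> modc (z - z0) < r1 by move=> h; apply/r'r1/(le_lt_trans h).
have u0b z : modc (z - z0) <= r -> a / 2 <= modc (u0 z) <= 2 * a.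
  move=> zr; have : modc (z - z0) < r2.
    by have := le_lt_trans zr rr'; rewrite lt_min => /andP[].
  move=> /Hr2 h; have := ler_modcD (u0 z - u0 z0) (u0 z0); have := ler_modcD (u0 z0 - u0 z) (u0 z).
  by rewrite !subrK (modcB (u0 z0)) -/a => h1 h2; apply/andP; split; lra.
have u0d' z : modc (z - z0) < r' -> cdiff u0 z by move/r'r1/u0d.
exists [set y | rs_dom c y /\ modc (rs_coord c y - z0 : C) < r]; split.
  apply: filterI; first exact: near_dom.
  have disc : \forall z \near z0, modc (z - z0) < r by apply/nearcP; exists r.
  exact: (rs_coord_continuous cx disc).
exists m => V nV; have /nearcP[rho1 rho10 HV] := near_param cx nV.
pose rho : R := Num.min rho1 r; have rho0 : 0 < rho by rewrite lt_min rho10.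
have [e e0 He] := hurwitz r0 rr' a20 u0d' u0b k rho0.
(* Bounds u - (z - z0)^m, the slope of [H] in [t], on the circle of radius [r]. *)
pose K : R := modc (u z0) + 1 + r ^+ m.
have K0 : 0 < K by rewrite addr_gt0 ?exprn_gt0// ltr_wpDl ?modc_ge0.
exists (e / K) => [|t tt0]; first by rewrite divr_gt0.
have [||l0 [v [sl lrho vd v0 HtE]]] := He (H t).
- by move=> z /r'r1; exact: Hd.
- move=> z zr; rewrite -HE.
  have -> : H t z - H t0 z = (t - t0)%:C * (u z - (z - z0) ^+ m).
    by rewrite /H !rmorphB /=; ring.
  rewrite Normc.normcM modc_real -[e](divfK (_ : K != 0)) ?gt_eqF//.
  have zr1 : modc (z - z0) < r1 by apply: rr1; rewrite zr.
  have [_ _ uz _] := P1 z zr1.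
  apply: ler_pM; rewrite ?modc_ge0// ?(ltW tt0)//.
  apply: le_trans (ler_modcD _ _) _; rewrite (modcN (_ ^+ m)) modcX zr /K.
  by rewrite lerD2r.
have l0r b : b \in l0 -> [/\ rs_cod c b, modc (b - z0) < r & modc (b - z0) < rho1].
  move=> /lrho; rewrite lt_min => /andP[b1 b2]; split=> //.
  by have [] := P1 b (rr1 _ (ltW b2)).
exists [seq rs_param c b | b <- l0]; split.
- move=> _ /mapP[b /l0r[bc br brho] ->]; split; last exact: HV.
  by split; [exact: rs_param_dom|rewrite rs_paramK].
- by rewrite size_map sl ordE.
move=> y [yc yr]; pose z : C := rs_coord c y.
have [v1 v10 l1] := lead_exp z0 z m; have [v2 v20 l2] := lead_prod l0 z.
have vh : hol v z.
  apply/nearcP; exists (r - modc (z - z0)); first by rewrite subr_gt0.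
  move=> w' w'z; apply: vd; have := ler_modcD (w' - z) (z - z0); rewrite addrA subrK; lra.
have v30 : v z != 0 by apply: v0; exact: ltW.
have := leadM (leadM l1 l2) (lead_hol vh); rewrite addr0.
move=> /(@lead_near_eq _ _ (pencil t \o rs_param c))-/(_ _)/(chart_leads yc).
case.
  have [d d0 Hd'] := neq_avoid [:: z0] z.
  apply/dnbhsP/nearcP; exists (Num.min d (r - modc (z - z0))).
    by rewrite lt_min d0 subr_gt0.
  move=> w'; rewrite lt_min => /andP[w'd w'r] w'z.
  have w'z0 : w' != z0.
    by have := Hd' w'; rewrite inE modc_gt0 subr_eq0 w'z w'd => /(_ isT).
  have [|_ _ _ Fw'] := P1 w'.
    apply: rr1; have := ler_modcD (w' - z) (z - z0); rewrite addrA subrK; lra.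
  by rewrite /= Fw'// HtE mulrA.
move=> w' Fw' /(_ (mulf_neq0 (mulf_neq0 v10 v20) v30)) w'0.
rewrite (ordx_eq w'0 Fw') addrC; congr (_%:Z - (m * nat_of_bool _)%:Z).
  rewrite count_map; apply: eq_in_count => b /l0r[bc _ _] /=.
  by rewrite /z; apply/eqP/eqP => [->|<-]; rewrite ?rs_coordK ?rs_paramK.
by rewrite /z; apply/eqP/eqP => [yx|->//]; rewrite -(rs_coordK yc) yx rs_coordK.
Unshelve. all: by end_near. Qed.

End Pencil.

(** * Sums over divisors, and the motion of zeros along the pencil *)

Section Degree.
Variables (R : realType) (X : curve R).
Notation C := R[i]^o.
Implicit Types (f g : X -> R[i]) (d : X -> int) (A : set X) (s : seq X).

Lemma fsum_seq d s A : uniq s -> (forall x, d x != 0 -> x \in s) ->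
  \sum_(x \in A) d x = \sum_(x <- s | x \in A) d x.
Proof.
move=> us ds; rewrite (@bigfs _ _ _ _ s (fun x => x \in A))//; last first.
  by move=> x _; apply: contraNeq => /ds.
by apply: eq_fsbigl; apply/seteqP; split=> x; rewrite /= inE.
Qed.

Lemma sum_count s (l : seq X) : uniq s -> {subset l <= s} ->
  \sum_(y <- s) (count_mem y l)%:Z = (size l)%:Z.
Proof.
move=> us; elim: l => [|x l IHl] ls; first by rewrite big1.
have xs : x \in s by apply: ls; rewrite inE eqxx.
under eq_bigr do rewrite /= PoszD; rewrite big_split /= IHl; last first.
  by move=> y yl; apply: ls; rewrite inE yl orbT.
rewrite (bigD1_seq x)//= eqxx big1_seq ?addr0//=.
by move=> y /andP[+ _]; rewrite eq_sym => /negbTE ->.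
Qed.

Lemma sum_pred1 s (x : X) (m : nat) : uniq s -> x \in s ->
  \sum_(y <- s) (m * (y == x))%:Z = m%:Z.
Proof.
move=> us xs; rewrite (bigD1_seq x)//= eqxx muln1 big1_seq ?addr0//.
by move=> y /andP[/negbTE -> _]; rewrite muln0.
Qed.

(* Swapping by an involution without fixed points pairs off the terms. *)
Lemma sum_involution_even (sigma : X -> X) d s : involutive sigma -> uniq s ->
  (forall y, y \in s -> sigma y \in s /\ sigma y != y) -> (forall y, d (sigma y) = d y) ->
  (2 %| \sum_(y <- s) d y)%Z.
Proof.
move=> sK; have [n] := ubnP (size s); elim: n s => // n IHn [|y s] /=.
  by rewrite big_nil dvdz0.
rewrite ltnS => sn /andP[ys us] ss dd.
have [sys sy] : sigma y \in s /\ sigma y != y.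
  by have [] := ss y (mem_head _ _); rewrite inE => /predU1P[->|//]; rewrite eqxx.
rewrite big_cons (perm_big _ (perm_to_rem sys)) big_cons /= dd addrA.
have d2 : (2 %| d y + d y)%Z by apply/dvdzP; exists (d y); ring.
apply: (rpredD d2); apply: IHn; rewrite ?rem_uniq// ?size_rem//.
  by rewrite (leq_ltn_trans (leq_pred _)).
move=> w; rewrite (mem_rem_uniq _ us) inE => /andP[wsy ws].
have [|sw sww] := ss w; first by rewrite inE ws orbT.
split=> //; rewrite (mem_rem_uniq _ us) inE.
have -> : sigma w != sigma y by rewrite (inj_eq (inv_inj sK)); apply: contraNneq ys => <-.
move: sw; rewrite inE => /predU1P[swy|//].
by case/eqP: wsy; rewrite -swy sK.
Qed.

Lemma leads_min f g x : (exists n v, leads f x n v) -> (exists n v, leads g x n v) ->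
  exists n v w, leads f x n v /\ leads g x n w.
Proof.
move=> [n [v fv]] [m [w gw]]; pose k := Num.min n m.
have kn : k <= n by rewrite ge_min lexx.
have km : k <= m by rewrite ge_min lexx orbT.
have [v' fv'] := leads_le kn fv; have [w' gw'] := leads_le km gw.
by exists k, v', w'.
Qed.

Lemma meroD f g : meromorphic f -> meromorphic g -> meromorphic (fun y => f y + g y).
Proof.
move=> fm gm x; have [n [v [w [fv gw]]]] := leads_min (fm x) (gm x).
by exists n, (v + w); exact: leadsD.
Qed.

Lemma meroM f g : meromorphic f -> meromorphic g -> meromorphic (fun y => f y * g y).
Proof.
move=> fm gm x; have [n [v fv]] := fm x; have [m [w gw]] := gm x.
by exists (n + m), (v * w); exact: leadsM.
Qed.

Lemma mero_cst (a : C) : meromorphic (fun _ : X => a).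
Proof. by move=> x; exists 0, a; exact: leads_cst. Qed.

Lemma nonzero_mero f : nonzero f -> meromorphic f.
Proof. by move=> fnz x; have [n [v [_ fv]]] := fnz x; exists n, v. Qed.

Lemma pencil_mero f t : meromorphic f -> meromorphic (pencil f t).
Proof. by move=> fm; apply: meroD; [exact: mero_cst|apply: meroM => //; exact: mero_cst]. Qed.

(** If the member at [t] vanishes identically, then [t] is not 0, as the member at 0 is 1; so [f] is
    a nonzero constant. *)
Lemma pencil_cases f : nonzero f ->
  (forall t, nonzero (pencil f t)) \/ (forall x, ordx f x = 0).
Proof.
move=> fnz; have [|/existsNP[t Ft]] := pselect (forall t, nonzero (pencil f t)); [by left|right=> x].
have [Fz|//] := identity_theorem (pencil_mero t (nonzero_mero fnz)).
have [v v0 fv] := ordxP x fnz.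
have t0 : t%:C != 0 :> R[i].
  apply/eqP => t0; have : (1 : C) = 0.
    apply: leads_zero (leads_cst 1 x); apply: filterS (Fz x) => y <-.
    by rewrite /pencil rmorphB /= t0 mul0r addr0 subr0.
  by move/eqP; rewrite oner_eq0.
pose a : C := - (1 - t)%:C / t%:C.
have fa : \forall y \near x^', f y = a.
  apply: filterS (Fz x) => y Fy; apply: (mulfI t0); rewrite /a [RHS]mulrC divfK//.
  by apply/eqP; rewrite -addr_eq0 addrC; apply/eqP; rewrite -Fy /pencil addrC.
have av := leads_near_eq fa fv.
have a0 : a != 0.
  apply: contraNneq v0 => a0; apply/eqP; apply: leads_zero av; near=> y; exact: a0.
exact: (leads_order_uniq v0 a0 av (leads_cst a x)).
Unshelve. all: by end_near. Qed.

(** The indicator function of the failure of [P] is continuous, so that the intermediate value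
    theorem forbids a jump between 0 and 1. *)
Lemma locally_constant (P : R -> Prop) :
  (forall t0, exists2 dl : R, 0 < dl & forall t, `|t - t0| < dl -> (P t <-> P t0)) ->
  P 0 -> P 1.
Proof.
move=> HP P0; apply: contrapT => nP1.
pose g (t : R) : R := if `[< P t >] then 0 else 1.
have gc : continuous g.
  move=> t0; have [dl dl0 H] := HP t0; apply/(@cvgrPdist_lt _ R _ (nbhs t0)) => e e0.
  apply/nbhs_ballP; exists dl => // t /=; rewrite /ball /= distrC => /H Pt.
  by rewrite /g (asbool_equiv_eq Pt) subrr normr0.
have g0 : g 0 = 0 by rewrite /g asboolT.
have g1 : g 1 = 1 by rewrite /g asboolF.
have [||c _] := @IVT R g 0 1 (1 / 2) ler01.
- exact: continuous_subspaceT.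
- by rewrite g0 g1 (min_idPl _) ?(max_idPr _)//; apply/andP; split; lra.
by rewrite /g; case: ifP => _ /eqP; rewrite eq_sym; apply/negP; apply/eqP; lra.
Qed.

Section Sums.
Variable f : X -> R[i].
Hypothesis fm : meromorphic f.
Hypothesis Fnz : forall t, nonzero (pencil f t).

(** The divisor of the points of [l] minus [m] times [x]: the zeros and poles into which the one at
    [x] breaks up when [t] moves. *)
Definition cluster (l : seq X) (m : nat) (x : X) : X -> int :=
  fun y => (count_mem y l)%:Z - (m * (y == x))%:Z.

(** The centres [xs] come from a finite cover by the sets [U] of [pencil_local] and depend on [t0]
    only; the disjoint [V] may be chosen afterwards. The [U] may overlap, but each cluster is
    supported in its own [V], so that every zero or pole belongs to exactly one centre. *)
Lemma pencil_clusters (t0 : R) : exists xs : seq X, uniq xs /\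
  forall V : X -> set X, (forall x, nbhs x (V x)) ->
  (forall x x', x \in xs -> x' \in xs -> x != x' -> V x `&` V x' = set0) ->
  exists2 dl : R, 0 < dl & forall t, `|t - t0| < dl ->
  exists (L : X -> seq X) (M : X -> nat), [/\ forall x b, x \in xs -> b \in L x -> V x b,
    forall x, x \in xs -> (size (L x))%:Z - (M x)%:Z = ordx (pencil f t0) x &
    forall y, ordx (pencil f t) y = \sum_(x <- xs) cluster (L x) (M x) x y].
Proof.
have /choice[U HU] := fun x => pencil_local fm Fnz x t0.
have /choice[M HM] : forall x, exists m : nat, forall V, nbhs x V ->
    exists2 dl : R, 0 < dl & forall t, `|t - t0| < dl ->
    exists l : seq X, [/\ forall b, b \in l -> U x b /\ V b,
    (size l)%:Z - m%:Z = ordx (pencil f t0) x &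
    forall y, U x y -> ordx (pencil f t) y = cluster l m x y].
  by move=> x; have [_] := HU x.
have [xs [uxs xsU]] := finite_cover (fun x => (HU x).1).
exists xs; split=> // V nV Vd.
have [dl dl0 Hdl] : exists2 dl : R, 0 < dl & forall t, `|t - t0| < dl -> forall x, x \in xs ->
    exists l : seq X, [/\ forall b, b \in l -> U x b /\ V x b,
    (size l)%:Z - (M x)%:Z = ordx (pencil f t0) x &
    forall y, U x y -> ordx (pencil f t) y = cluster l (M x) x y].
  elim: (xs) => [|x s [d1 d10 IH]]; first by exists 1.
  have [d2 d20 H2] := HM x _ (nV x).
  exists (Num.min d1 d2) => [|t]; rewrite lt_min ?d10// => /andP[t1 t2] x'.
  by rewrite inE => /predU1P[->|]; [exact: H2|exact: IH].
exists dl => // t /Hdl {}Hdl.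
have /choice[L HL] : forall x, exists l, x \in xs -> [/\ forall b, b \in l -> U x b /\ V x b,
    (size l)%:Z - (M x)%:Z = ordx (pencil f t0) x &
    forall y, U x y -> ordx (pencil f t) y = cluster l (M x) x y].
  move=> x; have [xxs|xNxs] := boolP (x \in xs); last by exists [::].
  by have [l Hl] := Hdl x xxs; exists l.
have clUV x y : x \in xs -> cluster (L x) (M x) x y != 0 -> U x y /\ V x y.
  move=> xxs; have [Lx _ _] := HL x xxs; rewrite /cluster.
  have [yL _|yL] := boolP (y \in L x); first by have [] := Lx y yL.
  rewrite (count_memPn yL); have [-> _|_] := eqVneq y x.
    by split; apply: nbhs_singleton; [exact: (HU x).1|exact: nV].
  by rewrite muln0 subrr eqxx.
have uniqV x x' y : x \in xs -> x' \in xs -> V x y -> V x' y -> x = x'.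
  move=> xx xx' Vy Vy'; apply/eqP/negP => /negP xNx'.
  by have : (V x `&` V x') y by []; rewrite Vd.
exists L, M; split.
- by move=> x b xxs bL; have [Lx _ _] := HL x xxs; have [] := Lx b bL.
- by move=> x xxs; have [] := HL x xxs.
move=> y; have [x xxs Uxy] := xsU y; have [_ _ Hx] := HL x xxs.
have [[x' x'xs x'y]|NZ] := pselect (exists2 x', x' \in xs & cluster (L x') (M x') x' y != 0); last first.
  rewrite big1_seq; last by move=> x' /= x'xs; apply/eqP/negP => /negP h; apply: NZ; exists x'.
  by rewrite Hx//; apply/eqP/negP => /negP h; apply: NZ; exists x.
have [Ux'y Vx'y] := clUV _ _ x'xs x'y.
rewrite (bigD1_seq x')//= big1_seq ?addr0; last first.
  move=> x'' /andP[x''x' x''xs]; apply/eqP/negP => /negP h.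
  by move: x''x'; rewrite (uniqV _ _ _ x''xs x'xs (clUV _ _ x''xs h).2 Vx'y) eqxx.
by have [_ _ Hx'] := HL x' x'xs; exact: Hx'.
Qed.

End Sums.
End Degree.

(** * Degree of principal divisors, and its parity on real components *)

Section DegreeTheorem.
Variables (R : realType) (X : curve R).
Notation C := R[i]^o.
Implicit Types (f g : X -> R[i]) (d : X -> int) (A : set X) (s : seq X).

Lemma separating_neighborhoods (N : X -> set X) (xs : seq X) : (forall x, nbhs x (N x)) ->
  exists V : X -> set X, [/\ forall x, nbhs x (V x), forall x, V x `<=` N x &
  forall x x', x \in xs -> x' \in xs -> x != x' -> V x `&` V x' = set0].
Proof.
move=> nN.
have sep (x x' : X) : x != x' -> exists B : set X * set X,
    [/\ nbhs x B.1, nbhs x' B.2 & B.1 `&` B.2 = set0].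
  have := @rs_hausdorff _ X; rewrite open_hausdorff => H.
  move=> /H[[A B] /= [xA xB] [oA oB /eqP AB]]; exists (A, B).
  by split=> //=; apply: open_nbhs_nbhs; split=> //; exact: set_mem.
have /choice[B HB] : forall xx : X * X, exists B : set X * set X, xx.1 != xx.2 ->
    [/\ nbhs xx.1 B.1, nbhs xx.2 B.2 & B.1 `&` B.2 = set0].
  move=> [x x']; have [->|/sep[B HB]] := eqVneq x x'; last by exists B.
  by exists (set0, set0).
pose W x x' := if x == x' then setT else (B (x, x')).1 `&` (B (x', x)).2.
have nW x x' : nbhs x (W x x').
  rewrite /W; case: eqVneq => [_|xx']; first exact: filterT.
  have [h1 _ _] := HB (x, x') xx'.
  have x'x : (x', x).1 != (x', x).2 by rewrite eq_sym.
  have [_ h2 _] := HB (x', x) x'x.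
  exact: filterI.
exists (fun x => N x `&` [set y | forall x', x' \in xs -> W x x' y]); split.
- move=> x; apply: filterI => //; elim: (xs) => [|x1 l IHl].
    by apply: filterS (@filterT _ _ _); move=> y _ x'; rewrite in_nil.
  apply: filterS2 IHl (nW x x1) => y IH Wy x'.
  by rewrite inE => /predU1P[->//|/IH].
- by move=> x y [].
move=> x x' xxs x'xs xx'; apply/seteqP; split=> // y [[_ /(_ _ x'xs) h1] [_ /(_ _ xxs) h2]].
move: h1 h2; rewrite /W [x' == x]eq_sym (negbTE xx') => -[h1 _] [_ h2].
by have [_ _ H] := HB (x, x') xx'; rewrite -H; split.
Qed.

Lemma ordx_pencil0 f x : ordx (pencil f 0) x = 0.
Proof.
apply: (@ordx_eq _ _ _ _ _ 1); rewrite ?oner_neq0//.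
apply: leads_near_eq (leads_cst 1 x); near=> y.
by rewrite /pencil subr0 mul0r addr0.
Unshelve. all: by end_near. Qed.

Lemma pencil1 f : pencil f 1 = f.
Proof. by apply/funext => y; rewrite /pencil subrr mul1r add0r. Qed.

Section Clusters.
Variables (xs : seq X) (L : X -> seq X) (M : X -> nat) (d : X -> int).
Hypothesis dE : forall y, d y = \sum_(x <- xs) cluster (L x) (M x) x y.

Let s := undup (xs ++ flatten (map L xs)).

Let us : uniq s. Proof. exact: undup_uniq. Qed.

Let xs_s x : x \in xs -> x \in s.
Proof. by move=> xxs; rewrite mem_undup mem_cat xxs. Qed.

Let L_s x b : x \in xs -> b \in L x -> b \in s.
Proof.
move=> xxs bL; rewrite mem_undup mem_cat; apply/orP; right.
by apply/flattenP; exists (L x) => //; exact: map_f.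
Qed.

Lemma cluster_support x y : x \in xs -> y \notin s -> cluster (L x) (M x) x y = 0.
Proof.
move=> xxs ys; rewrite /cluster (count_memPn (contra (@L_s x y xxs) ys)).
have -> : (y == x) = false by apply: contraNF ys => /eqP ->; exact: xs_s.
by rewrite muln0.
Qed.

Lemma sum_cluster x : x \in xs -> \sum_(y <- s) cluster (L x) (M x) x y = (size (L x))%:Z - (M x)%:Z.
Proof.
move=> xxs; rewrite sumrB sum_count//; first by rewrite sum_pred1// xs_s.
by move=> b; exact: L_s.
Qed.

Lemma fsum_clusters A : \sum_(y \in A) d y =
  \sum_(x <- xs) \sum_(y <- s | y \in A) cluster (L x) (M x) x y.
Proof.
rewrite (fsum_seq _ us) => [|y]; first by under eq_bigr do rewrite dE; exact: exchange_big.
apply: contraNT => ys; rewrite dE big1_seq// => x /= xxs.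
exact: cluster_support.
Qed.

Lemma fsum_clusters_total : \sum_(y \in [set: X]) d y = \sum_(x <- xs) ((size (L x))%:Z - (M x)%:Z).
Proof.
rewrite fsum_clusters; apply: eq_big_seq => x xxs; rewrite -sum_cluster//.
by apply: eq_bigl => y; rewrite in_setT.
Qed.

End Clusters.

Theorem degree_principal f : nonzero f -> \sum_(x \in [set: X]) ordx f x = 0.
Proof.
move=> fnz; have [Fnz|f0] := pencil_cases fnz; last by apply: fsbig1 => x _; exact: f0.
pose P t := \sum_(x \in [set: X]) ordx (pencil f t) x = 0.
suff: P 1 by rewrite /P pencil1.
apply: locally_constant; last by apply: fsbig1 => x _; exact: ordx_pencil0.
move=> t0; have [xs [uxs H]] := pencil_clusters (nonzero_mero fnz) Fnz t0.
have [V [nV _ dV]] := separating_neighborhoods xs (fun x => filterT : nbhs x setT).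
have [dl dl0 Hdl] := H V nV dV; exists dl => // t tt0.
(* The right-hand side does not involve [t1]. Using it for both [t] and [t0] avoids comparing [xs]
   with the support of the divisor at [t0]. *)
have total t1 : `|t1 - t0| < dl -> \sum_(x \in [set: X]) ordx (pencil f t1) x =
    \sum_(x <- xs) ordx (pencil f t0) x.
  move=> /Hdl[L [M [_ LM dE]]]; rewrite (fsum_clusters_total dE).
  by apply: eq_big_seq => x; exact: LM.
by rewrite /P !total// subrr normr0.
Qed.

Section Real.
Variable sigma : X -> X.
Hypothesis real_sigma : real_structure sigma.

Let sigmaK : involutive sigma. Proof. by case: real_sigma. Qed.

Lemma leads_conj f x n v : leads f (sigma x) n v ->
  exists2 w, leads (conj_fun sigma f) x n w & v != 0 -> w != 0.
Proof.
move=> fv; have [k k0 H] := chart_conj real_sigma n (chart_atP (sigma x)) (chart_atP x).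
exists (k * (conjc v : C)); first exact: H.
by move=> v0; rewrite mulf_neq0// conjc_eq0.
Qed.

Lemma ordx_conj f x : nonzero f -> ordx (conj_fun sigma f) x = ordx f (sigma x).
Proof.
move=> fnz; have [v v0 fv] := ordxP (sigma x) fnz; have [w fw w0] := leads_conj fv.
exact: ordx_eq (w0 v0) fw.
Qed.

Lemma ordx_near_eq f g x : nonzero f -> (\forall y \near x^', f y = g y) -> ordx g x = ordx f x.
Proof.
by move=> fnz fg; have [v v0 fv] := ordxP x fnz; exact: ordx_eq v0 (leads_near_eq fg fv).
Qed.

Definition real_function f := mero_eq (conj_fun sigma f) f.

Lemma ordx_real f x : nonzero f -> real_function f -> ordx f (sigma x) = ordx f x.
Proof.
move=> fnz fr; rewrite -ordx_conj//; apply/esym/(fun h => ordx_near_eq h (fr x)).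
by move=> y; have [v v0 /leads_conj[w fw /(_ v0) w0]] := ordxP (sigma y) fnz; exists (ordx f (sigma y)), w.
Qed.

Lemma closed_real_points : closed (real_points sigma).
Proof.
have [_ sc _] := real_sigma => x cx; apply/eqP/negP => /negP sx.
have := @rs_hausdorff _ X; rewrite open_hausdorff => H.
have [[A B] /= [xA xB] [oA oB /eqP AB]] := H _ _ sx.
have nB : nbhs x B by apply: open_nbhs_nbhs; split=> //; exact: set_mem.
have nA : nbhs x (sigma @^-1` A).
  by apply: sc; apply: open_nbhs_nbhs; split=> //; exact: set_mem.
have [y [ry [Ay By]]] := cx _ (filterI nA nB).
by move: Ay; rewrite /= ry => Ay; have : (A `&` B) y by []; rewrite AB.
Qed.

Lemma sum_real_points d s : uniq s -> (forall y, d y != 0 -> y \in s) ->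
  (forall y, d (sigma y) = d y) ->
  (2 %| \sum_(y <- s) d y - \sum_(y <- s | y \in real_points sigma) d y)%Z.
Proof.
move=> us ds dd; rewrite [X in (_ %| X - _)%Z](bigID (fun y => y \in real_points sigma))/=.
rewrite addrAC subrr add0r (bigID (fun y => d y != 0))/= [X in _ + X]big1 ?addr0; last first.
  by move=> y /andP[_ /negPn/eqP].
rewrite -big_filter; apply: (sum_involution_even sigmaK) => //; first exact: filter_uniq.
move=> y; rewrite !mem_filter => /andP[/andP[yr dy] ys].
have sy : sigma y != y by apply: contraNN yr => /eqP ?; rewrite inE.
split=> //; rewrite dd dy ds ?dd// !andbT; apply: contraNN yr; rewrite !inE /real_points /=.
by move/(can_inj sigmaK) => {2}<-.
Qed.

(** A centre in [A] is given a neighbourhood stable under [sigma] and disjoint from the real points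
    outside [A]. Its cluster is then invariant, with all its real points in [A], so that its degree
    on [A] has the parity of its total degree, which is the order at the centre for [t0]. The other
    clusters avoid [A]. *)
Theorem parity_real_component f A : nonzero f -> real_function f ->
  A `<=` real_points sigma -> closed A -> closed (real_points sigma `\` A) ->
  (2 %| \sum_(x \in A) ordx f x)%Z.
Proof.
move=> fnz fr Ar cA cB; have [Fnz|f0] := pencil_cases fnz; last first.
  by rewrite fsbig1 ?dvdz0// => x _; exact: f0.
(* Here the coefficients of the pencil have to be real. *)
have Fr t : real_function (pencil f t).
  move=> x; apply: filterS (fr x) => y; rewrite /conj_fun /pencil rmorphD rmorphM /= => ->.
  by rewrite !oppr0.
pose P t := is_true (2 %| \sum_(x \in A) ordx (pencil f t) x)%Z.
suff: P 1 by rewrite /P pencil1.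
apply: locally_constant; last by rewrite /P fsbig1 ?dvdz0// => x _; exact: ordx_pencil0.
move=> t0; have [xs [uxs H]] := pencil_clusters (nonzero_mero fnz) Fnz t0.
pose N x := if x \in A then ~` (real_points sigma `\` A) else ~` A.
have nN x : nbhs x (N x).
  rewrite /N; case: ifPn => xA; apply: open_nbhs_nbhs; split; try by rewrite openC.
    by rewrite inE in xA; move=> [].
  by move=> Ax; move/negP: xA; apply; rewrite inE.
have [V' [nV' VN' dV']] := separating_neighborhoods xs nN.
pose V x := if x \in A then V' x `&` sigma @^-1` V' x else V' x.
have VV' x : V x `<=` V' x by rewrite /V; case: ifP => _ // y [].
have nV x : nbhs x (V x).
  rewrite /V; case: ifPn => // xA; apply: filterI => //.
  apply: (near_sigma real_sigma); have -> : sigma x = x by apply: Ar; rewrite inE in xA.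
  exact: nV'.
have dV x x' : x \in xs -> x' \in xs -> x != x' -> V x `&` V x' = set0.
  move=> xxs x'xs xx'; apply/seteqP; split=> // y [/VV' h /VV' h'].
  by rewrite -(dV' _ _ xxs x'xs xx').
have [dl dl0 Hdl] := H V nV dV; exists dl => // t tt0.
suff total t1 : `|t1 - t0| < dl -> (2 %| \sum_(x \in A) ordx (pencil f t1) x -
    \sum_(x <- xs | x \in A) ordx (pencil f t0) x)%Z.
  have h1 := total _ tt0; have h2 : `|t0 - t0| < dl by rewrite subrr normr0.
  have {}h2 := total _ h2; have h3 := rpredB h1 h2; rewrite opprB addrA subrK in h3.
  rewrite /P; split=> h4; first by have := rpredB h4 h3; rewrite subKr.
  by have := rpredD h3 h4; rewrite subrK.
move=> /Hdl[L [M [LV LM dE]]]; pose e x := cluster (L x) (M x) x.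
have eV x y : x \in xs -> e x y != 0 -> V x y.
  move=> xxs; rewrite /e /cluster; have [yL _|yL] := boolP (y \in L x); first exact: LV.
  rewrite (count_memPn yL); have [-> _|_] := eqVneq y x; first exact: nbhs_singleton.
  by rewrite muln0 subrr eqxx.
have ed x y : x \in xs -> V x y -> e x y = ordx (pencil f t1) y.
  move=> xxs Vy; rewrite dE (bigD1_seq x)//= big1_seq ?addr0// => x' /andP[x'x x'xs].
  apply/eqP/negP => /negP /(eV _ _ x'xs) V'y.
  by have : (V x' `&` V x) y by []; rewrite dV.
(* On the symmetric set [V x] the cluster is the divisor of a real function, and it vanishes
   elsewhere. *)
have es x y : x \in xs -> x \in A -> e x (sigma y) = e x y.
  move=> xxs xA; have Vs y' : V x y' -> V x (sigma y').
    by rewrite /V xA => -[h1 h2]; split=> //=; rewrite sigmaK.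
  have [Vy|nVy] := pselect (V x y).
    by rewrite !ed//; [exact: ordx_real|exact: Vs].
  have -> : e x y = 0 by apply/eqP/negP => /negP /eV; auto.
  apply/eqP/negP => /negP /(eV _ _ xxs)/Vs; rewrite sigmaK; auto.
rewrite (fsum_clusters dE) (bigID (fun x => x \in A))/= addrAC.
rewrite [X in (_ %| _ + X)%Z]big1_seq ?addr0; last first.
  move=> x /andP[xA xxs]; apply: big1 => y yA; apply/eqP/negP => /negP /(eV _ _ xxs)/VV'/VN'.
  by rewrite /N (negbTE xA); apply; rewrite inE in yA.
rewrite -sumrB big_seq_cond; apply: rpred_sum => x /andP[xxs xA].
rewrite -LM// -(sum_cluster L M xxs).
set s := undup _; rewrite -[X in (_ %| X)%Z]opprB rpredN.
have -> : \sum_(y <- s | y \in A) e x y = \sum_(y <- s | y \in real_points sigma) e x y.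
  rewrite !(big_mkcond (fun y => y \in _)); apply: eq_bigr => y _.
  have [yA|yA] := boolP (y \in A).
    by rewrite ifT// inE; apply: Ar; rewrite inE in yA.
  case: ifP => // yr; apply/esym/eqP/negP => /negP /(eV _ _ xxs)/VV'/VN'.
  rewrite /N xA; apply; split; first by rewrite inE in yr.
  by move=> Ay; move/negP: yA; apply; rewrite inE.
apply: sum_real_points; first exact: undup_uniq.
  move=> y; apply: contraNT => h; apply/eqP; exact: cluster_support xxs h.
by move=> y; exact: es.
Qed.

End Real.
End DegreeTheorem.

(** * Ovals, marked points and sections vanishing at them *)

Section MarkedCurve.
Variables (R : realType) (X : curve R) (sigma : X -> X) (g : nat).
Variables (oval : 'I_g.+1 -> set X) (p : 'I_g.+3 -> X) (ty : mhv_type g.+3).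
Hypothesis mhv : smooth_mhv sigma oval p ty.
Notation C := R[i]^o.
Implicit Types (f : X -> R[i]) (E Z : X -> int).

Let curve_M : m_curve sigma oval. Proof. by case: mhv. Qed.
Let real_sigma : real_structure sigma. Proof. by case: curve_M. Qed.
Let sigmaK : involutive sigma. Proof. by case: real_sigma. Qed.
Let p_inj : injective p. Proof. by case: mhv. Qed.

Lemma ovalP j : exists2 x, real_points sigma x & oval j = connected_component (real_points sigma) x.
Proof.
have [_ _ _ E] := curve_M; have : range oval (oval j) by exists j.
by rewrite -E => -[x rx <-]; exists x.
Qed.

Lemma oval_real j : oval j `<=` real_points sigma.
Proof. by have [x _ ->] := ovalP j; exact: connected_component_sub. Qed.

Lemma oval_cover x : real_points sigma x -> exists j, oval j x.
Proof.
move=> rx; have [_ _ _ E] := curve_M.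
have : [set connected_component (real_points sigma) x | x in real_points sigma]
    (connected_component (real_points sigma) x) by exists x.
by rewrite E => -[j _ jE]; exists j; rewrite jE; exact: connected_component_refl.
Qed.

Lemma oval_disjoint j k x : oval j x -> oval k x -> j = k.
Proof.
have [y ry jE] := ovalP j; have [z rz kE] := ovalP k; rewrite jE kE => yx zx.
have [_ _ oval_inj _] := curve_M; apply: oval_inj; rewrite jE kE.
apply/seteqP; split=> t; apply: connected_component_trans.
  exact: connected_component_trans zx (connected_component_sym yx).
exact: connected_component_trans yx (connected_component_sym zx).
Qed.

Lemma oval_closed j : closed (oval j).
Proof.
by have [x _ ->] := ovalP j; apply: component_closed; exact: closed_real_points.
Qed.

(** The rest of the real locus is the finite union of the other ovals. *)
Lemma oval_compl_closed j : closed (real_points sigma `\` oval j).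
Proof.
have -> : real_points sigma `\` oval j = \bigcup_(k in [set k | k != j]) oval k.
  apply/seteqP; split=> x.
    by move=> [/oval_cover[k kx] jx]; exists k => //=; apply: contra_notN jx => /eqP <-.
  move=> [k /= kj kx]; split; first exact: oval_real kx.
  by move=> jx; move: kj; rewrite (oval_disjoint kx jx) eqxx.
apply: closed_bigcup => [|k _]; [exact: finite_finset | exact: oval_closed].
Qed.

(** The common feature of types A and B that enters the count of zeros. *)
Lemma oval_odd_marked j : odd #|marked_on p (oval j)|.
Proof.
have [_ _ _] := mhv; case: (ty) => [[_ [j0 [h0 h1]]]|a b [_ _ _ ->//]].
by have [->|/h1->//] := eqVneq j j0; rewrite h0.
Qed.

Let marks x : nat := \sum_(i < g.+3) (p i == x).

Let marks_le Z : (forall x, 0 <= Z x) -> (forall i, 1 <= Z (p i)) -> forall x, (marks x)%:Z <= Z x.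
Proof.
move=> Z0 Z1 x; have [[i <-]|NE] := pselect (exists i, p i = x).
  rewrite /marks (bigD1 i)//= eqxx big1 ?addn0//.
  by move=> k ki; rewrite (inj_eq p_inj) (negbTE ki).
rewrite /marks big1// => i _; case: eqP => // ix; case: NE; by exists i.
Qed.

Let sum_marks s (P : pred X) : uniq s -> (forall i, p i \in s) ->
  \sum_(x <- s | P x) (marks x)%:Z = (\sum_(i < g.+3) P (p i))%:Z.
Proof.
move=> us ps; under eq_bigr do rewrite /marks (big_morph Posz PoszD (erefl (0%N : int))).
rewrite exchange_big /=.
rewrite [in RHS](big_morph Posz PoszD (erefl (0%N : int))); apply: eq_bigr => i _.
rewrite big_mkcond (bigD1_seq (p i))//= eqxx big1 ?addr0; last first.
  by move=> x /negbTE xi; rewrite eq_sym xi if_same.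
by case: (P (p i)).
Qed.

Lemma odd_ge1 (n : int) : 0 <= n -> ~~ (2 %| n)%Z -> 1 <= n.
Proof. by case: n => // -[|n] //; rewrite dvdz0. Qed.

(* A nonzero real section T of O(E) has div T + E >= the marked points; the difference
   has odd, hence positive, degree on each of the g + 1 ovals, which is too much. *)
Lemma real_section_zero E f : is_divisor E -> degree E = (g.+1.*2)%:Z ->
  (forall j, (2 %| (\sum_(x \in oval j) E x)%R)%Z) ->
  real_function sigma f ->
  (forall x, exists v, leads f x (- E x) v) ->
  (forall i, exists v, leads f (p i) (1 - E (p i)) v) ->
  ~ nonzero f.
Proof.
move=> /finite_seqP[sE sEE] dE oE fr fE fp fnz.
have [sf sfP] := ordx_support fnz.
pose s := undup (sE ++ sf ++ codom p).
have us : uniq s by exact: undup_uniq.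
have Es x : E x != 0 -> x \in s.
  move=> Ex; rewrite mem_undup mem_cat.
  have xs : [set` sE] x by rewrite -sEE.
  by rewrite (xs : x \in sE).
have fs x : ordx f x != 0 -> x \in s by move=> /sfP xs; rewrite mem_undup !mem_cat xs orbT.
have ps i : p i \in s by rewrite mem_undup !mem_cat codom_f !orbT.
pose Z x := ordx f x + E x.
have Z0 x : 0 <= Z x.
  have [v v0 fv] := ordxP x fnz; have [w fw] := fE x.
  by have := leads_order_le v0 fv fw; rewrite /Z; lia.
have Z1 i : 1 <= Z (p i).
  have [v v0 fv] := ordxP (p i) fnz; have [w fw] := fp i.
  by have := leads_order_le v0 fv fw; rewrite /Z; lia.
pose D x := Z x - (marks x)%:Z.
(* [D] is effective because the marked points are distinct. Its degree is 2g + 2 - (g + 3) = g - 1,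
   to be contradicted by at least 1 on each of the g + 1 ovals. *)
have D0 x : 0 <= D x by rewrite subr_ge0 marks_le.
have sumD : \sum_(x <- s) D x = (g.+1.*2)%:Z - g.+3%:Z.
  rewrite sumrB big_split /= -dE /degree (fsum_seq setT us Es).
  have := degree_principal fnz; rewrite (fsum_seq setT us fs).
  have inT (h : X -> int) : \sum_(x <- s | x \in setT) h x = \sum_(x <- s) h x.
    by apply: eq_bigl => x; rewrite in_setT.
  rewrite !inT => ->; rewrite add0r; congr (_ - _).
  by rewrite sum_marks// sum1_card card_ord.
have Dj j : 1 <= \sum_(x <- s | x \in oval j) D x.
  apply: odd_ge1; first exact: sumr_ge0.
  rewrite sumrB big_split /= -(fsum_seq (oval j) us Es) -(fsum_seq (oval j) us fs).
  have Hf := parity_real_component real_sigma fnz fr (@oval_real j) (@oval_closed j) (@oval_compl_closed j).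
  apply/negP => H; have := rpredB (rpredD Hf (oE j)) H; rewrite subKr sum_marks//.
  have -> : (\sum_(i < g.+3) (p i \in oval j))%N = #|marked_on p (oval j)|.
    rewrite -sum1_card [RHS]big_mkcond /=; apply: eq_bigr => i _.
    by rewrite finset.in_set; case: ifP => [/asboolP/mem_set->//|/negbT/asboolPn xj]; rewrite memNset.
  by have := oval_odd_marked j; rewrite -[odd _]negbK -dvdn2 => /negP h /h.
have : \sum_(j < g.+1) \sum_(x <- s | x \in oval j) D x <= \sum_(x <- s) D x.
  under eq_bigr do rewrite big_mkcond; rewrite exchange_big; apply: ler_sum => x _.
  have [[j jx]|NE] := pselect (exists j, oval j x).
    rewrite (bigD1 j)//= ifT ?inE// big1 ?addr0// => k kj; rewrite ifF//.
    by apply/negP; rewrite inE => kx; move: kj; rewrite (oval_disjoint kx jx) eqxx.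
  rewrite big1// => j _; rewrite ifF//; apply/negP; rewrite inE => jx; apply: NE; by exists j.
have : \sum_(j < g.+1) (1 : int) <= \sum_(j < g.+1) \sum_(x <- s | x \in oval j) D x.
  by apply: ler_sum => j _.
rewrite sumD sumr_const card_ord; lia.
Qed.

(** Conjugation preserves [E] and permutes the marked points, so the conjugate of [f] satisfies the
    same conditions, and so do the real sections f + conj f and i (f - conj f). Both vanish, hence
    so does [f]. *)
Lemma section_zero E f : is_divisor E -> degree E = (g.+1.*2)%:Z ->
  (forall x, E (sigma x) = E x) ->
  (forall j, (2 %| (\sum_(x \in oval j) E x)%R)%Z) ->
  (forall x, exists v, leads f x (- E x) v) ->
  (forall i, exists v, leads f (p i) (1 - E (p i)) v) ->
  is_zero f.
Proof.
move=> fE dE sE oE fl fp.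
have cl x : exists v, leads (conj_fun sigma f) x (- E x) v.
  by have [v] := fl (sigma x); rewrite sE => /(leads_conj real_sigma)[w fw _]; exists w.
have cp i : exists v, leads (conj_fun sigma f) (p i) (1 - E (p i)) v.
  have [_ _ /(_ i)[j ij] _] := mhv; have [v] := fp j.
  by rewrite -ij sE => /(leads_conj real_sigma)[w fw _]; exists w.
have K (a b : C) : real_function sigma (fun y => a * f y + b * conj_fun sigma f y) ->
    is_zero (fun y => a * f y + b * conj_fun sigma f y).
  move=> Tr; have Tl x n : (exists v, leads f x n v) -> (exists v, leads (conj_fun sigma f) x n v) ->
      exists v, leads (fun y => a * f y + b * conj_fun sigma f y) x n v.
    by move=> [v fv] [w fw]; exists (a * v + b * w); apply: leadsD; exact: leadsZ.
  have Tm : meromorphic (fun y => a * f y + b * conj_fun sigma f y).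
    by move=> x; have [v Tv] := Tl x _ (fl x) (cl x); exists (- E x), v.
  have [//|Tnz] := identity_theorem Tm; exfalso.
  apply: (real_section_zero fE dE oE Tr _ _ Tnz) => [x|i]; exact: Tl.
have h1 : is_zero (fun y => 1 * f y + 1 * conj_fun sigma f y).
  apply: K => x; near=> y; rewrite /conj_fun !mul1r rmorphD /= (conjcK (f _)) sigmaK; exact: addrC.
have h2 : is_zero (fun y => 'i%C * f y + - 'i%C * conj_fun sigma f y).
  have cm (a b : R[i]) : conjc ('i%C * a + - 'i%C * b) = - 'i%C * conjc a + 'i%C * conjc b.
    case: a b => [a1 a2] [b1 b2]; apply/eqP; rewrite eq_complex /=.
    by apply/andP; split; apply/eqP; ring.
  apply: K => x; near=> y; rewrite /conj_fun cm.
  by rewrite sigmaK (conjcK (f _)) addrC.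
have i0 : 'i%C != 0 :> R[i] by rewrite eq_complex /= oner_eq0 andbF.
have t0 : (2 : R[i]) != 0 by rewrite pnatr_eq0.
move=> x; apply: filterS2 (h1 x) (h2 x) => y; rewrite !mul1r mulNr -mulrBr.
move=> e1 /eqP; rewrite mulf_eq0 (negbTE i0) /= subr_eq0 => /eqP e2.
by move: e1; rewrite -e2 -mulr2n -mulr_natl => /eqP; rewrite mulf_eq0 (negbTE t0) => /eqP.
Unshelve. all: by end_near. Qed.

End MarkedCurve.

(** * Pairs of sections without common zeros *)

Section Frames.
Variables (R : realType) (X : curve R).
Notation C := R[i]^o.
Implicit Types (x : X) (f : X -> R[i]) (D : X -> int) (s t : 'I_2 -> X -> R[i]) (v w : 'rV[R[i]]_2).

Definition pair_leads s x n v := forall k, leads (s k) x n (v 0 k).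

(** What is kept of a basis of H^0(O(D)): two sections of O(D) without common zeros, that is, a
    morphism to P^1. Neither vanishes identically, so that quotients can be formed. *)
Definition frame D s := (forall k, nonzero (s k)) /\
  forall x, exists2 v, v != 0 & pair_leads s x (- D x) v.

Definition pair_det s t : X -> R[i] := fun y => s 0 y * t 1 y - s 1 y * t 0 y.

Lemma ord2_cases (k : 'I_2) : k = 0 \/ k = 1.
Proof. by case: k => [[|[|]]//] h; [left|right]; apply/val_inj. Qed.

Lemma sum_ord2 (V : nmodType) (F : 'I_2 -> V) : \sum_k F k = F 0 + F 1.
Proof. by rewrite !big_ord_recl big_ord0 addr0; congr (_ + F _); apply/val_inj. Qed.

Lemma leads0 x n : leads (fun=> 0) x n 0.
Proof.
by exists (fun=> 0); split=> //; [exact: hol_cst|near=> z; rewrite mulr0].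
Unshelve. all: by end_near. Qed.

Lemma pair_leads_mul s x n v (M : 'M[R[i]]_2) : pair_leads s x n v ->
  pair_leads (fun k y => \sum_j M j k * s j y) x n (v *m M).
Proof.
move=> sv k; rewrite mxE sum_ord2 ![v _ _ * _]mulrC.
apply: leads_near_eq (leadsD (leadsZ (M 0 k) (sv 0)) (leadsZ (M 1 k) (sv 1))).
by near=> y; rewrite sum_ord2.
Unshelve. all: by end_near. Qed.

Lemma section_leads D f x : is_section D f ->
  exists u : C, leads f x (- D x) u.
Proof.
move=> /(_ x)[c [h fh]]; have [cx _ _] := fh.
by have [w fw _] := chart_leads cx (local_form_lead fh); exists w.
Qed.

Lemma is_section0 D : is_section D (fun=> 0).
Proof.
move=> x; exists (chart_at x).
by have [h fh _] := lead_local_form (chart_atP x) (leads0 x (- D x)); exists h.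
Qed.

(** If both coefficients vanished at [x], so would that of every section, against global
    generation. *)
Lemma basis_generates D s x : section_basis D s -> globally_generated D ->
  exists2 v, v != 0 & pair_leads s x (- D x) v.
Proof.
move=> [sD sB] /(_ x)[f [c [h [fD fh h0]]]].
have /fin_all_exists[u su] k := section_leads x (sD k).
have sv : pair_leads s x (- D x) (\row_k u k) by move=> k; rewrite mxE.
exists (\row_k u k) => //; apply/eqP => u0; rewrite u0 in sv.
have [cx _ _] := fh; have [w fw /(_ h0) w0] := chart_leads cx (local_form_lead fh).
have [a [fa _]] := sB f fD; move: w0; rewrite (leads_uniq (leads_near_eq (fa x) fw) _ (w := 0)) ?eqxx//.
have sa := leadsD (leadsZ (a 0 0) (sv 0)) (leadsZ (a 0 1) (sv 1)).
rewrite !mxE !mulr0 addr0 in sa.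
by apply: leads_near_eq sa; near=> y; rewrite sum_ord2.
Unshelve. all: by end_near. Qed.

(** The coordinates of the zero section in the basis are unique; were this combination zero, they
    would also be given by column [k] of [M], which is not zero. *)
Lemma basis_mul_nonzero D s (M : 'M[R[i]]_2) k : section_basis D s -> M \in unitmx ->
  nonzero (fun y => \sum_j M j k * s j y).
Proof.
move=> [sD sB] Mu.
have Mm : meromorphic (fun y => \sum_j M j k * s j y).
  move=> x; have /fin_all_exists[u su] j := section_leads x (sD j).
  have sv : pair_leads s x (- D x) (\row_k u k) by move=> j; rewrite mxE.
  by exists (- D x), ((\row_k u k *m M) 0 k); exact: pair_leads_mul.
have [Mz|//] := identity_theorem Mm; exfalso.
have [a [_ aU]] := sB _ (is_section0 D).
have a0 : a = 0.
  by apply: aU => x; near=> y; rewrite big1// => j _; rewrite mxE mul0r.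
have : a = (col k M)^T.
  apply: aU => x; apply: filterS (Mz x) => y My.
  transitivity (\sum_j M j k * s j y); first by rewrite My.
  by apply: eq_bigr => j _; rewrite !mxE.
rewrite a0 => /(congr1 trmx); rewrite trmxK trmx0 => M0.
have : M *m delta_mx k (0 : 'I_1) = 0 by rewrite -colE -M0.
move=> /(congr1 (mulmx (invmx M))); rewrite mulKmx// mulmx0 => /matrixP/(_ k 0)/eqP.
by rewrite !mxE !eqxx oner_eq0.
Unshelve. all: by end_near. Qed.

Lemma morphism_leads D s x v : morphism_at D s x v ->
  exists2 l : R[i], l != 0 & pair_leads s x (- D x) (l *: v).
Proof.
move=> [c [h hv]]; have [[cx _ _] _] := hv 0.
have [l l0 H] := chart_change (- D x) cx (chart_atP x); exists l => // k.
by rewrite mxE; apply: H; have [/local_form_lead sh ->] := hv k.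
Qed.

(** Normalization by PGL_2: transforming the basis by [M] gives it, up to factors, the prescribed
    values [w] at the marked points. *)
Lemma amplitude_frame g (p : 'I_g.+3 -> X) D (v w : 'I_g.+3 -> 'rV[R[i]]_2) :
  amplitude p D v -> config_equiv v w ->
  exists2 s, frame D s & forall i, exists l, pair_leads s (p i) (- D (p i)) (l *: w i).
Proof.
move=> [[_ _ _ gg] [_ [s [sB sv]]]] [M Mu vw].
exists (fun k y => \sum_j M j k * s j y).
  split=> [k|x]; first exact: basis_mul_nonzero sB Mu.
  have [u u0 su] := basis_generates x sB gg; exists (u *m M); last exact: pair_leads_mul.
  by apply: contra_neq u0 => uM; rewrite -(mulmxK Mu u) uM mul0mx.
move=> i; have [l l0 sl] := morphism_leads (sv i).
have /andP[/sub_rVP[m vm] _] := vw i; exists (l * m).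
by rewrite -scalerA -vm scalemxAl; exact: pair_leads_mul.
Qed.

Lemma det_leads s t x n m v w : pair_leads s x n v -> pair_leads t x m w ->
  leads (pair_det s t) x (n + m) (v 0 0 * w 0 1 - v 0 1 * w 0 0).
Proof.
move=> sv tw; have H := leadsD (leadsM (sv 0) (tw 1)) (leadsZ (-1) (leadsM (sv 1) (tw 0))).
by rewrite mulN1r in H; apply: leads_near_eq H; near=> y; rewrite mulN1r.
Unshelve. all: by end_near. Qed.

(** The determinant of proportional values is 0, so the coefficient at exponent [n + m] vanishes and
    one order is gained. *)
Lemma det_leads_proportional s t x n m w a b :
  pair_leads s x n (a *: w) -> pair_leads t x m (b *: w) ->
  exists u : C, leads (pair_det s t) x (n + m + 1) u.
Proof.
move=> sv tw; apply/leads_succ; have := det_leads sv tw; rewrite !mxE.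
by congr leads; ring.
Qed.

Lemma frame_order_le D s k x : frame D s -> - D x <= ordx (s k) x.
Proof.
move=> [snz /(_ x)[v _ sv]]; have [u u0 su] := ordxP x (snz k).
exact: leads_order_le u0 su (sv k).
Qed.

Lemma frame_order_eq D s x : frame D s -> ordx (s 0) x = - D x \/ ordx (s 1) x = - D x.
Proof.
move=> [snz /(_ x)[v v0 sv]]; have [v1|v1] := eqVneq (v 0 0) 0; last first.
  by left; exact: ordx_eq v1 (sv 0).
right; apply: ordx_eq (sv 1); apply: contra_neq v0 => v2.
by apply/rowP => k; rewrite mxE; have [->|->] := ord2_cases k.
Qed.

(** From s_0 t_1 = s_1 t_0, the quotients t_0 / s_0 and t_1 / s_1 have the same order at each point.
    The smaller order among the s_k is - D1 and among the t_k it is - D2, so this common order is D1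
    - D2. *)
Lemma frames_lin_equiv D1 D2 s t : frame D1 s -> frame D2 t -> is_zero (pair_det s t) ->
  lin_equiv D1 D2.
Proof.
move=> sF tF st0; have [snz _] := sF; have [tnz _] := tF.
exists (fun y => t 0 y * (s 0 y)^-1) => x; exists (chart_at x).
have [a0 a00 sa0] := ordxP x (snz 0); have [a1 a10 sa1] := ordxP x (snz 1).
have [b0 b00 tb0] := ordxP x (tnz 0); have [b1 b10 tb1] := ordxP x (tnz 1).
have E : ordx (s 0) x + ordx (t 1) x = ordx (s 1) x + ordx (t 0) x.
  apply: (leads_order_uniq _ _ (leadsM sa0 tb1)); last first.
  - apply: leads_near_eq (leadsM sa1 tb0); apply: filterS (st0 x) => y /eqP.
    by rewrite subr_eq0 => /eqP ->.
  - exact: mulf_neq0.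
  - exact: mulf_neq0.
have -> : D1 x - D2 x = ordx (t 0) x - ordx (s 0) x.
  have := frame_order_le 0 x sF; have := frame_order_le 1 x sF.
  have := frame_order_le 0 x tF; have := frame_order_le 1 x tF.
  by have := frame_order_eq x sF; have := frame_order_eq x tF; lia.
have [h fh hx] := lead_local_form (chart_atP x) (leadsM tb0 (leadsV a00 sa0)).
by exists h; split => //; rewrite hx mulf_neq0// invr_neq0.
Qed.

Lemma lin_equiv_order D1 D2 : lin_equiv D1 D2 ->
  exists2 f, nonzero f & forall x, ordx f x = D1 x - D2 x.
Proof.
move=> [f fD]; have fl x : exists2 v, v != 0 & leads f x (D1 x - D2 x) v.
  have [c [h [fh h0]]] := fD x; have [cx _ _] := fh.
  by have [w fw /(_ h0) w0] := chart_leads cx (local_form_lead fh); exists w.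
exists f => x; have [v v0 fv] := fl x; first by exists (D1 x - D2 x), v.
exact: ordx_eq v0 fv.
Qed.

Lemma mul_is_zero f h : meromorphic f -> nonzero h -> is_zero (fun y => f y * h y) -> is_zero f.
Proof.
move=> fm hnz fh0; have [//|fnz] := identity_theorem fm; exfalso.
have [x _] := @rs_nonempty _ X; have [v v0 fv] := ordxP x fnz; have [w w0 hw] := ordxP x hnz.
by have /eqP := leads_zero (fh0 x) (leadsM fv hw); rewrite mulf_eq0 (negbTE v0) (negbTE w0).
Qed.

Section Conjugation.
Variable sigma : X -> X.
Hypothesis real_sigma : real_structure sigma.

Lemma conj_pair_leads s x n v : pair_leads s (sigma x) n v ->
  exists2 l : R[i], l != 0 & pair_leads (fun k => conj_fun sigma (s k)) x n (l *: p1_conj v).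
Proof.
move=> sv; have [l l0 H] := chart_conj real_sigma n (chart_atP (sigma x)) (chart_atP x).
by exists l => // k; rewrite !mxE; apply: H; exact: sv.
Qed.

Lemma conj_frame D s : frame D s -> frame (D \o sigma) (fun k => conj_fun sigma (s k)).
Proof.
move=> [snz sv]; split=> [k x|x].
  by have [v v0 /(leads_conj real_sigma)[w fw /(_ v0) w0]] := ordxP (sigma x) (snz k); exists (ordx (s k) (sigma x)), w.
have [v v0 /conj_pair_leads[l l0 sl]] := sv (sigma x); exists (l *: p1_conj v) => //.
rewrite scaler_eq0 (negbTE l0) /=; apply: contra_neq v0 => /rowP v0.
by apply/rowP => k; have := v0 k; rewrite !mxE => /eqP; rewrite conjc_eq0 => /eqP.
Qed.

End Conjugation.
End Frames.

(** * Supports, degrees and conjugates of divisors *)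

Section Divisors.
Variables (R : realType) (X : curve R).
Implicit Types (D E : X -> int) (A : set X).

Lemma is_divisorP D : is_divisor D <-> exists2 l, uniq l & forall x, D x != 0 -> x \in l.
Proof.
split=> [/finite_seqP[l lE]|[l _ Dl]]; last exact: sub_finite_set Dl (finite_seq l).
exists (undup l) => [|x Dx]; first exact: undup_uniq.
have xl : [set` l] x by rewrite -lE.
by rewrite mem_undup (xl : x \in l).
Qed.

Lemma common_support D E : is_divisor D -> is_divisor E ->
  exists2 l, uniq l & forall x, [|| D x != 0 | E x != 0] -> x \in l.
Proof.
move=> /is_divisorP[l _ Dl] /is_divisorP[m _ Em]; exists (undup (l ++ m)) => [|x].
  exact: undup_uniq.
by rewrite mem_undup mem_cat => /orP[/Dl->//|/Em->]; rewrite orbT.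
Qed.

Lemma is_divisorD D E : is_divisor D -> is_divisor E -> is_divisor (fun x => D x + E x).
Proof.
move=> fD fE; have [l ul lP] := common_support fD fE; apply/is_divisorP; exists l => // x DE.
apply: lP; apply: contraNT DE; rewrite negb_or !negbK => /andP[/eqP-> /eqP->].
by rewrite addr0.
Qed.

Lemma fsumD D E A : is_divisor D -> is_divisor E ->
  \sum_(x \in A) (D x + E x) = \sum_(x \in A) D x + \sum_(x \in A) E x.
Proof.
move=> fD fE; have [l ul lP] := common_support fD fE.
have Dl x : D x != 0 -> x \in l by move=> Dx; apply: lP; rewrite Dx.
have El x : E x != 0 -> x \in l by move=> Ex; apply: lP; rewrite Ex orbT.
rewrite (fsum_seq A ul Dl) (fsum_seq A ul El) -big_split; apply: fsum_seq => // x DE.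
apply: lP; apply: contraNT DE; rewrite negb_or !negbK => /andP[/eqP-> /eqP->].
by rewrite addr0.
Qed.

Lemma is_divisor_involution D (sigma : X -> X) : involutive sigma -> is_divisor D ->
  is_divisor (D \o sigma).
Proof.
move=> sK /is_divisorP[l _ Dl]; apply/is_divisorP; exists (undup (map sigma l)) => [|x].
  exact: undup_uniq.
by move=> /Dl sx; rewrite mem_undup -[x]sK map_f.
Qed.

Lemma degree_involution D (sigma : X -> X) : involutive sigma -> degree (D \o sigma) = degree D.
Proof. by move=> sK; rewrite /degree (reindex_fsbigT sigma D (Bijective sK sK)). Qed.

Lemma odd_dvdzD (a b : int) : odd `|a| = odd `|b| -> (2 %| a + b)%Z.
Proof. lia. Qed.

End Divisors.

(** * Reality and injectivity of the amplitude map *)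

Section Amplitude.
Variables (R : realType) (X : curve R) (sigma : X -> X) (g : nat).
Variables (oval : 'I_g.+1 -> set X) (p : 'I_g.+3 -> X) (ty : mhv_type g.+3).
Hypothesis mhv : smooth_mhv sigma oval p ty.
Implicit Types (D E : X -> int) (v w : 'I_g.+3 -> 'rV[R[i]]_2).

Let curve_M : m_curve sigma oval. Proof. by case: mhv. Qed.
Let real_sigma : real_structure sigma. Proof. by case: curve_M. Qed.
Let sigmaK : involutive sigma. Proof. by case: real_sigma. Qed.

(** Conjugation permutes the points of the real configuration in the same way as the marked points:
    trivially in type A, by exchanging the labels [a] and [b] in type B. *)
Lemma conj_config w : match ty with
    | TypeA => forall i, (p1_conj (w i) == w i)%MS
    | TypeB a b => (p1_conj (w a) == w b)%MS /\
        forall i, i != a -> i != b -> (p1_conj (w i) == w i)%MS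
    end ->
  forall i, exists j, sigma (p i) = p j /\ exists l, p1_conj (w j) = l *: w i.
Proof.
have P (v1 v2 : 'rV[R[i]]_2) : (v1 == v2)%MS -> exists l : R[i], v1 = l *: v2.
  by move=> /andP[/sub_rVP[l ->] _]; exists l.
have Q (v1 v2 : 'rV[R[i]]_2) : (p1_conj v1 == v2)%MS -> exists l : R[i], p1_conj v2 = l *: v1.
  move=> /andP[_ /sub_rVP[l ->]]; exists (conjc l); apply/rowP => k.
  by rewrite !mxE rmorphM /= conjcK.
have [_ _ _] := mhv; case: (ty) => [[pr _] wr i|a b [ab pab pr _] [wab wr] i].
  by exists i; split; [exact: pr|exact: P].
have [->|ia] := eqVneq i a.
  by exists b; split => //; exact: Q.
have [->|ib] := eqVneq i b.
  by exists a; split; [rewrite -pab sigmaK|exact: P].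
by exists i; split; [exact: pr|exact/P/wr].
Qed.

Lemma amplitude_real D v : amplitude p D v -> real_moduli ty v -> pic_real sigma D.
Proof.
move=> Av [w [_ vw wr]]; have [s sF sp] := amplitude_frame Av vw.
have [[dD degD _ _] _] := Av; have tF := conj_frame real_sigma sF.
have dDs := is_divisor_involution sigmaK dD.
suff st0 : is_zero (pair_det (fun k => conj_fun sigma (s k)) s) by exact: frames_lin_equiv tF sF st0.
apply: (section_zero mhv (E := fun x => (D \o sigma) x + D x)) => [|||j|x|i].
- exact: is_divisorD.
- by rewrite /degree fsumD// -!/(degree _) degree_involution// degD -PoszD addnn.
- by move=> x; rewrite /= sigmaK addrC.
(* On an oval [sigma] is the identity, so the degree there is twice that of [D]. *)
- have -> : \sum_(x \in oval j) ((D \o sigma) x + D x) = \sum_(x \in oval j) (D x + D x).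
    by apply: eq_fsbigr => x /set_mem /(oval_real mhv) /= ->.
  by rewrite fsumD// odd_dvdzD.
- have [_ /(_ x)[u _ tu]] := tF; have [_ /(_ x)[u' _ su]] := sF.
  by rewrite opprD; eexists; exact: det_leads tu su.
(* At [p i] the conjugate frame takes the conjugate of the value of [s] at sigma (p i) = p j, hence
   a multiple of the conjugate of [w j], which is proportional to [w i]. *)
- have [j [ij [l wl]]] := conj_config wr i; have [m sm] := sp i; have [m' sm'] := sp j.
  rewrite -ij in sm'; have [k _] := conj_pair_leads real_sigma sm'.
  have -> : p1_conj (m' *: w j) = (conjc m' * l) *: w i.
    by rewrite -scalerA -wl; apply/rowP => q; rewrite !mxE rmorphM.
  rewrite scalerA => tk; have [u tu] := det_leads_proportional tk sm.
  exists u; have -> // : 1 - ((D \o sigma) (p i) + D (p i)) = - D (sigma (p i)) - D (p i) + 1.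
  by rewrite /=; ring.
Qed.

(** Trades [D] for an invariant divisor [E] in its class and keeps the function [f] relating them;
    the degrees agree because principal divisors have degree 0. *)
Lemma pic_component_real I D : is_divisor D -> degree D = g.+1%:Z ->
  pic_component sigma oval I D ->
  exists E f, [/\ is_divisor E, degree E = g.+1%:Z & forall x, E (sigma x) = E x] /\
    [/\ forall j, odd `|(\sum_(x \in oval j) E x)%R|%N = (j \in I),
       nonzero f & forall x, ordx f x = D x - E x].
Proof.
move=> dD degD [E [dE DE sE oE]]; have [f fnz fE] := lin_equiv_order DE.
exists E, f; split; split => //.
have [l ul lP] : exists2 l : seq X, uniq l & forall x, ordx f x != 0 -> x \in l.
  have [l lP] := ordx_support fnz; exists (undup l); first exact: undup_uniq.
  by move=> x /lP; rewrite mem_undup.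
rewrite -degD -[degree E]add0r -(degree_principal fnz) -fsumD//; last by apply/is_divisorP; exists l.
by apply: eq_fsbigr => x _; rewrite fE subrK.
Qed.

(** The determinant is a section of O(D + D'). Multiplied by [f] and [f'] it becomes a section of
    O(E + E'), whose degree on each oval is even since [E] and [E'] both have the parities
    prescribed by [I]. *)
Lemma amplitude_injective I D D' v v' :
  pic_component sigma oval I D -> pic_component sigma oval I D' ->
  amplitude p D v -> amplitude p D' v' -> config_equiv v v' -> lin_equiv D D'.
Proof.
move=> cD cD' Av Av' vv'.
(* Both frames are normalized to the values [v']: [s] through the given equivalence, [t] through the
   identity matrix. *)
have [s sF sp] := amplitude_frame Av vv'.
have vv : config_equiv v' v'.
  by exists 1%:M => [|i]; rewrite ?unitmx1// mulmx1 submx_refl.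
have [t tF tp] := amplitude_frame Av' vv.
have [[dD degD _ _] _] := Av; have [[dD' degD' _ _] _] := Av'.
have [E [f [[dE degE sE] [oE fnz fE]]]] := pic_component_real dD degD cD.
have [E' [f' [[dE' degE' sE'] [oE' fnz' fE']]]] := pic_component_real dD' degD' cD'.
apply: (frames_lin_equiv sF tF).
have det_l x : exists u : R[i], leads (pair_det s t) x (- D x - D' x) u.
  have [_ /(_ x)[u _ su]] := sF; have [_ /(_ x)[u' _ tu]] := tF.
  by eexists; exact: det_leads su tu.
have det_m : meromorphic (pair_det s t) by move=> x; have [u tu] := det_l x; exists (- D x - D' x), u.
have fl (h : X -> R[i]) : nonzero h -> forall x, exists u : R[i], leads h x (ordx h x) u.
  by move=> hnz x; have [u _ hu] := ordxP x hnz; exists u.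
have Fl x n : (exists u : R[i], leads (pair_det s t) x n u) ->
    exists u : R[i], leads (fun y => pair_det s t y * f y * f' y) x (n + (D x - E x) + (D' x - E' x)) u.
  move=> [u tu]; have [u1 fu] := fl _ fnz x; have [u2 fu'] := fl _ fnz' x.
  by rewrite -fE -fE'; eexists; exact: leadsM (leadsM tu fu) fu'.
apply: (mul_is_zero det_m fnz); apply: (mul_is_zero _ fnz').
  by apply: meroM => //; exact: nonzero_mero.
apply: (section_zero mhv (E := fun x => E x + E' x)) => [|||j|x|i].
- exact: is_divisorD.
- by rewrite /degree fsumD// -!/(degree _) degE degE' -PoszD addnn.
- by move=> x; rewrite sE sE'.
- by rewrite fsumD// odd_dvdzD// oE oE'.
- have [u Fu] := Fl x _ (det_l x); exists u.
  by have -> // : - (E x + E' x) = - D x - D' x + (D x - E x) + (D' x - E' x) by ring.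
- have [l sl] := sp i; have [l' tl] := tp i.
  have [u Fu] := Fl (p i) _ (det_leads_proportional sl tl); exists u.
  by have -> // : 1 - (E (p i) + E' (p i)) = - D (p i) - D' (p i) + 1 + (D (p i) - E (p i)) + (D' (p i) - E' (p i)) by ring.
Qed.

End Amplitude.

Theorem theorem8p6 (R : realType) (X : curve R) (sigma : X -> X) (g : nat)
    (oval : 'I_g.+1 -> set X) (p : 'I_g.+3 -> X) (ty : mhv_type g.+3)
    (mhv : smooth_mhv sigma oval p ty) :
  (forall (D : X -> int) (v : 'I_g.+3 -> 'rV[R[i]%C]_2),
     amplitude p D v -> real_moduli ty v -> pic_real sigma D) /\
  (forall I : {set 'I_g.+1}, odd #|I| = odd g.+1 ->
   forall (D D' : X -> int) (v v' : 'I_g.+3 -> 'rV[R[i]%C]_2),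
     pic_component sigma oval I D -> pic_component sigma oval I D' ->
     amplitude p D v -> amplitude p D' v' -> config_equiv v v' ->
     lin_equiv D D').
Proof.
split=> [D v|I _ D D' v v']; first exact: (amplitude_real mhv).
exact: (amplitude_injective mhv).
Qed.
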